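(* Let $K_0,K_1\subset\mathbb{R}^n$ be convex bodies with $\dim K_0=\dim K_1=k\geq 1$, with $\mathrm{vol}_k(K_0)=\mathrm{vol}_k(K_1)$, and such that the affine hulls of $K_0$ and $K_1$ are parallel. For $\lambda\in[0,1]$ let $K_\lambda=(1-\lambda)K_0+\lambda K_1$. Then for every real $p\geq 1$ and every $\lambda\in[0,1]$, $$\int_{K_\lambda}|x|^p\,d\mathcal{H}^k(x)+\int_{K_{1-\lambda}}|x|^p\,d\mathcal{H}^k(x)\;\geq\;|2\lambda-1|^p\left(\int_{K_0}|x|^p\,d\mathcal{H}^k(x)+\int_{K_1}|x|^p\,d\mathcal{H}^k(x)\right).$$ Equality holds if and only if either $\lambda\in\{0,1\}$, or ($p=1$ and there exists $u\in\mathbb{S}^{n-1}$ such that $K_0,K_1\subset\mathrm{lin}\{u\}$ and the hyperplane $\{x\in\mathbb{R}^n:\langle u,x\rangle=0\}$ separates $K_\lambda$ and $K_{1-\lambda}$).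
   Context: A convex body in $\mathbb{R}^n$ is a non-empty convex compact subset of $\mathbb{R}^n$ (not necessarily with interior points); its dimension is the dimension of its affine hull. $\mathcal{H}^k$ is the $k$-dimensional Hausdorff measure and $\mathrm{vol}_k(S)=\mathcal{H}^k(S)$ for a $k$-dimensional set $S$. $\langle\cdot,\cdot\rangle$ is the standard inner product, $|\cdot|$ the Euclidean norm, and $\mathbb{S}^{n-1}$ the Euclidean unit sphere. $\mathrm{lin}$ denotes the linear hull. The Minkowski combination is $\alpha A+\beta B=\{\alpha a+\beta b:a\in A,\,b\in B\}$. A hyperplane separates two sets if one is contained in one of the two closed half-spaces bounded by the hyperplane and the other set is contained in the other closed half-space. *)

(* Defs.v *)
From HB Require Import structures.
From mathcomp Require Import all_boot all_order all_algebra.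
From mathcomp Require Import all_classical all_reals all_analysis.

Set Implicit Arguments.
Unset Strict Implicit.
Unset Printing Implicit Defensive.

Import Order.TTheory GRing.Theory Num.Theory.
Import numFieldNormedType.Exports.

Local Open Scope classical_set_scope.
Local Open Scope ring_scope.

(* The library norm `|x| on 'rV[R]_n is the sup norm; it induces the usual
   topology, but the Euclidean structure has to be defined separately. *)
Section euclidean.
Context {R : realType} {n : nat}.
Implicit Types (x y u : 'rV[R]_n) (A B K : set 'rV[R]_n).

Definition dotp x y : R := \sum_(i < n) x ord0 i * y ord0 i.

Definition enorm x : R := Num.sqrt (dotp x x).

(* -oo for the empty set *)
Definition diam A : \bar R :=
  ereal_sup [set (enorm (z.1 - z.2))%:E | z in A `*` A].

Definition convex_body K := [/\ K !=set0, convex_set K & compact K].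

Definition affine_hull A : set 'rV[R]_n :=
  [set x | exists (m : nat) (a : 'I_m -> R) (y : 'I_m -> 'rV[R]_n),
    [/\ forall i, A (y i), \sum_i a i = 1 & x = \sum_i a i *: y i]].

Definition flat (c : 'rV[R]_n) (V : {vspace 'rV[R]_n}) : set 'rV[R]_n :=
  [set c + v | v in [set v | v \in V]].

Definition has_dim A (k : nat) :=
  exists c V, affine_hull A = flat c V /\ \dim V = k.

(* Parallelism of flats of equal dimension: they are translates of one and the
   same linear subspace. *)
Definition parallel A B :=
  exists c d V, A = flat c V /\ B = flat d V.

Definition minkowski_comb (a : R) A (b : R) B : set 'rV[R]_n :=
  [set a *: z.1 + b *: z.2 | z in A `*` B].

Definition interpolate A B (l : R) : set 'rV[R]_n :=
  minkowski_comb (1 - l) A l B.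

(* the hyperplane {x | dotp u x = b} separates A and B *)
Definition hyperplane_separates u (b : R) A B :=
  (A `<=` [set x | dotp u x <= b] /\ B `<=` [set x | b <= dotp u x]) \/
  (B `<=` [set x | dotp u x <= b] /\ A `<=` [set x | b <= dotp u x]).

End euclidean.

(* Volume of the k-dimensional Euclidean unit ball, pi^(k/2) / Gamma(k/2 + 1),
   by the recursion omega_(k+2) = 2 pi / (k+2) * omega_k. *)
Fixpoint ball_volume (R : realType) (k : nat) : R :=
  match k with
  | 0 => 1
  | 1 => 2
  | (k'.+1 as k1).+1 => 2 * pi / k1.+1%:R * ball_volume R k'
  end.

Lemma ball_volume_ge0 (R : realType) k : 0 <= ball_volume R k.
Proof.
elim/ltn_ind: k => -[|[|k]] IH //=.
by rewrite mulr_ge0 ?IH// divr_ge0// mulr_ge0// pi_ge0.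
Qed.

Section hausdorff.
Context {R : realType} {n : nat}.
Variable k : nat.
Local Notation E := 'rV[R]_n.
Implicit Types (A U : set E) (F : (set E)^nat) (d : R).
Local Open Scope ereal_scope.

(* Normalized so that on R^k the measure is Lebesgue measure. The test on the
   empty set only matters for k = 0, where diam^0 must be 0 on set0. *)
Definition hausdorff_gauge U : \bar R :=
  if U == set0 then 0
  else (ball_volume R k * (fine (diam U) / 2) ^+ k)%:E.

Definition delta_cover d A : set (set E)^nat :=
  [set F | (forall i, diam (F i) <= d%:E) /\ A `<=` \bigcup_i F i].

Definition hausdorff_delta d A : \bar R :=
  ereal_inf [set \sum_(i <oo) hausdorff_gauge (F i) | F in delta_cover d A].

Definition hausdorff A : \bar R :=
  ereal_sup [set hausdorff_delta d A | d in [set d : R | (0 < d)%R]].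

Lemma diam_set0 : diam (set0 : set E) = -oo.
Proof. by rewrite /diam set0X image_set0 ereal_sup0. Qed.

Lemma diam_ge0 U : U !=set0 -> 0 <= diam U.
Proof.
move=> [x Ux]; apply: (@le_trans _ _ (enorm (x - x))%:E).
  by rewrite lee_fin sqrtr_ge0.
by apply: ereal_sup_ubound; exists (x, x).
Qed.

Lemma hausdorff_gauge_ge0 U : 0 <= hausdorff_gauge U.
Proof.
rewrite /hausdorff_gauge; case: ifPn => // /set0P U0.
rewrite lee_fin mulr_ge0 ?ball_volume_ge0// exprn_ge0// divr_ge0//.
by rewrite fine_ge0// diam_ge0.
Qed.

Lemma hausdorff_gauge0 : hausdorff_gauge set0 = 0.
Proof. by rewrite /hausdorff_gauge eqxx. Qed.

Lemma hausdorff_delta_ge0 d A : 0 <= hausdorff_delta d A.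
Proof.
apply: le_ereal_inf_tmp => _ [F _ <-].
by apply: nneseries_ge0 => i _ _; exact: hausdorff_gauge_ge0.
Qed.

Lemma hausdorff_delta0 d : hausdorff_delta d set0 = 0.
Proof.
apply/eqP; rewrite eq_le hausdorff_delta_ge0 andbT.
apply: ereal_inf_lbound; exists (fun=> set0).
  by split=> // i; rewrite diam_set0 leNye.
by rewrite eseries0// => i _ _; exact: hausdorff_gauge0.
Qed.

Lemma le_hausdorff_delta d A B :
  A `<=` B -> hausdorff_delta d A <= hausdorff_delta d B.
Proof.
move=> AB; apply/ereal_inf_le_tmp => x [F [dF BF]] <-.
by exists F => //; split => //; exact: subset_trans AB BF.
Qed.

Lemma hausdorff_delta_sigma_subadditive d :
  sigma_subadditive (hausdorff_delta d).
Proof.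
move=> A; have [[i ioo]|] := pselect (exists i, hausdorff_delta d (A i) = +oo).
  rewrite (eseries_pinfty _ _ ioo) ?leey// => j _.
  by rewrite -ltNye (lt_le_trans _ (hausdorff_delta_ge0 _ _)).
rewrite -forallNE => Aoo.
suff add2e (e : {posnum R}) : hausdorff_delta d (\bigcup_j A j) <=
    \sum_(i <oo) hausdorff_delta d (A i) + e%:num%:E.
  by apply/lee_addgt0Pr => _/posnumP[].
rewrite (le_trans _ (epsilon_trick _ _ _))//; last first.
  by move=> j; exact: hausdorff_delta_ge0.
pose mu := hausdorff_gauge.
have muge0 U : 0 <= mu U by exact: hausdorff_gauge_ge0.
pose P j (B : (set E)^nat) := delta_cover d (A j) B /\
  \sum_(l <oo) mu (B l) <= hausdorff_delta d (A j) +
                           (e%:num / (2 ^ j.+1)%:R)%:E.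
have [G PG] : {G : ((set E)^nat)^nat & forall j, P j (G j)}.
  apply: (@choice _ _ P) => j; rewrite /P.
  have en1 : (0 < e%:num / (2 ^ j.+1)%:R :> R)%R by [].
  have fA : hausdorff_delta d (A j) \is a fin_num.
    rewrite ge0_fin_numE ?hausdorff_delta_ge0// ltey.
    exact/eqP/Aoo.
  have [x [B cB <-] xS] := lb_ereal_inf_adherent en1 fA.
  by exists B; split => //; exact/ltW.
have muG_ge0 x : 0 <= (mu \o uncurry G) x by exact: muge0.
apply: (@le_trans _ _ (\esum_(i in setT) (mu \o uncurry G) i)).
  apply: ereal_inf_lbound => /=.
  have /card_esym/ppcard_eqP[f] := card_nat2.
  exists (uncurry G \o f).
    split => [i|].
      by rewrite /= /uncurry; case: (f i) => a b /=; exact: (PG a).1.1.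
    move=> t [i _] /(PG i).1.2 [j _ Bijt].
    by exists (f^-1%FUN (i, j)) => //=; rewrite invK ?inE.
  rewrite -(esum_pred_image (mu \o uncurry G) _ xpredT) ?[fun=> _]set_true//.
  by rewrite image_eq.
rewrite (_ : esum _ _ = \sum_(i <oo) \sum_(j <oo ) mu (G i j)); last first.
  pose J : nat -> set (nat * nat) := fun i => [set (i, j) | j in setT].
  rewrite (_ : setT = \bigcup_l J l); last first.
    by rewrite predeqE => -[a b]; split => // _; exists a => //; exists b.
  rewrite esum_bigcupT /=; last 2 first.
    - apply/trivIsetP => i j _ _ ij.
      rewrite predeqE => -[p m] /=; split => //= -[] [_] _ [<-{p} _].
      by move=> [m' _] [] /esym/eqP; rewrite (negbTE ij).
    - by move=> /= [p m]; exact: muge0.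
  rewrite -(image_id [set: nat]) -fun_true esum_pred_image//; last first.
    by move=> p _; exact: esum_ge0.
  apply: eq_eseriesr => /= j _.
  rewrite -(esum_pred_image (mu \o uncurry G) (pair j) predT)//=; last first.
    by move=> ? ? _ _; exact: (@can_inj _ _ _ snd).
  by congr esum; rewrite predeqE => -[a b]; split; move=> [i _ <-]; exists i.
apply: lee_nneseries => i _; last exact: (PG i).2.
by move=> _; apply: nneseries_ge0.
Qed.

Lemma hausdorff0 : hausdorff set0 = 0.
Proof.
apply/eqP; rewrite eq_le; apply/andP; split.
  by apply: ge_ereal_sup => _ [d _ <-]; rewrite hausdorff_delta0.
by apply: ereal_sup_ubound; exists 1%R => //=; rewrite hausdorff_delta0.
Qed.

Lemma hausdorff_ge0 A : 0 <= hausdorff A.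
Proof.
apply: (@le_trans _ _ (hausdorff_delta 1 A)); first exact: hausdorff_delta_ge0.
by apply: ereal_sup_ubound; exists 1%R => //=.
Qed.

Lemma le_hausdorff : {homo hausdorff : A B / A `<=` B >-> A <= B}.
Proof.
move=> A B AB; apply: ge_ereal_sup => _ [d d0 <-].
apply: le_trans (le_hausdorff_delta d AB) _.
by apply: ereal_sup_ubound; exists d.
Qed.

Lemma hausdorff_sigma_subadditive : sigma_subadditive hausdorff.
Proof.
move=> F; apply: ge_ereal_sup => _ [d d0 <-].
apply: le_trans (hausdorff_delta_sigma_subadditive d F) _.
apply: lee_nneseries => i _; first by move=> _; exact: hausdorff_delta_ge0.
by apply: ereal_sup_ubound; exists d.
Qed.

HB.instance Definition _ := isOuterMeasure.Build R E hausdorff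
  hausdorff0 hausdorff_ge0 le_hausdorff hausdorff_sigma_subadditive.

Definition hausdorff_outer : {outer_measure set E -> \bar R} := hausdorff.

(* The measure obtained by restricting the outer measure hausdorff to its
   Caratheodory-measurable sets. *)
Definition hausdorff_measure :
    {measure set (caratheodory_type hausdorff_outer) -> \bar R} :=
  (hausdorff_outer : set (caratheodory_type hausdorff_outer) -> _).

Definition hausdorff_integral (A : set E) (f : E -> \bar R) : \bar R :=
  \int[hausdorff_measure]_(x in A) f x.

End hausdorff.

Arguments hausdorff {R n} k A.
Arguments hausdorff_outer {R} n k.
Arguments hausdorff_measure {R} n k.
Arguments hausdorff_integral {R n} k A f.

Definition moment {R : realType} {n : nat} (k : nat) (p : R)
    (A : set 'rV[R]_n) : \bar R :=
  hausdorff_integral k A (fun x => (enorm x `^ p)%:E).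

(* Main.v *)
Require Import Defs.
From mathcomp Require Import all_boot all_order all_algebra.
From mathcomp Require Import all_classical all_reals all_analysis.
From mathcomp Require Import measurable_realfun ring lra.

(* Put x' = (1 - l) x + l y and y' = l x + (1 - l) y. Since
   (1 - 2 l) x = (1 - l) x' - l y', convexity gives the pointwise inequality
   |x'|^p + |y'|^p >= |2 l - 1|^p (|x|^p + |y|^p); call the difference of the two
   sides the gap at (x, y). To integrate it, K_0 and K_1 are almost exhausted by
   finitely many boxes with parallel sides; following Hadwiger and Ohmann, these
   are cut into small boxes P_j in K_0 and Q_j in K_1 of equal volumes, such that
   any two pairs are separated by hyperplanes in a common coordinate direction.
   The boxes (1 - l) P_j + l Q_j are then disjoint, are contained in K_l, and by
   the AM-GM inequality are at least as large as P_j. Summing the pointwise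
   inequality over the pairs proves the integral inequality.

   Let 0 < l < 1. If the direction space of the bodies is not contained in the
   line spanned by a relatively interior point c of K_0, take a unit vector q
   orthogonal to c but not to all directions. Cutting K_0 along the hyperplane
   q^perp before matching leaves a positive proportion of pairs (P_j, Q_j) on
   one and the same side of q^perp, where the gap is bounded from below. So
   equality forces K_0 and K_1 to be segments of equal length on a line through
   the origin. Then K_1 is a translate of K_0, the defect is the integral of the
   gap at (x, x + w) over K_0, and the equality case is read off pointwise. *)

Set Implicit Arguments.
Unset Strict Implicit.
Unset Printing Implicit Defensive.

Import Order.TTheory GRing.Theory Num.Theory.
Import numFieldNormedType.Exports.

Local Open Scope classical_set_scope.
Local Open Scope ring_scope.

(** Hausdorff measure enters only through boxes: by translation invariance and additivity, the image
    of a box under an affine chart has measure [kappa B] times the volume of the box. Since the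
    affine hulls are parallel, one matrix [B] serves both bodies, everything scales with the same
    factor [kappa B], and what remains to be shown about this factor is that it is positive.

    The coupling is only approximate, so a strict inequality between pairs could be lost in the
    limit. Strictness therefore rests on two bounds that do not depend on the mesh: a lower bound
    for the gap at points that stay away from [q^perp], and a lower bound for the volume of the
    pairs at such points. The cut of K_1 that matches the cut of K_0 in volume need not happen at
    [q^perp]. But wherever it falls, either both upper parts lie on the nonnegative side of
    [q^perp], or both lower parts lie on the nonpositive side. *)

Section euclidean_norm.
Context {R : realType} {n : nat}.
Implicit Types (x y z u : 'rV[R]_n) (a : R).

Lemma dotpC x y : dotp x y = dotp y x.
Proof. by apply: eq_bigr => i _; rewrite mulrC. Qed.

Lemma dotpDl x y z : dotp (x + y) z = dotp x z + dotp y z.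
Proof. by rewrite /dotp -big_split; apply: eq_bigr => i _; rewrite mxE mulrDl. Qed.

Lemma dotpZl a x z : dotp (a *: x) z = a * dotp x z.
Proof. by rewrite /dotp mulr_sumr; apply: eq_bigr => i _; rewrite mxE mulrA. Qed.

Lemma dotpDr x y z : dotp z (x + y) = dotp z x + dotp z y.
Proof. by rewrite !(dotpC z) dotpDl. Qed.

Lemma dotpZr a x z : dotp z (a *: x) = a * dotp z x.
Proof. by rewrite !(dotpC z) dotpZl. Qed.

Lemma dotpNl x z : dotp (- x) z = - dotp x z.
Proof. by rewrite -scaleN1r dotpZl mulN1r. Qed.

Lemma dotpNr x z : dotp z (- x) = - dotp z x.
Proof. by rewrite !(dotpC z) dotpNl. Qed.

Lemma dotp0l z : dotp 0 z = 0.
Proof. by rewrite -(scale0r 0) dotpZl mul0r. Qed.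

Lemma dotp_ge0 x : 0 <= dotp x x.
Proof. by apply: sumr_ge0 => i _; rewrite -expr2 sqr_ge0. Qed.

Lemma enorm_ge0 x : 0 <= enorm x.
Proof. exact: sqrtr_ge0. Qed.

Lemma enorm_sqr x : enorm x ^+ 2 = dotp x x.
Proof. by rewrite sqr_sqrtr// dotp_ge0. Qed.

Lemma coord_le_enorm x i : `|x ord0 i| <= enorm x.
Proof.
rewrite -sqrtr_sqr; apply: ler_wsqrtr; rewrite /dotp (bigD1 i)//= -expr2 lerDl.
by apply: sumr_ge0 => j _; rewrite -expr2 sqr_ge0.
Qed.

Lemma enorm_eq0 x : (enorm x == 0) = (x == 0).
Proof.
apply/eqP/eqP => [x0|->]; last by rewrite /enorm dotp0l sqrtr0.
apply/rowP => i; rewrite mxE; apply/normr0_eq0/eqP.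
by rewrite eq_le normr_ge0 andbT -x0 coord_le_enorm.
Qed.

Lemma enorm0 : enorm (0 : 'rV[R]_n) = 0.
Proof. by apply/eqP; rewrite enorm_eq0. Qed.

Lemma enormZ a x : enorm (a *: x) = `|a| * enorm x.
Proof.
by rewrite /enorm dotpZl dotpZr mulrA -expr2 sqrtrM ?sqr_ge0// sqrtr_sqr.
Qed.

Lemma enormN x : enorm (- x) = enorm x.
Proof. by rewrite -scaleN1r enormZ normrN1 mul1r. Qed.

Lemma enormB x y : enorm (x - y) = enorm (y - x).
Proof. by rewrite -enormN opprB. Qed.

(** Writes the defect in the Cauchy-Schwarz inequality for [x] and [- y] as a squared norm. This
    yields the inequality itself and, later, a quantitative version for vectors in an open
    half-space. *)
Lemma cross_sqr x y : enorm (enorm y *: x + enorm x *: y) ^+ 2 =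
  2 * (enorm x * enorm y) * (enorm x * enorm y + dotp x y).
Proof.
rewrite enorm_sqr !(dotpDl, dotpDr, dotpZl, dotpZr) -!enorm_sqr (dotpC y x).
by ring.
Qed.

Lemma cauchy_schwarz x y : `|dotp x y| <= enorm x * enorm y.
Proof.
suff H z w : - (enorm z * enorm w) <= dotp z w.
  rewrite ler_norml H/=; have := H (- x) y.
  by rewrite enormN dotpNl lerN2.
have [->|z0] := eqVneq z 0; first by rewrite enorm0 mul0r dotp0l oppr0.
have [->|w0] := eqVneq w 0; first by rewrite enorm0 mulr0 dotpC dotp0l oppr0.
have p0 : 0 < enorm z * enorm w.
  by rewrite mulr_gt0// lt_def enorm_eq0 ?z0 ?w0 enorm_ge0.
have := sqr_ge0 (enorm (enorm w *: z + enorm z *: w)).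
rewrite cross_sqr pmulr_rge0; first by rewrite -lerBlDl sub0r.
by rewrite mulr_gt0.
Qed.

Lemma enormD x y : enorm (x + y) <= enorm x + enorm y.
Proof.
rewrite -(@ler_pXn2r _ 2)// ?nnegrE ?addr_ge0 ?enorm_ge0//.
rewrite enorm_sqr !(dotpDl, dotpDr) sqrrD -!enorm_sqr (dotpC y x).
have := cauchy_schwarz x y; rewrite ler_norml => /andP[_].
lra.
Qed.

Lemma ler_enormB x y : `|enorm x - enorm y| <= enorm (x - y).
Proof.
have H z w : enorm z - enorm w <= enorm (z - w).
  by rewrite lerBlDr -[X in enorm X <= _](subrK w) enormD.
by rewrite ler_norml H andbT lerNl opprB (enormB x) H.
Qed.

Lemma enorm_sum (I : Type) (r : seq I) (P : pred I) (f : I -> 'rV[R]_n) :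
  enorm (\sum_(i <- r | P i) f i) <= \sum_(i <- r | P i) enorm (f i).
Proof.
elim/big_ind2 : _ => //; first by rewrite enorm0.
by move=> x1 x2 y1 y2 h1 h2; apply: le_trans (enormD _ _) (lerD h1 h2).
Qed.

End euclidean_norm.

Lemma enorm_mulmx {R : realType} (k n : nat) (B : 'M[R]_(k, n)) (x : 'rV[R]_k)
    (r : R) : (forall i, `|x ord0 i| <= r) ->
  enorm (x *m B) <= r * \sum_i enorm (row i B).
Proof.
move=> xr; rewrite mulmx_sum_row; apply: le_trans (enorm_sum _ _ _) _.
by rewrite mulr_sumr; apply: ler_sum => i _; rewrite enormZ ler_wpM2r// enorm_ge0.
Qed.

(** * Convexity of power functions *)

Section power_inequalities.
Context {R : realType}.
Implicit Types (p s t m l : R).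

(** With s = e^L, both e^((p-1)L) >= 1 + (p-1)L and e^(-L) >= 1 - L are instances of
    [1 + x <= expR x]; multiplied by e^L they combine to the claim, and no derivative is taken. *)
Lemma powR_bernoulli p s : 1 <= p -> 0 <= s -> 1 + p * (s - 1) <= s `^ p.
Proof.
move=> p1; rewrite le_eqVlt => /predU1P[<-|s0].
  by rewrite powR0; [lra|apply: lt0r_neq0; lra].
rewrite /powR gt_eqF//; set L := ln s.
have -> : s = expR L by rewrite /L lnK.
have h1 : expR L * (1 + (p - 1) * L) <= expR (p * L).
  have -> : p * L = L + (p - 1) * L by ring.
  by rewrite expRD ler_wpM2l ?expR_ge0// expR_ge1Dx.
have h2 : expR L * (1 - L) <= 1.
  rewrite -[X in _ <= X](@expR0 R) -(subrr L) expRD ler_wpM2l ?expR_ge0//.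
  exact: expR_ge1Dx.
have : 0 <= (p - 1) * (1 - expR L * (1 - L)) by rewrite mulr_ge0; lra.
lra.
Qed.

Lemma powR_bernoulli_lt p s : 1 < p -> 0 <= s -> s != 1 ->
  1 + p * (s - 1) < s `^ p.
Proof.
move=> p1; rewrite le_eqVlt => /predU1P[<- _|s0 s1].
  by rewrite powR0; [lra|apply: lt0r_neq0; lra].
rewrite /powR gt_eqF//; set L := ln s.
have L0 : L != 0 by rewrite ln_eq0// gt_eqF.
have -> : s = expR L by rewrite /L lnK.
have h1 : expR L * (1 + (p - 1) * L) <= expR (p * L).
  have -> : p * L = L + (p - 1) * L by ring.
  by rewrite expRD ler_wpM2l ?expR_ge0// expR_ge1Dx.
have h2 : expR L * (1 - L) < 1.
  rewrite -[X in _ < X](@expR0 R) -(subrr L) expRD ltr_pM2l ?expR_gt0//.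
  by apply: expR_gt1Dx; rewrite oppr_eq0.
have : 0 < (p - 1) * (1 - expR L * (1 - L)) by rewrite mulr_gt0; lra.
lra.
Qed.

Lemma le_powR p s t : 0 <= p -> 0 <= s <= t -> s `^ p <= t `^ p.
Proof.
by move=> p0 /andP[s0 st]; apply: ge0_ler_powR => //; rewrite nnegrE// (le_trans s0).
Qed.

Lemma powR_predM p m : 0 < m -> m `^ p = m `^ (p - 1) * m.
Proof.
move=> m0; rewrite -[X in _ * X](powRr1 (ltW m0)) -powRD ?subrK//.
by rewrite (gt_eqF m0) implybT.
Qed.

Lemma powR_tangent p m t : 1 <= p -> 0 < m -> 0 <= t ->
  m `^ p + p * m `^ (p - 1) * (t - m) <= t `^ p.
Proof.
move=> p1 m0 t0; have tm0 : 0 <= t / m by rewrite divr_ge0// ltW.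
have := powR_bernoulli p1 tm0.
rewrite -(ler_pM2l (powR_gt0 p m0)) -powRM ?(ltW m0)//.
rewrite [m * (t / m)]mulrC divfK ?gt_eqF//; apply: le_trans.
rewrite (powR_predM p m0).
rewrite le_eqVlt; apply/orP; left; apply/eqP; field; exact: lt0r_neq0.
Qed.

Lemma powR_tangent_lt p m t : 1 < p -> 0 < m -> 0 <= t -> t != m ->
  m `^ p + p * m `^ (p - 1) * (t - m) < t `^ p.
Proof.
move=> p1 m0 t0 tm; have tm0 : 0 <= t / m by rewrite divr_ge0// ltW.
have tm1 : t / m != 1.
  by apply: contra tm => /eqP h; rewrite -(divfK (lt0r_neq0 m0) t) h mul1r.
have := powR_bernoulli_lt p1 tm0 tm1.
rewrite -(ltr_pM2l (powR_gt0 p m0)) -powRM ?(ltW m0)//.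
rewrite [m * (t / m)]mulrC divfK ?gt_eqF//; apply: le_lt_trans.
rewrite (powR_predM p m0).
rewrite le_eqVlt; apply/orP; left; apply/eqP; field; exact: lt0r_neq0.
Qed.

(** The tangent at the larger of the two points gives the bound, because its slope is at most the
    slope at [M]. *)
Lemma powR_lipschitz p M s t : 1 <= p -> 0 <= s <= M -> 0 <= t <= M ->
  `|s `^ p - t `^ p| <= p * M `^ (p - 1) * `|s - t|.
Proof.
move=> p1.
wlog ts : s t / t <= s.
  move=> H hs ht; have [/H|/ltW/H] := leP t s; first exact.
  by rewrite distrC (distrC s); exact.
move=> /andP[s0 sM] /andP[t0 tM].
rewrite !ger0_norm ?subr_ge0//; last by apply: le_powR; lra.
have [s00|sn0] := eqVneq s 0.
  have -> : t = s by apply/eqP; rewrite eq_le ts s00 t0.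
  by rewrite !subrr mulr0.
have sp : 0 < s by rewrite lt_def sn0.
have := powR_tangent p1 sp t0.
have : p * s `^ (p - 1) * (s - t) <= p * M `^ (p - 1) * (s - t).
  rewrite ler_wpM2r ?subr_ge0// ler_wpM2l//; first lra.
  by apply: le_powR; lra.
lra.
Qed.

(** In the average of the tangent inequalities at the mean [m], the linear terms cancel. *)
Lemma powR_convex p l s t : 1 <= p -> 0 <= l <= 1 -> 0 <= s -> 0 <= t ->
  ((1 - l) * s + l * t) `^ p <= (1 - l) * s `^ p + l * t `^ p.
Proof.
move=> p1 /andP[l0 l1] s0 t0; set m := _ + _.
have l1' : 0 <= 1 - l by lra.
have : 0 <= m by rewrite addr_ge0// mulr_ge0.
rewrite le_eqVlt => /predU1P[<-|m0].
  by rewrite powR0 ?addr_ge0 ?mulr_ge0 ?powR_ge0//; lra.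
have := ler_wpM2l l1' (powR_tangent p1 m0 s0).
have := ler_wpM2l l0 (powR_tangent p1 m0 t0).
have : (1 - l) * (p * m `^ (p - 1) * (s - m)) +
       l * (p * m `^ (p - 1) * (t - m)) = 0 by rewrite /m; ring.
lra.
Qed.

Lemma powR_strictly_convex p l s t : 1 < p -> 0 < l < 1 -> 0 <= s -> 0 <= t ->
  s != t -> ((1 - l) * s + l * t) `^ p < (1 - l) * s `^ p + l * t `^ p.
Proof.
move=> p1 /andP[l0 l1] s0 t0 st; set m := _ + _.
have l1' : 0 < 1 - l by lra.
have : 0 <= m by rewrite addr_ge0// mulr_ge0// ltW.
rewrite le_eqVlt => /predU1P[m0|m0].
  have : 0 <= (1 - l) * s by rewrite mulr_ge0//; lra.
  have : 0 <= l * t by rewrite mulr_ge0//; lra.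
  move=> lt0 ls0; have lt00 : l * t = 0 by move: m0; rewrite /m; lra.
  have ls00 : (1 - l) * s = 0 by move: m0; rewrite /m; lra.
  move: lt00 ls00 => /eqP; rewrite mulf_eq0 gt_eqF//= => /eqP t00 /eqP.
  by rewrite mulf_eq0 gt_eqF//= => /eqP s00; rewrite s00 t00 eqxx in st.
have sm : s != m.
  apply: contra st; rewrite -subr_eq0 => /eqP H.
  have : l * (s - t) = 0 by rewrite -H /m; ring.
  by move/eqP; rewrite mulf_eq0 gt_eqF//= subr_eq0.
have tm : t != m.
  apply: contra st; rewrite -subr_eq0 => /eqP H.
  have : (1 - l) * (s - t) = 0 by rewrite -[RHS]oppr0 -H /m; ring.
  by move/eqP; rewrite mulf_eq0 gt_eqF//= subr_eq0.
have h1 := powR_tangent_lt p1 m0 s0 sm; rewrite -(ltr_pM2l l1') in h1.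
have h2 := powR_tangent_lt p1 m0 t0 tm; rewrite -(ltr_pM2l l0) in h2.
have : (1 - l) * (p * m `^ (p - 1) * (s - m)) +
       l * (p * m `^ (p - 1) * (t - m)) = 0 by rewrite /m; ring.
lra.
Qed.

(** A substitute for the mean value theorem that remains valid at p = 1: in r^p = r^(p-1) r, the
    first factor is raised to s^(p-1). *)
Lemma powR_diff_ge p r s : 1 <= p -> 0 <= r <= s ->
  s `^ (p - 1) * (s - r) <= s `^ p - r `^ p.
Proof.
move=> p1 /andP[r0]; rewrite le_eqVlt => /predU1P[->|rs]; first by rewrite !subrr mulr0.
have s0 : 0 < s by lra.
have E t : 0 <= t -> t `^ p = t `^ (p - 1) * t.
  rewrite le_eqVlt => /predU1P[<-|t0].
    by rewrite powR0 ?mulr0//; apply: lt0r_neq0; lra.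
  exact: powR_predM.
rewrite !E ?(ltW s0)// mulrBr lerD2l lerN2 ler_wpM2r//.
by apply: le_powR; lra.
Qed.

End power_inequalities.

(* The identity [(1 - 2 l) x = (1 - l) a - l b] for [a = wavg l x y] and
   [b = wavg l y x] bounds the moments of [x] and [y] by those of [a] and [b]. *)
Section moment_gap.
Context {R : realType} {n : nat}.
Implicit Types (x y q : 'rV[R]_n).

Definition wavg (l : R) x y : 'rV[R]_n := (1 - l) *: x + l *: y.

Definition moment_gap (p l : R) x y : R :=
  enorm (wavg l x y) `^ p + enorm (wavg l y x) `^ p
  - `|2 * l - 1| `^ p * (enorm x `^ p + enorm y `^ p).

Lemma wavg_ge (l d s t : R) : 0 <= l <= 1 -> d <= s -> d <= t ->
  d <= (1 - l) * s + l * t.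
Proof.
move=> l01 ds dt.
have : 0 <= (1 - l) * (s - d) by rewrite mulr_ge0//; lra.
have : 0 <= l * (t - d) by rewrite mulr_ge0//; lra.
lra.
Qed.

Lemma wavg_le (l d s t : R) : 0 <= l <= 1 -> s <= d -> t <= d ->
  (1 - l) * s + l * t <= d.
Proof.
move=> l01 ds dt.
have : 0 <= (1 - l) * (d - s) by rewrite mulr_ge0//; lra.
have : 0 <= l * (d - t) by rewrite mulr_ge0//; lra.
lra.
Qed.

Lemma enorm_wavg l x y : 0 <= l <= 1 ->
  enorm (wavg l x y) <= (1 - l) * enorm x + l * enorm y.
Proof.
move=> /andP[h1 h2]; apply: le_trans (enormD _ _) _.
rewrite !enormZ !ger0_norm//; lra.
Qed.

Lemma wavgBl l x y : (1 - l) *: wavg l x y - l *: wavg l y x = (1 - 2 * l) *: x.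
Proof. by apply/rowP => i; rewrite !mxE; ring. Qed.

Variables (p l : R).
Hypotheses (p1 : 1 <= p) (l01 : 0 <= l <= 1).

(** One bracket for each of the terms in [x] and [y] that the gap subtracts. Each bracket is
    nonnegative by the triangle inequality followed by convexity of the power. *)
Lemma moment_gapE x y :
  moment_gap p l x y =
  ((1 - l) * enorm (wavg l x y) `^ p + l * enorm (wavg l y x) `^ p
     - enorm ((1 - l) *: wavg l x y - l *: wavg l y x) `^ p) +
  (l * enorm (wavg l x y) `^ p + (1 - l) * enorm (wavg l y x) `^ p
     - enorm ((1 - l) *: wavg l y x - l *: wavg l x y) `^ p).
Proof.
rewrite !wavgBl !enormZ !powRM ?enorm_ge0// [`|1 - 2 * l|]distrC /moment_gap.
move: (enorm (wavg l x y) `^ p) (enorm (wavg l y x) `^ p) => a b.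
by move: (enorm x `^ p) (enorm y `^ p) (_ `^ p) => c d e; ring.
Qed.

Lemma enorm_combB x y :
  enorm ((1 - l) *: x - l *: y) <= (1 - l) * enorm x + l * enorm y.
Proof. by rewrite -(enormN y) -scalerN; exact: enorm_wavg. Qed.

Lemma powR_enorm_combB x y : enorm ((1 - l) *: x - l *: y) `^ p <=
  ((1 - l) * enorm x + l * enorm y) `^ p.
Proof.
apply: le_powR; first exact: le_trans p1.
by rewrite enorm_ge0 enorm_combB.
Qed.

Lemma moment_gap_half x y : enorm ((1 - l) *: x - l *: y) `^ p <=
  l * enorm y `^ p + (1 - l) * enorm x `^ p.
Proof.
apply: le_trans (powR_enorm_combB x y) _.
by rewrite [leRHS]addrC; exact: powR_convex (enorm_ge0 _) (enorm_ge0 _).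
Qed.

(** Discards the second bracket of [moment_gapE] and the convexity defect of the first; what is left
    measures the failure of equality in the triangle inequality. *)
Lemma moment_gap_ge x y :
  ((1 - l) * enorm (wavg l x y) + l * enorm (wavg l y x)) `^ p -
    enorm ((1 - l) *: wavg l x y - l *: wavg l y x) `^ p <= moment_gap p l x y.
Proof.
rewrite moment_gapE.
have h1 := powR_convex p1 l01 (enorm_ge0 (wavg l x y)) (enorm_ge0 (wavg l y x)).
have h2 := moment_gap_half (wavg l y x) (wavg l x y).
apply: ler_wpDr; first by rewrite subr_ge0.
by rewrite lerD2r.
Qed.

Lemma moment_gap_ge0 x y : 0 <= moment_gap p l x y.
Proof.
apply: le_trans (moment_gap_ge x y); rewrite subr_ge0; exact: powR_enorm_combB.
Qed.

Lemma enorm_combB_sqr x y :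
  ((1 - l) * enorm x + l * enorm y) ^+ 2 - enorm ((1 - l) *: x - l *: y) ^+ 2
  = 2 * l * (1 - l) * (enorm x * enorm y + dotp x y).
Proof.
rewrite [X in _ - X]enorm_sqr !(dotpDl, dotpDr, dotpNl, dotpNr, dotpZl, dotpZr).
rewrite (dotpC y x) -!enorm_sqr.
by move: (enorm x) (enorm y) (dotp x y) => a b c; ring.
Qed.

(** Both inequalities behind [moment_gap_ge0] must be equalities. Strict convexity makes the two
    norms equal unless p = 1, and equality in the triangle inequality makes the two averages point
    in opposite directions, by [enorm_combB_sqr]. *)
Lemma moment_gap_eq0 x y : 0 < l < 1 -> moment_gap p l x y = 0 ->
  (p = 1 \/ enorm (wavg l x y) = enorm (wavg l y x)) /\
  dotp (wavg l x y) (wavg l y x) = - (enorm (wavg l x y) * enorm (wavg l y x)).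
Proof.
move=> l01' E0; have E1 := moment_gap_ge x y.
have E2 := moment_gapE x y; rewrite E0 in E1 E2.
have h1 := moment_gap_half (wavg l y x) (wavg l x y).
move: E1 E2 h1.
set a := wavg l x y; set b := wavg l y x => E1 E2 h1.
have h2 := powR_enorm_combB a b.
split.
  have [->|pn1] := eqVneq p 1; [by left|right].
  have p1' : 1 < p by rewrite lt_def pn1.
  apply/eqP; apply: contraT => ab.
  have := powR_strictly_convex p1' l01' (enorm_ge0 a) (enorm_ge0 b) ab.
  move: E2 h1 h2; move: (_ `^ p) (_ `^ p) (_ `^ p) (_ `^ p) (_ `^ p).
  by move=> *; lra.
have rs : enorm ((1 - l) *: a - l *: b) = (1 - l) * enorm a + l * enorm b.
  apply/eqP; rewrite eq_le enorm_combB//= leNgt; apply/negP => lt.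
  have : enorm ((1 - l) *: a - l *: b) `^ p <
    ((1 - l) * enorm a + l * enorm b) `^ p.
    apply: gt0_ltr_powR; rewrite ?nnegrE ?enorm_ge0//; first exact: lt_le_trans p1.
    by apply: wavg_ge; rewrite ?enorm_ge0.
  by rewrite ltNge -subr_le0 E1.
have := enorm_combB_sqr a b; rewrite rs subrr => /esym/eqP.
rewrite !mulf_eq0 pnatr_eq0/=.
have [-> ->]/= : (l == 0) = false /\ (1 - l == 0) = false.
  by case/andP: l01' => l0 l1; rewrite !gt_eqF// subr_gt0.
by rewrite addrC addr_eq0 => /eqP.
Qed.

(* Equality in the triangle inequality would force [wavg l x y] and [wavg l y x]
   to point in opposite directions, which is impossible in an open half-space. *)
Lemma moment_gap_halfspace (d M : R) q : 0 < l < 1 -> 0 < d -> enorm q = 1 ->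
  exists2 eps, 0 < eps & forall x y, enorm x <= M -> enorm y <= M ->
    d <= dotp q x -> d <= dotp q y -> eps <= moment_gap p l x y.
Proof.
move=> /andP[l0 l1] d0 q1.
have cs z : dotp q z <= enorm z.
  by have := cauchy_schwarz q z; rewrite q1 mul1r; exact: le_trans (ler_norm _).
have [dM|Md] := leP d M; last first.
  exists 1 => // x y xM _ dx _; exfalso.
  by move: Md; rewrite ltNge (le_trans dx (le_trans (cs x) xM)).
have M0 : 0 < M by exact: lt_le_trans dM.
(* [g] is a lower bound for the difference of squares in [enorm_combB_sqr]. Division by the sum of
   the two norms, at most 2M, bounds the difference itself, and [powR_diff_ge] contributes the
   factor d^(p-1). *)
pose g := 2 * l * (1 - l) * (2 * d ^+ 4 / M ^+ 2).
have g0 : 0 < g by rewrite /g !mulr_gt0 ?invr_gt0 ?exprn_gt0//; lra.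
exists (d `^ (p - 1) * (g / (2 * M))).
  by rewrite mulr_gt0 ?powR_gt0// divr_gt0// mulr_gt0.
move=> x y xM yM dx dy; apply: le_trans (moment_gap_ge x y).
have da : d <= dotp q (wavg l x y) by rewrite dotpDr !dotpZr wavg_ge.
have db : d <= dotp q (wavg l y x) by rewrite dotpDr !dotpZr wavg_ge.
have AM : enorm (wavg l x y) <= M by apply: le_trans (enorm_wavg _ _ _) (wavg_le _ _ _).
have BM : enorm (wavg l y x) <= M by apply: le_trans (enorm_wavg _ _ _) (wavg_le _ _ _).
move: (wavg l x y) (wavg l y x) da db AM BM => a b da db AM BM.
have dA : d <= enorm a by exact: le_trans da (cs _).
have dB : d <= enorm b by exact: le_trans db (cs _).
(* The vector in [cross_sqr] has inner product at least 2d^2 with the unit vector [q], so its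
   squared norm is at least 4d^4. *)
have qge : 2 * d ^+ 4 / M ^+ 2 <= enorm a * enorm b + dotp a b.
  have lw2 : 4 * d ^+ 4 <= 2 * (enorm a * enorm b) * (enorm a * enorm b + dotp a b).
    rewrite -cross_sqr (_ : 4 * d ^+ 4 = (2 * d ^+ 2) ^+ 2); last by ring.
    rewrite ler_pXn2r// ?nnegrE ?enorm_ge0 ?mulr_ge0 ?(ltW d0)//.
    apply: le_trans _ (cs _); rewrite dotpDr !dotpZr.
    have h1 : d * d <= enorm b * dotp q a by apply: ler_pM => //; exact: ltW.
    have h2 : d * d <= enorm a * dotp q b by apply: ler_pM => //; exact: ltW.
    by rewrite mulr_natl mulr2n expr2; exact: lerD.
  have csq : 0 <= enorm a * enorm b + dotp a b.
    have := cauchy_schwarz a b; rewrite ler_norml => /andP[+ _].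
    by rewrite lerNl -subr_ge0 opprK addrC.
  have M2 : enorm a * enorm b <= M ^+ 2 by rewrite expr2 ler_pM ?enorm_ge0.
  rewrite ler_pdivrMr ?exprn_gt0//.
  have := ler_wpM2r csq M2; move: lw2.
  move: (enorm a * enorm b) (_ + _) (d ^+ 4) (M ^+ 2) => u v w z; lra.
have := enorm_combB_sqr a b; have := enorm_combB a b; have := enorm_ge0 ((1 - l) *: a - l *: b).
have : d <= (1 - l) * enorm a + l * enorm b by exact: wavg_ge.
have : (1 - l) * enorm a + l * enorm b <= M by exact: wavg_le.
move: (enorm (_ - _)) (_ + _) => r s sM ds r0 rs rsE.
have gsr : g / (2 * M) <= s - r.
  have ge : g <= (s - r) * (s + r).
    rewrite -subr_sqr rsE /g ler_wpM2l// !mulr_ge0//; lra.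
  rewrite ler_pdivrMr; last by rewrite mulr_gt0.
  apply: le_trans ge _; rewrite ler_wpM2l//; lra.
apply: le_trans (powR_diff_ge p1 _); last by rewrite r0.
apply: ler_pM => //; rewrite ?powR_ge0//.
  by rewrite divr_ge0 ?(ltW g0)// mulr_ge0// ltW.
by apply: le_powR; rewrite ?subr_ge0// (ltW d0).
Qed.

End moment_gap.

(** * Hausdorff measure *)

Section hausdorff_basics.
Context {R : realType} {n : nat}.
Variable k : nat.
Local Notation E := 'rV[R]_n.
Implicit Types (A B U X : set E).

Definition translate (c : E) A : set E := [set c + x | x in A].

Lemma translateK c A : translate (- c) (translate c A) = A.
Proof.
apply/seteqP; split=> [_ [_ [x Ax <-] <-]|x Ax]; first by rewrite addKr.
by exists (c + x); [exists x|rewrite addKr].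
Qed.

Lemma diam_le A (d : R) :
  (forall x y, A x -> A y -> enorm (x - y) <= d) -> (diam A <= d%:E)%E.
Proof.
by move=> Ad; apply: ge_ereal_sup => _ [[x y] [/= Ax Ay]] <-; rewrite lee_fin Ad.
Qed.

Lemma enorm_le_diam A x y : A x -> A y -> ((enorm (x - y))%:E <= diam A)%E.
Proof. by move=> Ax Ay; apply: ereal_sup_ubound; exists (x, y). Qed.

Lemma diam_translate c A : diam (translate c A) = diam A.
Proof.
congr ereal_sup; apply/seteqP; split=> _ [[x y] /= [Ax Ay] <-].
  case: Ax Ay => x' Ax' <- [y' Ay' <-]; exists (x', y') => //=.
  by rewrite opprD addrACA subrr add0r.
exists (c + x, c + y); first by split; [exists x|exists y].
by rewrite /= opprD addrACA subrr add0r.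
Qed.

Lemma hausdorff_gauge_translate c A :
  hausdorff_gauge k (translate c A) = hausdorff_gauge k A.
Proof.
rewrite /hausdorff_gauge diam_translate.
have -> // : (translate c A == set0) = (A == set0).
apply/eqP/eqP => [h|->]; last by rewrite /translate image_set0.
by rewrite -(translateK c A) h /translate image_set0.
Qed.

Lemma hausdorff_translate c A : hausdorff k (translate c A) = hausdorff k A.
Proof.
suff H c' A' : (hausdorff k (translate c' A') <= hausdorff k A')%E.
  by apply/eqP; rewrite eq_le H/= -[X in (hausdorff k X <= _)%E](translateK c A) H.
apply: ge_ereal_sup => _ [d d0 <-]; apply: le_trans; last first.
  by apply: ereal_sup_ubound; exists d.
apply: le_ereal_inf_tmp => _ [F [dF AF] <-]; apply: ereal_inf_lbound.
exists (fun i => translate c' (F i)); last first.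
  by congr (limn _); apply/funext => m; apply: eq_bigr => i _; exact: hausdorff_gauge_translate.
split=> [i|_ [x /AF[i _ Fix] <-]]; first by rewrite diam_translate.
by exists i => //; exists x.
Qed.

Lemma hausdorff_gauge_le U (d : R) : (diam U <= d%:E)%E -> 0 <= d ->
  (hausdorff_gauge k U <= (ball_volume R k * (d / 2) ^+ k)%:E)%E.
Proof.
move=> Ud d0; rewrite /hausdorff_gauge; case: ifPn => [_|/set0P U0].
  by rewrite lee_fin mulr_ge0 ?ball_volume_ge0// exprn_ge0// divr_ge0.
have D0 := diam_ge0 U0.
have Df : diam U \is a fin_num by rewrite ge0_fin_numE// (le_lt_trans Ud) ?ltry.
rewrite lee_fin ler_wpM2l ?ball_volume_ge0// lerXn2r// ?nnegrE ?divr_ge0 ?fine_ge0//.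
by rewrite ler_wpM2r// -lee_fin fineK.
Qed.

Lemma hausdorff_delta_homo (d d' : R) A :
  d <= d' -> (hausdorff_delta k d' A <= hausdorff_delta k d A)%E.
Proof.
move=> dd'; apply/ereal_inf_le_tmp => _ [F [dF AF] <-]; exists F => //.
by split=> // i; apply: le_trans (dF i) _; rewrite lee_fin.
Qed.

Lemma hausdorff_delta_le (d : R) A : 0 < d -> (hausdorff_delta k d A <= hausdorff k A)%E.
Proof. by move=> d0; apply: ereal_sup_ubound; exists d. Qed.

(** A set of diameter at most [d] cannot meet both [A] and [B], so a cover of the union splits into
    a cover of [A] and one of [B]. Replacing the other members by [set0], of gauge 0, keeps the
    indexing by all naturals. *)
Lemma hausdorff_delta_separated (d : R) A B :
  (forall a b, A a -> B b -> d < enorm (a - b)) ->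
  (hausdorff_delta k d A + hausdorff_delta k d B <= hausdorff_delta k d (A `|` B))%E.
Proof.
move=> sep; apply: le_ereal_inf_tmp => _ [F [dF ABF] <-].
pose part X i := if pselect (F i `&` X !=set0) then F i else set0.
have partD X i : (diam (part X i) <= d%:E)%E.
  rewrite /part; case: pselect => [? |?] /=; first exact: dF.
  by rewrite diam_set0 leNye.
have partC X : X `<=` A `|` B -> X `<=` \bigcup_i part X i.
  move=> XAB x Xx; have [i _ Fix] := ABF x (XAB x Xx); exists i => //.
  by rewrite /part; case: pselect => // -[]; exists x.
have H X : X `<=` A `|` B ->
  (hausdorff_delta k d X <= \sum_(i <oo) hausdorff_gauge k (part X i))%E.
  move=> XAB; apply: ereal_inf_lbound; exists (part X) => //.
  by split; [exact: partD|exact: partC].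
apply: le_trans (leeD (H A _) (H B _)) _; [exact: subsetUl|exact: subsetUr|].
rewrite -nneseriesD => [|i _ _|i _ _]; [|exact: hausdorff_gauge_ge0..].
apply: lee_nneseries => [i _ _|i _].
  by rewrite adde_ge0 ?hausdorff_gauge_ge0.
rewrite /part; case: pselect => [hA|hA] /=; last first.
  rewrite hausdorff_gauge0 add0e; case: pselect => [hB|hB] //=.
  by rewrite hausdorff_gauge0 hausdorff_gauge_ge0.
case: pselect => [hB|hB] /=; last by rewrite hausdorff_gauge0 adde0.
case: hA hB => x [Fx Ax] [y [Fy By]].
by have := le_trans (enorm_le_diam Fx Fy) (dF i); rewrite lee_fin leNgt sep.
Qed.

Lemma hausdorff_separated (d : R) A B : 0 < d ->
  (forall a b, A a -> B b -> d < enorm (a - b)) ->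
  (hausdorff k A + hausdorff k B <= hausdorff k (A `|` B))%E.
Proof.
move=> d0 sep; set C := hausdorff k (A `|` B).
have [->|Cy] := eqVneq C +oo%E; first by rewrite leey.
have fin X : X `<=` A `|` B -> hausdorff k X \is a fin_num.
  move=> XAB; rewrite ge0_fin_numE ?hausdorff_ge0//.
  by apply: le_lt_trans (le_hausdorff _ XAB) _; rewrite ltey.
have H d1 d2 : 0 < d1 -> 0 < d2 ->
  (hausdorff_delta k d1 A + hausdorff_delta k d2 B <= C)%E.
  move=> d10 d20; pose m := Order.min d (Order.min d1 d2).
  have m0 : 0 < m by rewrite !lt_min d0 d10 d20.
  apply: le_trans; last exact: (hausdorff_delta_le _ m0).
  apply: le_trans (leeD _ _) (hausdorff_delta_separated _).
  - by apply: hausdorff_delta_homo; rewrite /m !ge_min lexx !orbT.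
  - by apply: hausdorff_delta_homo; rewrite /m !ge_min lexx !orbT.
  - by move=> a b Aa Bb; apply: le_lt_trans (sep _ _ Aa Bb); rewrite /m ge_min lexx.
have finB d2 : 0 < d2 -> hausdorff_delta k d2 B \is a fin_num.
  move=> d20; rewrite ge0_fin_numE ?hausdorff_delta_ge0//.
  apply: le_lt_trans (hausdorff_delta_le _ d20) _.
  by rewrite -ge0_fin_numE ?hausdorff_ge0// fin//; exact: subsetUr.
have finA := fin A (@subsetUl _ A B).
rewrite addeC -leeBrDr//; apply: ge_ereal_sup => _ [d2 d20 <-].
rewrite leeBrDr//.
rewrite addeC -leeBrDr ?finB//.
apply: ge_ereal_sup => _ [d1 d10 <-].
by rewrite leeBrDr ?finB// H.
Qed.

End hausdorff_basics.

(** * Caratheodory measurability of sublevel sets of Lipschitz functions *)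

Section caratheodory_measurability.
Context {R : realType} {n : nat}.
Variables (k : nat) (f : 'rV[R]_n -> R) (C : R).
Hypothesis fC : forall x y, `|f x - f y| <= C * enorm (x - y).
Local Notation mu := (@hausdorff R n k).

Let C0 : 0 < `|C| + 1. Proof. by rewrite ltr_wpDl. Qed.

Lemma lipschitz_separated (s t : R) (A B : set 'rV[R]_n) : s < t ->
  A `<=` [set x | f x <= s] -> B `<=` [set x | t <= f x] ->
  (mu A + mu B <= mu (A `|` B))%E.
Proof.
move=> st As Bt; apply: (@hausdorff_separated _ _ _ ((t - s) / 2 / (`|C| + 1))).
  by rewrite !divr_gt0// subr_gt0.
move=> a b /As/= fa /Bt/= fb; rewrite ltr_pdivrMr//.
have h1 : t - s <= `|f a - f b|.
  rewrite distrC; apply: le_trans (ler_norm _); lra.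
have h2 : C * enorm (a - b) <= enorm (a - b) * (`|C| + 1).
  rewrite mulrC ler_wpM2l ?enorm_ge0//; have := ler_norm C; lra.
have := le_trans h1 (le_trans (fC _ _) h2); lra.
Qed.

Variables (t : R) (X : set 'rV[R]_n).
Let r (j : nat) : R := t - j.+1%:R^-1.
Let Xl j := X `&` [set x | f x <= r j].
Let Xr j := X `&` [set x | r j < f x <= r j.+1].

Let r_lt j : r j < r j.+1.
Proof. by rewrite ltrD2l ltrN2 ltf_pV2 ?posrE ?ltr0n// ltr_nat. Qed.

(** A whole layer lies between [Xl N] and [Xr N.+1], so these sets are at positive distance and each
    new layer can be absorbed into the next sublevel set. The right-hand side is at most twice the
    measure of [X], hence the series of layers converges. *)
Let layer_sum N : (\sum_(i < N) mu (Xr i.+1) <= mu (Xl N) + mu (Xl N.+1))%E.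
Proof.
elim: N => [|N IH]; first by rewrite big_ord0 adde_ge0 ?hausdorff_ge0.
rewrite big_ord_recr/=; apply: le_trans (leeD IH (lexx _)) _.
rewrite addeAC [leLHS]addeC leeD2l//.
apply: le_trans
  (@lipschitz_separated (r N) (r N.+1) (Xl N) (Xr N.+1) (r_lt N) _ _) _;
  [by move=> x []|by move=> x [_ /= /andP[/ltW]]|].
apply: le_hausdorff => x [[Xx fx]|[Xx /= /andP[_ fx]]]; split=> //=.
exact: le_trans fx (ltW (lt_trans (r_lt _) (r_lt _))).
Qed.

(** The part of [X] with f < t is some [Xl N.+1] up to a tail of layers of measure less than [e],
    and [Xl N.+1] is at positive distance from the part with f >= t. *)
Lemma hausdorff_split_sublevel : (mu X < +oo)%E ->
  (mu (X `&` [set x | (f x < t)%R]) + mu (X `&` ~` [set x | (f x < t)%R]) <= mu X)%E.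
Proof.
move=> Xoo; set S := [set x | _].
have sumoo : (\sum_(0 <= i <oo) mu (Xr i.+1) <= mu X + mu X)%E.
  apply: lime_le; first by apply: is_cvg_nneseries => *; exact: hausdorff_ge0.
  near=> N; rewrite big_mkord; apply: le_trans (layer_sum N) (leeD _ _);
  by apply: le_hausdorff => x [].
have sumlt := le_lt_trans sumoo (lte_add_pinfty Xoo Xoo).
have cv := nneseries_tail_cvg sumlt (fun i _ => hausdorff_ge0 k (Xr i.+1)).
apply/lee_addgt0Pr => e e0.
have [N _ HN] : \forall N \near \oo, (\sum_(N <= i <oo) mu (Xr i.+1) < e%:E)%E.
  apply: (cv [set x | (x < e%:E)%E]); apply: open_nbhs_nbhs; split; first exact: open_ereal_lt_ereal.
  by rewrite /= lte_fin.
have {HN} := HN N (leqnn N) => tl.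
have XS : X `&` S `<=` Xl N.+1 `|` \bigcup_(i in ~` `I_N) Xr i.+1.
  move=> x [Xx fxt]; have [fx|fx] := leP (f x) (r N.+1); first by left.
  right.
  have ex : exists j, f x <= r j.
    have : 0 < t - f x by rewrite subr_gt0.
    move=> /ltr_add_invr[j]; rewrite add0r => hj.
    by exists j; rewrite /r lerBrDr addrC -lerBrDr ltW.
  (* The first level [r m] that reaches [f x] has m >= N + 2. Hence [x] is in the layer [Xr m.-1]
     just below that level, which is the member m - 2 of the tail. *)
  case: (ex_minnP ex) => m fm mmin.
  have Nm : (N.+1 < m)%N.
    rewrite ltnNge; apply/negP => mN; move: fx; rewrite ltNge => /negP; apply.
    apply: le_trans fm _; elim: (N.+1) mN => [|q IH]; first by rewrite leqn0 => /eqP->.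
    by rewrite leq_eqVlt ltnS => /predU1P[->//|/IH h]; apply: le_trans h (ltW _).
  case: m Nm fm mmin => // m; rewrite ltnS => Nm fm mmin.
  case: m Nm fm mmin => // m; rewrite ltnS => Nm fm mmin.
  exists m; first by rewrite /= => /(leq_ltn_trans Nm); rewrite ltnn.
  split=> //=; rewrite fm andbT ltNge; apply/negP => /mmin; by rewrite ltnn.
have h1 : (mu (X `&` S) <= mu (Xl N.+1) + e%:E)%E.
  apply: le_trans (le_hausdorff k XS) _.
  apply: le_trans (outer_measureU2 (hausdorff_outer n k) _ _) _.
  apply: leeD => //; apply: le_trans (ltW tl).
  exact: (outer_measure_sigma_subadditive_tail (hausdorff_outer n k)).
apply: le_trans (leeD h1 (lexx _)) _; rewrite addeAC leeD2r//.
apply: le_trans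
  (@lipschitz_separated (r N.+1) t (Xl N.+1) (X `&` ~` S) _ _ _) _;
  [by rewrite /r ltrBlDr ltrDl invr_gt0|by move=> x []|
   by move=> x [_ /negP]; rewrite -leNgt|].
by apply: le_hausdorff => x [] [].
Unshelve. all: by end_near. Qed.

End caratheodory_measurability.

Section lipschitz_measurable.
Context {R : realType} {n : nat}.
Variables (k : nat) (f : 'rV[R]_n -> R) (C : R).
Hypothesis fC : forall x y, `|f x - f y| <= C * enorm (x - y).
Local Notation T := (caratheodory_type (@hausdorff_outer R n k)).

Lemma lipschitz_measurable_lt t : measurable ([set x | f x < t] : set T).
Proof.
apply: (le_caratheodory_measurable (mu := hausdorff_outer n k)) => X.
have [->|Xoo] := eqVneq (hausdorff_outer n k X) +oo%E; first by rewrite leey.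
by apply: (hausdorff_split_sublevel fC); rewrite ltey.
Qed.

Lemma lipschitz_measurable_fun : measurable_fun [set: T] (f : T -> R).
Proof.
move=> mT; apply: (measurability _ (measurable_realfun.RGenInftyO.measurableE R)) => //.
move=> _ [_ [t ->] <-]; rewrite setTI.
rewrite (_ : f @^-1` _ = [set x | f x < t]); first exact: lipschitz_measurable_lt.
by apply/seteqP; split => x /=; rewrite in_itv/=.
Qed.

Lemma lipschitz_measurable_le t : measurable ([set x | f x <= t] : set T).
Proof.
rewrite (_ : [set x | _] = f @^-1` `]-oo, t]).
  by rewrite -[X in measurable X]setTI; exact: lipschitz_measurable_fun.
by apply/seteqP; split => x /=; rewrite in_itv/=.
Qed.

End lipschitz_measurable.

(** * Coupling of boxes *)

Section boxes.
Context {R : realType} {k : nat}.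

(* the half-open box with lower corner [b.1] and upper corner [b.2] *)
Definition box := ('rV[R]_k * 'rV[R]_k)%type.
Implicit Types (b c P Q : box) (s : seq box) (i : 'I_k) (t d : R) (x : 'rV[R]_k).

Definition bvol b : R := \prod_i (b.2 ord0 i - b.1 ord0 i).
Definition vols s : R := \sum_(b <- s) bvol b.
Definition bpos b := [forall i, b.1 ord0 i < b.2 ord0 i].
Definition bsub b c :=
  [forall i, (c.1 ord0 i <= b.1 ord0 i) && (b.2 ord0 i <= c.2 ord0 i)].
Definition bsmall d b := [forall i, b.2 ord0 i - b.1 ord0 i <= d].
Definition before i b c := b.2 ord0 i <= c.1 ord0 i.
Definition bsep b c := [exists i, before i b c || before i c b].
Definition inbox b : set 'rV[R]_k := [set x | forall i, b.1 ord0 i <= x ord0 i < b.2 ord0 i].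

Definition upd x i t : 'rV[R]_k := \row_j (if j == i then t else x ord0 j).
Definition blo i t b : box := (b.1, upd b.2 i (Order.min (b.2 ord0 i) t)).
Definition bhi i t b : box := (upd b.1 i (Order.max (b.1 ord0 i) t), b.2).
(** Boxes without a part on this side are dropped, so that all pieces stay in the class [bpos] and
    every cut can be iterated. *)
Definition cutlo i t s := [seq blo i t b | b <- s & b.1 ord0 i < t].
Definition cuthi i t s := [seq bhi i t b | b <- s & t < b.2 ord0 i].

Lemma bvol_gt0 b : bpos b -> 0 < bvol b.
Proof. by move=> /forallP bp; apply: prodr_gt0 => i _; rewrite subr_gt0. Qed.

Lemma bsub_refl b : bsub b b.
Proof. by apply/forallP => i; rewrite !lexx. Qed.

Lemma bsub_trans b c e : bsub b c -> bsub c e -> bsub b e.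
Proof.
move=> /forallP bc /forallP ce; apply/forallP => i.
have /andP[h1 h2] := bc i; have /andP[h3 h4] := ce i.
by rewrite (le_trans h3)// (le_trans h2).
Qed.

Lemma bsub_sep b c b' c' : bsub b b' -> bsub c c' -> bsep b' c' -> bsep b c.
Proof.
move=> /forallP bb /forallP cc /existsP[i h]; apply/existsP; exists i.
have /andP[h1 h2] := bb i; have /andP[h3 h4] := cc i.
case/orP: h => h; apply/orP; [left|right].
  exact: le_trans h2 (le_trans h h3).
exact: le_trans h4 (le_trans h h1).
Qed.

Lemma bsub_in b c : bsub b c -> inbox b `<=` inbox c.
Proof.
move=> /forallP bc x bx i; have /andP[h1 h2] := bc i; have /andP[h3 h4] := bx i.
by rewrite (le_trans h1)//= (lt_le_trans h4).
Qed.

Lemma bsep_disjoint b c x : bsep b c -> inbox b x -> ~ inbox c x.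
Proof.
move=> /existsP[i /orP[h|h]] bx cx.
  have /andP[_ h1] := bx i; have /andP[h2 _] := cx i.
  by have := lt_le_trans h1 (le_trans h h2); rewrite ltxx.
have /andP[h2 _] := bx i; have /andP[_ h1] := cx i.
by have := lt_le_trans h1 (le_trans h h2); rewrite ltxx.
Qed.

Lemma blo_sub i t b : bsub (blo i t b) b.
Proof.
apply/forallP => j; rewrite lexx/= mxE; case: eqP => [->|_] //.
by rewrite ge_min lexx.
Qed.

Lemma bhi_sub i t b : bsub (bhi i t b) b.
Proof.
apply/forallP => j; rewrite lexx/= mxE andbT; case: eqP => [->|_] //.
by rewrite le_max lexx.
Qed.

Lemma blo_le i t b : (blo i t b).2 ord0 i <= t.
Proof. by rewrite mxE eqxx ge_min lexx orbT. Qed.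

Lemma bhi_ge i t b : t <= (bhi i t b).1 ord0 i.
Proof. by rewrite mxE eqxx le_max lexx orbT. Qed.

Lemma blo_pos i t b : bpos b -> b.1 ord0 i < t -> bpos (blo i t b).
Proof.
move=> /forallP bp bt; apply/forallP => j; rewrite mxE; case: eqP => [->|_] //.
by rewrite lt_min bp.
Qed.

Lemma bhi_pos i t b : bpos b -> t < b.2 ord0 i -> bpos (bhi i t b).
Proof.
move=> /forallP bp bt; apply/forallP => j; rewrite mxE; case: eqP => [->|_] //.
by rewrite gt_max bp.
Qed.

Definition bface i b : R := \prod_(j | j != i) (b.2 ord0 j - b.1 ord0 j).

Lemma bvolE i b : bvol b = (b.2 ord0 i - b.1 ord0 i) * bface i b.
Proof. by rewrite /bvol (bigD1 i). Qed.

Lemma bface_blo i t b : bface i (blo i t b) = bface i b.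
Proof. by apply: eq_bigr => j /negbTE ji; rewrite !mxE ji. Qed.

Lemma bface_bhi i t b : bface i (bhi i t b) = bface i b.
Proof. by apply: eq_bigr => j /negbTE ji; rewrite !mxE ji. Qed.

(** Extending the width of the lower part by 0 to boxes above the cut turns the volume below [t]
    into a sum over the fixed family [s], continuous in [t]. *)
Definition lowidth i b t : R := Order.max 0 (Order.min (b.2 ord0 i) t - b.1 ord0 i).

Lemma vols_cutlo i t s : all bpos s ->
  vols (cutlo i t s) = \sum_(b <- s) lowidth i b t * bface i b.
Proof.
move=> /allP sp; rewrite /vols /cutlo big_map big_filter big_mkcond/=.
apply: eq_big_seq => b /sp /forallP /(_ i) bp; rewrite (bvolE i) bface_blo !mxE eqxx.
rewrite /lowidth; case: ifPn => bt.
  by rewrite max_r// subr_ge0 le_min !ltW.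
by rewrite max_l ?mul0r// subr_le0 ge_min (leNgt t) bt orbT.
Qed.

Lemma vols_cut i t s : all bpos s ->
  vols s = vols (cutlo i t s) + vols (cuthi i t s).
Proof.
move=> sp; rewrite vols_cutlo// /vols /cuthi big_map big_filter big_mkcond/=.
rewrite [X in _ + X]big_mkcond -big_split/=; apply: eq_big_seq => b /(allP sp) /forallP /(_ i) bp.
rewrite /lowidth; case: ifPn => bt.
  rewrite !(bvolE i) bface_bhi !mxE eqxx -mulrDl; congr (_ * _).
  have := bt; rewrite (min_r (ltW bt)) => _.
  have [h|h] := leP t (b.1 ord0 i).
    by rewrite max_l ?subr_le0// add0r.
  by rewrite max_r ?subr_ge0 ?ltW//=; ring.
rewrite -leNgt in bt; rewrite addr0 (bvolE i) (min_l bt) max_r// subr_ge0.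
exact: ltW.
Qed.

Lemma vols_ge0 s : all bpos s -> 0 <= vols s.
Proof.
move=> /allP sp; rewrite /vols big_seq; apply: sumr_ge0 => b /sp bp.
exact/ltW/bvol_gt0.
Qed.

Lemma cutlo_pos i t s : all bpos s -> all bpos (cutlo i t s).
Proof.
move=> /allP sp; apply/allP => c /mapP[b + ->{c}]; rewrite mem_filter => /andP[bt /sp bp].
exact: blo_pos.
Qed.

Lemma cuthi_pos i t s : all bpos s -> all bpos (cuthi i t s).
Proof.
move=> /allP sp; apply/allP => c /mapP[b + ->{c}]; rewrite mem_filter => /andP[bt /sp bp].
exact: bhi_pos.
Qed.

Lemma cutlo_sep i t s : pairwise bsep s -> pairwise bsep (cutlo i t s).
Proof.
move=> sp; rewrite pairwise_map; apply: pairwise_filter; apply: sub_pairwise sp.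
by move=> b c; apply: bsub_sep; exact: blo_sub.
Qed.

Lemma cuthi_sep i t s : pairwise bsep s -> pairwise bsep (cuthi i t s).
Proof.
move=> sp; rewrite pairwise_map; apply: pairwise_filter; apply: sub_pairwise sp.
by move=> b c; apply: bsub_sep; exact: bhi_sub.
Qed.

Lemma has_cutlo i t s b : has (bsub b) (cutlo i t s) ->
  has (bsub b) s /\ b.2 ord0 i <= t.
Proof.
move=> /hasP[_ /mapP[c + ->] bc]; rewrite mem_filter => /andP[_ cs]; split.
  by apply/hasP; exists c => //; exact: bsub_trans bc (blo_sub _ _ _).
by move/forallP: bc => /(_ i)/andP[_ /le_trans]; apply; exact: blo_le.
Qed.

Lemma has_cuthi i t s b : has (bsub b) (cuthi i t s) ->
  has (bsub b) s /\ t <= b.1 ord0 i.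
Proof.
move=> /hasP[_ /mapP[c + ->] bc]; rewrite mem_filter => /andP[_ cs]; split.
  by apply/hasP; exists c => //; exact: bsub_trans bc (bhi_sub _ _ _).
by move/forallP: bc => /(_ i)/andP[+ _]; apply: le_trans; exact: bhi_ge.
Qed.

Lemma size_cutlo i t s : (size (cutlo i t s) <= size s)%N.
Proof. by rewrite size_map size_filter count_size. Qed.

Lemma size_cuthi i t s : (size (cuthi i t s) <= size s)%N.
Proof. by rewrite size_map size_filter count_size. Qed.

Lemma boxes_bounded i s :
  exists2 M, 0 <= M & {in s, forall b, - M <= b.1 ord0 i /\ b.2 ord0 i <= M}.
Proof.
elim: s => [|b s [M M0 IH]]; first by exists 0.
exists (M + `|b.1 ord0 i| + `|b.2 ord0 i|); first by rewrite !addr_ge0.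
have := ler_norm (- b.1 ord0 i); have := ler_norm (b.2 ord0 i).
have := normr_ge0 (b.1 ord0 i); have := normr_ge0 (b.2 ord0 i); rewrite normrN.
move=> h1 h2 h3 h4 c; rewrite inE => /predU1P[->|/IH[h5 h6]]; split; lra.
Qed.

(** The volume below a moving hyperplane grows continuously from 0 to the total. This is how a cut
    of one family is answered by a cut of the other in the same direction with the same volumes. *)
Lemma cutlo_ivt i s (v : R) : all bpos s -> 0 <= v <= vols s ->
  exists t, vols (cutlo i t s) = v.
Proof.
move=> sp /andP[v0 vs]; have [M M0 Mb] := boxes_bounded i s.
pose f t := \sum_(b <- s) lowidth i b t * bface i b.
have fc : {within `[- M, M], continuous f}.
  apply: continuous_subspaceT => t; rewrite /f; elim: s {sp vs Mb f} => [|b s IH].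
    by under eq_fun do rewrite big_nil; exact: cvg_cst.
  under eq_fun do rewrite big_cons; apply: (@cvgD _ R^o) => //.
  apply: cvgM; last exact: cvg_cst.
  apply: (@continuous_max R R (fun=> 0) (fun t => Order.min (b.2 ord0 i) t - b.1 ord0 i)).
    exact: cvg_cst.
  apply: cvgB; last exact: cvg_cst.
  by apply: (@continuous_min R R (fun=> b.2 ord0 i) id); [exact: cvg_cst|exact: cvg_id].
have fM : f (- M) = 0.
  rewrite /f big_seq big1// => b /Mb[h1 _].
  by rewrite /lowidth max_l ?mul0r// subr_le0 ge_min h1 orbT.
have fM' : f M = vols s.
  rewrite /f /vols; apply: eq_big_seq => b bs; have [_ h1] := Mb _ bs.
  rewrite (bvolE i) /lowidth (min_l h1) max_r// subr_ge0 ltW//.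
  by move/allP: sp => /(_ _ bs)/forallP.
have [||t _ ft] := @IVT _ f (- M) M v _ fc.
- lra.
- by rewrite fM fM' min_l ?max_r ?(le_trans v0)// v0.
by exists t; rewrite vols_cutlo.
Qed.

End boxes.
Arguments box R k : clear implicits.

Section subdivision.
Context {R : realType} {k : nat}.
Implicit Types (b c P Q : box R k) (N : nat).

Definition subbox b N (f : {ffun 'I_k -> 'I_N}) : box R k :=
  (\row_i (b.1 ord0 i + (f i)%:R / N%:R * (b.2 ord0 i - b.1 ord0 i)),
   \row_i (b.1 ord0 i + (f i).+1%:R / N%:R * (b.2 ord0 i - b.1 ord0 i))).

Lemma subbox_width b N (f : {ffun 'I_k -> 'I_N}) i :
  (subbox b f).2 ord0 i - (subbox b f).1 ord0 i =
  (b.2 ord0 i - b.1 ord0 i) / N%:R.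
Proof. by rewrite !mxE -[(f i).+1]addn1 natrD; ring. Qed.

Lemma subbox_pos b N (f : {ffun 'I_k -> 'I_N}) : (0 < N)%N -> bpos b -> bpos (subbox b f).
Proof.
move=> N0 /forallP bp; apply/forallP => i; rewrite -subr_gt0 subbox_width.
by rewrite divr_gt0 ?ltr0n// subr_gt0.
Qed.

Lemma bvol_subbox b N (f : {ffun 'I_k -> 'I_N}) : bvol (subbox b f) = bvol b / N%:R ^+ k.
Proof.
rewrite /bvol; under eq_bigr do rewrite subbox_width.
by rewrite big_split/= prodr_const card_ord exprVn.
Qed.

Lemma vols_subbox b N : (0 < N)%N ->
  \sum_(f : {ffun 'I_k -> 'I_N}) bvol (subbox b f) = bvol b.
Proof.
move=> N0; under eq_bigr do rewrite bvol_subbox.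
rewrite sumr_const card_ffun !card_ord -[_ *+ _]mulr_natr natrX divfK//.
by rewrite expf_neq0// pnatr_eq0 -lt0n.
Qed.

Lemma subbox_sub b N (f : {ffun 'I_k -> 'I_N}) : bpos b -> bsub (subbox b f) b.
Proof.
move=> /forallP bp; apply/forallP => i; rewrite !mxE.
have N0 : 0 < N%:R :> R by rewrite ltr0n (leq_ltn_trans _ (ltn_ord (f i))).
have w0 : 0 <= b.2 ord0 i - b.1 ord0 i by rewrite subr_ge0 ltW.
rewrite lerDl mulr_ge0 ?divr_ge0 ?ler0n//= addrC -lerBrDr ler_piMl//.
by rewrite ler_pdivrMr// mul1r ler_nat.
Qed.

Lemma subbox_before b N (f g : {ffun 'I_k -> 'I_N}) i : bpos b -> (f i < g i)%N ->
  before i (subbox b f) (subbox b g).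
Proof.
move=> /forallP bp fg; rewrite /before !mxE lerD2l ler_wpM2r//.
  by rewrite subr_ge0 ltW.
by rewrite ler_wpM2r ?invr_ge0 ?ler0n// ler_nat.
Qed.

Lemma subbox_cover b N x : (0 < N)%N -> inbox b x ->
  exists f : {ffun 'I_k -> 'I_N}, inbox (subbox b f) x.
Proof.
case: N => // N _ bx.
have bp i : 0 < b.2 ord0 i - b.1 ord0 i.
  by rewrite subr_gt0; have /andP[h1 h2] := bx i; exact: le_lt_trans h1 h2.
pose y i := (x ord0 i - b.1 ord0 i) / (b.2 ord0 i - b.1 ord0 i) * N.+1%:R.
have y0 i : 0 <= y i.
  rewrite mulr_ge0// divr_ge0 ?(ltW (bp i))//.
  by have /andP[h1 h2] := bx i; rewrite subr_ge0.
have yN i : y i < N.+1%:R.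
  rewrite /y gtr_pMl ?ltr0n// ltr_pdivrMr// mul1r ltrD2r.
  by have /andP[h1 h2] := bx i.
have tN i : (Num.truncn (y i) < N.+1)%N.
  rewrite -(ltr_nat R); by apply: le_lt_trans (yN i); rewrite truncn_le.
have xE i : x ord0 i = b.1 ord0 i + y i / N.+1%:R * (b.2 ord0 i - b.1 ord0 i).
  by rewrite /y mulfK ?pnatr_eq0// divfK ?gt_eqF// addrC subrK.
exists [ffun i => Ordinal (tN i)] => i; rewrite !mxE ffunE/= xE.
rewrite lerD2l ltrD2l ler_pM2r// ltr_pM2r// ler_pM2r ?ltr_pM2r ?invr_gt0 ?ltr0n//.
exact: truncn_itv.
Qed.

End subdivision.

Section interpolation.
Context {R : realType} {k : nat}.
Implicit Types (b c P Q : box R k) (l : R).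

Definition binterp l P Q : box R k := (wavg l P.1 Q.1, wavg l P.2 Q.2).

Lemma binterp_width l P Q i :
  (binterp l P Q).2 ord0 i - (binterp l P Q).1 ord0 i =
  (1 - l) * (P.2 ord0 i - P.1 ord0 i) + l * (Q.2 ord0 i - Q.1 ord0 i).
Proof. by rewrite !mxE; ring. Qed.

Lemma binterp_before l P Q P' Q' i : 0 <= l <= 1 ->
  before i P P' -> before i Q Q' -> before i (binterp l P Q) (binterp l P' Q').
Proof.
move=> /andP[l0 l1] h1 h2; rewrite /before !mxE lerD// ler_wpM2l//.
by rewrite subr_ge0.
Qed.

Lemma binterp_pos l P Q : 0 <= l <= 1 -> bpos P -> bpos Q -> bpos (binterp l P Q).
Proof.
move=> l01 /forallP Pp /forallP Qp; apply/forallP => i; rewrite -subr_gt0 binterp_width.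
have := Pp i; have := Qp i; rewrite -subr_gt0 -(subr_gt0 (P.1 _ _)).
move: (_ - _) (_ - _) => u v u0 v0.
apply: (@lt_le_trans _ _ (Order.min u v)); first by rewrite lt_min u0 v0.
by apply: wavg_ge; rewrite ?ge_min ?lexx ?orbT.
Qed.

Lemma binterp_small l P Q d : 0 <= l <= 1 -> bsmall d P -> bsmall d Q ->
  bsmall d (binterp l P Q).
Proof.
move=> l01 /forallP Pd /forallP Qd; apply/forallP => i; rewrite binterp_width.
exact: wavg_le.
Qed.

(** Boxes with parallel sides have a box as their Minkowski combination: [y] and [z] are the points
    of [P] and [Q] with the same relative position [th] that [x] has in [binterp l P Q]. *)
Lemma binterp_minkowski l P Q x : 0 <= l <= 1 -> bpos P -> bpos Q ->
  inbox (binterp l P Q) x ->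
  exists y z, [/\ inbox P y, inbox Q z & x = wavg l y z].
Proof.
move=> l01 Pp Qp xI; have /forallP Ip := binterp_pos l01 Pp Qp.
move: Pp Qp => /forallP Pp /forallP Qp.
pose th i := (x ord0 i - (binterp l P Q).1 ord0 i) /
  ((binterp l P Q).2 ord0 i - (binterp l P Q).1 ord0 i).
have th01 i : 0 <= th i < 1.
  have /andP[h1 h2] := xI i; have w0 := Ip i; rewrite -subr_gt0 in w0.
  by rewrite divr_ge0 ?subr_ge0 ?(ltW (Ip i))//= ltr_pdivrMr// mul1r ltrD2r.
have H b : (forall i, b.1 ord0 i < b.2 ord0 i) ->
    inbox b (\row_i (b.1 ord0 i + th i * (b.2 ord0 i - b.1 ord0 i))).
  move=> bp i; rewrite mxE; have /andP[t0 t1] := th01 i.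
  have w0 := bp i; rewrite -subr_gt0 in w0.
  by rewrite lerDl mulr_ge0 ?(ltW w0)//= addrC -ltrBrDr gtr_pMl.
exists (\row_i (P.1 ord0 i + th i * (P.2 ord0 i - P.1 ord0 i))).
exists (\row_i (Q.1 ord0 i + th i * (Q.2 ord0 i - Q.1 ord0 i))).
split; [exact: H|exact: H|]; apply/rowP => i; rewrite !mxE.
have w0 := Ip i; rewrite -subr_gt0 binterp_width in w0.
have : th i * ((1 - l) * (P.2 ord0 i - P.1 ord0 i) + l * (Q.2 ord0 i - Q.1 ord0 i))
   = x ord0 i - (binterp l P Q).1 ord0 i.
  by rewrite /th binterp_width divfK// gt_eqF.
rewrite !mxE; move: (th i) (x _ _) (P.1 _ _) (P.2 _ _) (Q.1 _ _) (Q.2 _ _).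
by move=> u v w z t s; lra.
Qed.

Lemma ln_prod (I : finType) (f : I -> R) : (forall i, 0 < f i) ->
  \prod_i f i = expR (\sum_i ln (f i)).
Proof. by move=> f0; rewrite expR_sum; apply: eq_bigr => i _; rewrite lnK// posrE. Qed.

Lemma expR_wavg l (s t : R) : 0 <= l <= 1 ->
  expR ((1 - l) * s + l * t) <= (1 - l) * expR s + l * expR t.
Proof.
move=> /andP[l0 l1]; set m := _ + _.
have H u : expR m * (1 + (u - m)) <= expR u.
  by rewrite -[X in _ <= expR X](subrK m u) [u - m + m]addrC (expRD m (u - m)) ler_wpM2l ?expR_ge0 ?expR_ge1Dx.
have l1' : 0 <= 1 - l by rewrite subr_ge0.
apply: le_trans (lerD (ler_wpM2l l1' (H s)) (ler_wpM2l l0 (H t))).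
by rewrite le_eqVlt; apply/orP; left; apply/eqP; rewrite /m; ring.
Qed.

(** Every width of [binterp l P Q] is at least the weighted geometric mean of the widths of [P] and
    [Q], and the product of these means is the weighted geometric mean of two equal volumes. *)
Lemma bvol_binterp l P Q : 0 <= l <= 1 -> bpos P -> bpos Q -> bvol P = bvol Q ->
  bvol P <= bvol (binterp l P Q).
Proof.
move=> l01 /forallP Pp /forallP Qp PQ.
have Pp' i : 0 < P.2 ord0 i - P.1 ord0 i by rewrite subr_gt0.
have Qp' i : 0 < Q.2 ord0 i - Q.1 ord0 i by rewrite subr_gt0.
have := PQ; rewrite /bvol (ln_prod Pp') (ln_prod Qp') => /expR_inj h.
rewrite [X in expR X](_ : _ = (1 - l) * \sum_i ln (P.2 ord0 i - P.1 ord0 i)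
   + l * \sum_i ln (Q.2 ord0 i - Q.1 ord0 i)); last by rewrite -h; ring.
rewrite !mulr_sumr -big_split/= expR_sum; apply: ler_prod => i _.
rewrite expR_ge0 binterp_width/=; apply: le_trans (expR_wavg _ _ l01) _.
by rewrite !lnK// posrE.
Qed.

End interpolation.

Section coupling.
Context {R : realType} {k : nat}.
Implicit Types (b c P Q : box R k) (sA sB : seq (box R k)) (i : 'I_k).
Implicit Types (T : box R k * box R k) (s : seq (box R k * box R k)).

(** The direction and the order must agree on both sides: only then are the interpolated boxes
    separated as well. *)
Definition psep T T' := [exists i,
  (before i T.1 T'.1 && before i T.2 T'.2) || (before i T'.1 T.1 && before i T'.2 T.2)].

Definition goodpair (d : R) T := [&& bpos T.1, bpos T.2, bsmall d T.1, bsmall d T.2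
  & bvol T.1 == bvol T.2].

(* a discrete transport of [sA] onto [sB] that is monotone, in the sense that two
   of its pieces are separated in one and the same direction on both sides *)
Definition coupling (d : R) sA sB s := [/\ all (goodpair d) s,
  all (fun T => has (bsub T.1) sA && has (bsub T.2) sB) s,
  pairwise psep s & \sum_(T <- s) bvol T.1 = vols sA].

Lemma psep_binterp l T T' : 0 <= l <= 1 -> psep T T' ->
  bsep (binterp l T.1 T.2) (binterp l T'.1 T'.2).
Proof.
move=> l01 /existsP[i /orP[] /andP[h1 h2]]; apply/existsP; exists i; apply/orP.
  by left; exact: binterp_before.
by right; exact: binterp_before.
Qed.

Lemma psep_fst T T' : psep T T' -> bsep T.1 T'.1.
Proof.
move=> /existsP[i /orP[] /andP[h1 h2]]; apply/existsP; exists i; rewrite h1 ?orbT//.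
Qed.

Lemma psep_snd T T' : psep T T' -> bsep T.2 T'.2.
Proof.
move=> /existsP[i /orP[] /andP[h1 h2]]; apply/existsP; exists i; rewrite h2 ?orbT//.
Qed.

Lemma coupling_vols_snd d sA sB s : coupling d sA sB s ->
  \sum_(T <- s) bvol T.2 = vols sA.
Proof.
move=> [/allP gs _ _ <-]; apply: eq_big_seq => T /gs /and5P[_ _ _ _ /eqP->] //.
Qed.

Lemma couplingC d sA sB s : vols sA = vols sB -> coupling d sA sB s ->
  coupling d sB sA [seq (T.2, T.1) | T <- s].
Proof.
move=> AB cs; have := coupling_vols_snd cs; case: cs => gs hs ps _ vs; split.
- rewrite all_map; apply: sub_all gs => T /and5P[h1 h2 h3 h4 /eqP h5].
  by rewrite /goodpair/= h1 h2 h3 h4 h5 eqxx.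
- by rewrite all_map; apply: sub_all hs => T /=; rewrite andbC.
- rewrite pairwise_map; apply: sub_pairwise ps => T T' /existsP[i h].
  by apply/existsP; exists i; rewrite /= andbC orbC andbC orbC.
- by rewrite big_map/= vs.
Qed.

(** Both boxes are cut into the same number N^k of congruent pieces, and pieces with the same
    multi-index are paired; [N] is large enough for all widths to be at most [d]. *)
Lemma coupling_single d P Q : 0 < d -> bpos P -> bpos Q -> bvol P = bvol Q ->
  exists s, coupling d [:: P] [:: Q] s.
Proof.
move=> d0 Pp Qp PQ.
have [N N0 HN] : exists2 N, (0 < N)%N & forall i,
    P.2 ord0 i - P.1 ord0 i <= d * N%:R /\ Q.2 ord0 i - Q.1 ord0 i <= d * N%:R.
  pose M := \sum_i (`|P.2 ord0 i - P.1 ord0 i| + `|Q.2 ord0 i - Q.1 ord0 i|).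
  have Mi i : `|P.2 ord0 i - P.1 ord0 i| + `|Q.2 ord0 i - Q.1 ord0 i| <= M.
    by rewrite /M (bigD1 i)//= lerDl; apply: sumr_ge0 => j _; rewrite addr_ge0.
  have M0 : 0 <= M by apply: sumr_ge0 => j _; rewrite addr_ge0.
  exists (Num.truncn (M / d)).+1 => // i.
  have MN : M <= d * (Num.truncn (M / d)).+1%:R.
    rewrite mulrC -ler_pdivrMr//; apply: ltW; exact: truncnS_gt.
  split; apply: le_trans MN; apply: le_trans (Mi i); apply: le_trans (ler_norm _) _.
    by rewrite lerDl.
  by rewrite lerDr.
have small b : (forall i, b.2 ord0 i - b.1 ord0 i <= d * N%:R) ->
    forall f : {ffun 'I_k -> 'I_N}, bsmall d (subbox b f).
  move=> hb f; apply/forallP => i; rewrite subbox_width ler_pdivrMr ?ltr0n//.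
exists [seq (subbox P f, subbox Q f) | f <- enum {: {ffun 'I_k -> 'I_N}}]; split.
- apply/allP => T /mapP[f _ ->]; rewrite /goodpair/= !subbox_pos// !bvol_subbox PQ eqxx.
  by rewrite !small// => i; have [] := HN i.
- by apply/allP => T /mapP[f _ ->] /=; rewrite !orbF !subbox_sub.
- rewrite pairwise_map; have := enum_uniq {: {ffun 'I_k -> 'I_N}}.
  rewrite uniq_pairwise; apply: sub_pairwise => f g /= /eqP/ffunP fg.
  have [i fgi] : exists i, f i != g i.
    apply/existsP; rewrite -negb_forall; apply/negP => /forallP h.
    by apply: fg => i; apply/eqP.
  apply/existsP; exists i; rewrite -(inj_eq val_inj) neq_ltn in fgi.
  by case/orP: fgi => fgi; apply/orP; [left|right]; rewrite /= !subbox_before.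
- by rewrite big_map big_enum/= vols_subbox// /vols big_seq1.
Qed.

Lemma coupling_cat d i (t t' : R) sA sB s1 s2 : all bpos sA ->
  coupling d (cutlo i t sA) (cutlo i t' sB) s1 ->
  coupling d (cuthi i t sA) (cuthi i t' sB) s2 -> coupling d sA sB (s1 ++ s2).
Proof.
move=> Ap [g1 h1 p1 v1] [g2 h2 p2 v2]; split.
- by rewrite all_cat g1 g2.
- rewrite all_cat; apply/andP; split.
    apply: sub_all h1 => T /andP[/has_cutlo[-> _] /has_cutlo[-> _]] //.
  by apply: sub_all h2 => T /andP[/has_cuthi[-> _] /has_cuthi[-> _]].
- rewrite pairwise_cat p1 p2 !andbT; apply/allrelP => T T' /(allP h1) + /(allP h2).
  move=> /andP[/has_cutlo[_ l1] /has_cutlo[_ l2]] /andP[/has_cuthi[_ l3] /has_cuthi[_ l4]].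
  by apply/existsP; exists i; rewrite /before (le_trans l1 l3) (le_trans l2 l4).
- by rewrite big_cat/= v1 v2 -vols_cut.
Qed.

(** A hyperplane that separates two boxes of the family misses one of them on each side, so both
    parts of the family are strictly smaller. This drives the Hadwiger-Ohmann induction. *)
Lemma cut_smaller sA : all bpos sA -> pairwise bsep sA -> (1 < size sA)%N ->
  exists i t, (size (cutlo i t sA) < size sA)%N /\ (size (cuthi i t sA) < size sA)%N.
Proof.
have H (b c : box R k) (s : seq (box R k)) i : b \in s -> c \in s -> before i b c ->
    (size (cutlo i (b.2 ord0 i) s) < size s)%N /\ (size (cuthi i (b.2 ord0 i) s) < size s)%N.
  move=> bs cs bc; rewrite !size_map !size_filter.
  rewrite !ltn_neqAle !count_size !andbT -!all_count; split; apply/allPn.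
    by exists c => //=; rewrite -leNgt.
  by exists b => //=; rewrite ltxx.
case: sA => [|b [|c s]] // _ /= /andP[/andP[/existsP[i /orP[h|h]] _] _] _.
  by exists i, (b.2 ord0 i); apply: (H b c) => //; rewrite !inE eqxx ?orbT.
by exists i, (c.2 ord0 i); apply: (H c b) => //; rewrite !inE eqxx ?orbT.
Qed.

(** Induction on the total number of boxes. The larger family is cut as in [cut_smaller], the other
    one at equal volume by [cutlo_ivt], which does not increase its number of boxes; the two
    couplings of the parts are concatenated. *)
Lemma coupling_exists d sA sB : 0 < d -> all bpos sA -> all bpos sB ->
  pairwise bsep sA -> pairwise bsep sB -> vols sA = vols sB ->
  exists s, coupling d sA sB s.
Proof.
move=> d0; move: {2}(size sA + size sB)%N (leqnn (size sA + size sB)) => m.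
elim: m sA sB => [|m IH] sA sB.
  rewrite leqn0 addn_eq0 => /andP[/nilP-> /nilP->] *.
  by exists [::]; split=> //; rewrite /vols !big_nil.
wlog BA : sA sB / (size sB <= size sA)%N.
  move=> H hm Ap Bp As Bs AB; have [BA|AB'] := leqP (size sB) (size sA).
    exact: H.
  rewrite addnC in hm.
  have [s cs] := H sB sA (ltnW AB') hm Bp Ap Bs As (esym AB).
  by exists [seq (T.2, T.1) | T <- s]; apply: couplingC => //.
move=> hm Ap Bp As Bs AB.
have [A2|A1] := ltnP 1 (size sA).
  have [i [t [slo shi]]] := cut_smaller Ap As A2.
  have [t' vt'] : exists t', vols (cutlo i t' sB) = vols (cutlo i t sA).
    apply: cutlo_ivt => //; rewrite vols_ge0 ?cutlo_pos//= -AB (vols_cut i t Ap).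
    by rewrite lerDl vols_ge0// cuthi_pos.
  have vt'' : vols (cuthi i t' sB) = vols (cuthi i t sA).
    by apply: (@addrI _ (vols (cutlo i t' sB))); rewrite -vols_cut// vt' -vols_cut.
  have sm1 : (size (cutlo i t sA) + size (cutlo i t' sB) <= m)%N.
    rewrite -ltnS; apply: leq_trans hm.
    by rewrite -addSn leq_add// size_cutlo.
  have sm2 : (size (cuthi i t sA) + size (cuthi i t' sB) <= m)%N.
    rewrite -ltnS; apply: leq_trans hm.
    by rewrite -addSn leq_add// size_cuthi.
  have [|||||s1 c1] := IH _ _ sm1; rewrite ?cutlo_pos ?cutlo_sep//.
  have [|||||s2 c2] := IH _ _ sm2; rewrite ?cuthi_pos ?cuthi_sep//.
  by exists (s1 ++ s2); exact: coupling_cat c1 c2.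
case: sA BA A1 hm Ap As AB => [|P [|//]] /= BA _ hm.
  move: BA; rewrite leqn0 => /nilP -> *.
  by exists [::]; split=> //; rewrite /vols !big_nil.
case: sB Bp Bs BA hm => [|Q [|//]] /= Bp Bs _ hm Pp _ AB.
  exfalso; move: AB Pp; rewrite /vols big_nil big_seq1 andbT => PQ /bvol_gt0.
  by rewrite PQ ltxx.
rewrite andbT in Pp; rewrite andbT in Bp.
by apply: coupling_single => //; move: AB; rewrite /vols !big_seq1.
Qed.

(** A coupling whose first cut of [sA] is prescribed; for strictness it will be placed at
    [q^perp]. *)
Lemma coupling_cut d i t sA sB : 0 < d -> all bpos sA -> all bpos sB ->
  pairwise bsep sA -> pairwise bsep sB -> vols sA = vols sB ->
  exists t' s1 s2, [/\ coupling d (cutlo i t sA) (cutlo i t' sB) s1,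
    coupling d (cuthi i t sA) (cuthi i t' sB) s2 & coupling d sA sB (s1 ++ s2)].
Proof.
move=> d0 Ap Bp As Bs AB.
have [t' vt'] : exists t', vols (cutlo i t' sB) = vols (cutlo i t sA).
  apply: cutlo_ivt => //; rewrite vols_ge0 ?cutlo_pos//= -AB (vols_cut i t Ap).
  by rewrite lerDl vols_ge0// cuthi_pos.
have vt'' : vols (cuthi i t' sB) = vols (cuthi i t sA).
  by apply: (@addrI _ (vols (cutlo i t' sB))); rewrite -vols_cut// vt' -vols_cut.
have [|||||s1 c1] := @coupling_exists d (cutlo i t sA) (cutlo i t' sB) d0;
  rewrite ?cutlo_pos ?cutlo_sep//.
have [|||||s2 c2] := @coupling_exists d (cuthi i t sA) (cuthi i t' sB) d0;
  rewrite ?cuthi_pos ?cuthi_sep//.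
by exists t', s1, s2; split => //; exact: coupling_cat c1 c2.
Qed.

End coupling.

(** * Hausdorff measure of boxes in a flat *)

Lemma rowBE (R : realType) k (x y : 'rV[R]_k) i :
  (x - y) ord0 i = x ord0 i - y ord0 i.
Proof. by rewrite !mxE. Qed.

Lemma ball_volume_gt0 (R : realType) k : 0 < ball_volume R k.
Proof.
elim/ltn_ind: k => -[|[|k]] IH //=.
by rewrite mulr_gt0 ?IH// divr_gt0// mulr_gt0// pi_gt0.
Qed.

(** Cauchy's functional equation for monotone functions: N g(t) and N t g(1) both lie between m g(1)
    and (m+1) g(1), where m is the integer part of N t, so they differ by at most g(1) for every
    N. *)
Lemma additive_linear (R : realType) (g : R -> R) :
  (forall s t, 0 <= s -> 0 <= t -> g (s + t) = g s + g t) ->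
  (forall t, 0 <= t -> 0 <= g t) -> forall t, 0 <= t -> g t = t * g 1.
Proof.
move=> gD g0 t t0.
have g00 : g 0 = 0 by apply: (@addrI _ (g 0)); rewrite -gD// !addr0.
have gM m s : 0 <= s -> g (m%:R * s) = m%:R * g s.
  move=> s0; elim: m => [|m IH]; first by rewrite !mul0r.
  by rewrite -natr1 !mulrDl gD ?mulr_ge0// IH !mul1r.
have gle s u : 0 <= s -> s <= u -> g s <= g u.
  by move=> s0 su; rewrite -(subrKC s u) gD ?subr_ge0// lerDl g0// subr_ge0.
have H N : `|g t - t * g 1| * N%:R <= g 1.
  have tN0 : 0 <= N%:R * t by rewrite mulr_ge0.
  have /andP[m1 m2] := truncn_itv tN0; set m := Num.trunc _ in m1 m2.
  have h1 : m%:R * g 1 <= N%:R * g t.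
    by rewrite -!gM// gle ?mulr1.
  have h2 : N%:R * g t <= m.+1%:R * g 1.
    by rewrite -!gM// gle ?mulr1// ltW.
  have h3 : m%:R * g 1 <= N%:R * t * g 1 by rewrite ler_wpM2r ?g0.
  have h4 : N%:R * t * g 1 <= m.+1%:R * g 1 by rewrite ler_wpM2r ?g0// ltW.
  rewrite -[X in _ * X](ger0_norm (ler0n R N)) -normrM ler_norml.
  move: h2 h4; rewrite -natr1 mulrDl mul1r.
  move: h1 h3; rewrite mulrBl [g t * _]mulrC mulrAC [t * _]mulrC.
  by move: (m%:R * _) (N%:R * g t) (N%:R * t * g 1) => u v w; lra.
apply/eqP; rewrite -subr_eq0 -normr_le0 leNgt; apply/negP => e0.
have := H (Num.trunc (g 1 / `|g t - t * g 1|)).+1.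
rewrite mulrC -ler_pdivlMr// leNgt => /negP; apply; exact: truncnS_gt.
Qed.

Section flat_boxes.
Context {R : realType} {n k : nat}.
Variable B : 'M[R]_(k, n).
Hypothesis Bfree : row_free B.
Implicit Types (c : 'rV[R]_n) (x w : 'rV[R]_k) (b : box R k).
Local Notation T := (caratheodory_type (@hausdorff_outer R n k)).
Local Notation H := (@hausdorff R n k).

Definition psi c x : 'rV[R]_n := c + x *m B.
Definition img c b : set 'rV[R]_n := psi c @` inbox b.
Definition Bnorm : R := \sum_i enorm (row i B) + 1.
Definition coo (z : 'rV[R]_n) : 'rV[R]_k := z *m pinvmx B.
Definition coonorm : R := \sum_i enorm (col i (pinvmx B))^T + 1.

Lemma Bnorm_gt0 : 0 < Bnorm.
Proof. by rewrite ltr_wpDl// sumr_ge0// => i _; rewrite enorm_ge0. Qed.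

Lemma coonorm_gt0 : 0 < coonorm.
Proof. by rewrite ltr_wpDl// sumr_ge0// => i _; rewrite enorm_ge0. Qed.

Lemma enorm_mulB x (r : R) : 0 <= r -> (forall i, `|x ord0 i| <= r) ->
  enorm (x *m B) <= r * Bnorm.
Proof.
move=> r0 xr; apply: le_trans (enorm_mulmx _ xr) _.
by rewrite ler_wpM2l// lerDl.
Qed.

Lemma psiB c x y : psi c x - psi c y = (x - y) *m B.
Proof. by rewrite opprD addrACA subrr add0r mulmxBl. Qed.

Lemma cooE z i : coo z ord0 i = dotp z (col i (pinvmx B))^T.
Proof. by rewrite mxE; apply: eq_bigr => j _; rewrite !mxE. Qed.

Lemma coo_le z i : `|coo z ord0 i| <= coonorm * enorm z.
Proof.
rewrite cooE mulrC; apply: le_trans (cauchy_schwarz _ _) _; rewrite ler_wpM2l ?enorm_ge0//.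
rewrite /coonorm (bigD1 i)//= -addrA lerDl addr_ge0// sumr_ge0// => j _.
exact: enorm_ge0.
Qed.

Lemma cooB (z w : 'rV[R]_n) : coo (z - w) = coo z - coo w.
Proof. by rewrite /coo mulmxBl. Qed.

Lemma coo_psi c x : coo (psi c x - c) = x.
Proof. by rewrite /psi addrC addKr /coo mulmxKp. Qed.

Lemma dotp_lipschitz (w x y : 'rV[R]_n) :
  `|dotp x w - dotp y w| <= enorm w * enorm (x - y).
Proof. by rewrite -dotpNl -dotpDl mulrC cauchy_schwarz. Qed.

(** In the ambient space the image of a box is cut out by finitely many linear conditions: the
    pseudo-inverse of [B] gives the coordinates and the cokernel gives the equations of the flat.
    Linear functionals are Lipschitz, so measurability follows. *)
Lemma img_equations c b : img c b =
  \bigcap_(i in [set: 'I_k])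
    ([set z | b.1 ord0 i + dotp c (col i (pinvmx B))^T <= dotp z (col i (pinvmx B))^T] `&`
     [set z | dotp z (col i (pinvmx B))^T < b.2 ord0 i + dotp c (col i (pinvmx B))^T]) `&`
  \bigcap_(j in [set: 'I_n])
    ([set z | dotp z (col j (cokermx B))^T <= dotp c (col j (cokermx B))^T] `&`
     [set z | dotp c (col j (cokermx B))^T <= dotp z (col j (cokermx B))^T]).
Proof.
have kE z j : (z *m cokermx B) ord0 j = dotp z (col j (cokermx B))^T.
  by rewrite mxE; apply: eq_bigr => i _; rewrite !mxE.
apply/seteqP; split => [_ [x bx <-]|z [/= h1 h2]].
  split=> i _ /=.
    rewrite -!cooE; have -> : coo (psi c x) = x + coo c.
      by rewrite -(subrK (coo c) (coo (psi c x))) -cooB coo_psi.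
    by rewrite !mxE lerD2r ltrD2r; have /andP[-> ->] := bx i.
  rewrite -!kE /psi mulmxDl -mulmxA mulmx_coker mulmx0 addr0.
  by split.
have zB : (z - c <= B)%MS.
  rewrite submxE; apply/eqP/rowP => j; rewrite mulmxBl mxE.
  have Ej : (z *m cokermx B) ord0 j = (c *m cokermx B) ord0 j.
    by have [/= h3 h4] := h2 j I; apply/eqP; rewrite !kE eq_le h3 h4.
  by rewrite Ej [X in _ + X]mxE subrr mxE.
exists (coo (z - c)); last by rewrite /psi /coo mulmxKpV// addrC subrK.
move=> i; have [/= h3 h4] := h1 i I.
by rewrite cooB mxE [X in _ + X]mxE !cooE lerBrDr ltrBlDr h3 h4.
Qed.

Lemma measurable_img c b : measurable (img c b : set T).
Proof.
rewrite img_equations; apply: measurableI; apply: fin_bigcap_measurable => // i _.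
  apply: measurableI.
    rewrite [X in measurable X](_ : _ = ~` [set z | dotp z (col i (pinvmx B))^T <
      b.1 ord0 i + dotp c (col i (pinvmx B))^T]).
      apply: measurableC; exact: (lipschitz_measurable_lt _ (@dotp_lipschitz _)).
    by apply/seteqP; split => z /=; rewrite leNgt => /negP.
  exact: (lipschitz_measurable_lt _ (@dotp_lipschitz _)).
apply: measurableI; first exact: (lipschitz_measurable_le _ (@dotp_lipschitz _)).
rewrite [X in measurable X](_ : _ = ~` [set z | dotp z (col i (cokermx B))^T <
  dotp c (col i (cokermx B))^T]).
  apply: measurableC; exact: (lipschitz_measurable_lt _ (@dotp_lipschitz _)).
by apply/seteqP; split => z /=; rewrite leNgt => /negP.
Qed.

Lemma img_translate c b : img c b = translate (c + b.1 *m B) (img 0 (0, b.2 - b.1)).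
Proof.
apply/seteqP; split => [_ [x bx <-]|_ [_ [x bx <-] <-]].
  exists (psi 0 (x - b.1)).
    exists (x - b.1) => // i; rewrite !mxE subr_ge0 ltrD2r.
    by have /andP[-> ->] := bx i.
  by rewrite /psi add0r mulmxBl -addrA; congr (c + _); rewrite addrC subrK.
exists (b.1 + x); last by rewrite /psi add0r mulmxDl addrA.
move=> i; have /andP[] := bx i; rewrite !mxE => h1 h2.
by rewrite lerDl h1/= addrC -ltrBrDr.
Qed.

(** A grid of N^k pieces has a gauge sum bounded independently of N, so one finite bound serves all
    scales. *)
Lemma hausdorff_img_le c b (D : R) : 0 <= D ->
  (forall i, 0 < b.2 ord0 i - b.1 ord0 i <= D) ->
  (H (img c b) <= (ball_volume R k * (D * Bnorm / 2) ^+ k)%:E)%E.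
Proof.
move=> D0 bD; apply: ge_ereal_sup => _ [d /= d0 <-].
pose N := (Num.trunc (D * Bnorm / d)).+1.
have N0 : 0 < N%:R :> R by rewrite ltr0n.
have ND : D * Bnorm / N%:R <= d.
  rewrite ler_pdivrMr// [d * _]mulrC -ler_pdivrMr// /N; apply: ltW; exact: truncnS_gt.
pose s := enum {: {ffun 'I_k -> 'I_N}}.
pose F j := if (j < size s)%N then img c (subbox b (nth [ffun=> ord0] s j)) else set0.
have diamF (f : {ffun 'I_k -> 'I_N}) : (diam (img c (subbox b f)) <= (D * Bnorm / N%:R)%:E)%E.
  apply: diam_le => _ _ [x xf <-] [y yf <-]; rewrite psiB mulrAC.
  apply: enorm_mulB => [|i]; first by rewrite divr_ge0// ltW.
  have /andP[x1 x2] := xf i; have /andP[y1 y2] := yf i.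
  have wd : (subbox b f).2 ord0 i - (subbox b f).1 ord0 i <= D / N%:R.
    rewrite subbox_width ler_wpM2r ?invr_ge0 ?ler0n//.
    by have /andP[] := bD i.
  rewrite !mxE; move: x1 x2 y1 y2 wd.
  move: ((subbox b f).1 ord0 i) ((subbox b f).2 ord0 i) (x _ _) (y _ _) => u v p q.
  by move=> *; rewrite ler_norml; apply/andP; split; lra.
have Fcov : delta_cover d (img c b) F.
  split=> [j|_ [x bx <-]].
    rewrite /F; case: ifP => _; last by rewrite diam_set0 leNye.
    by apply: le_trans (diamF _) _; rewrite lee_fin.
  have [f xf] := subbox_cover (ltn0Sn _ : (0 < N)%N) bx.
  exists (index f s) => //; rewrite /F index_mem mem_enum inE nth_index ?mem_enum ?inE//.
  by exists x.
apply: le_trans (ereal_inf_lbound _) _; first by exists F.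
rewrite (nneseries_split 0 (size s)); last by move=> *; exact: hausdorff_gauge_ge0.
rewrite add0n [X in (_ + X)%E]eseries0 ?adde0; last first.
  by move=> j js _; rewrite /F ltnNge js hausdorff_gauge0.
rewrite big_mkord.
apply: (@le_trans _ _ (\sum_(j < size s) (ball_volume R k * (D * Bnorm / N%:R / 2) ^+ k)%:E)%E).
  apply: lee_sum => j _; rewrite /F ltn_ord; apply: hausdorff_gauge_le => //.
  by rewrite divr_ge0 ?mulr_ge0 ?(ltW Bnorm_gt0).
rewrite sumEFin sumr_const card_ord /s -cardE card_ffun !card_ord.
rewrite lee_fin -mulrnAr ler_wpM2l ?ball_volume_ge0// -[_ *+ _]mulr_natr natrX -exprMn.
by rewrite [_ / N%:R / 2]mulrAC divfK// lt0r_neq0.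
Qed.

Definition hv w : R := fine (H (img 0 (0, w))).

Lemma hausdorff_imgE c b : bpos b -> H (img c b) = (hv (b.2 - b.1))%:E.
Proof.
move=> /forallP bp; rewrite /hv img_translate hausdorff_translate fineK//.
pose D := \sum_i (b.2 ord0 i - b.1 ord0 i).
have w0 i : 0 < b.2 ord0 i - b.1 ord0 i by rewrite subr_gt0.
rewrite ge0_fin_numE ?hausdorff_ge0//; apply: le_lt_trans (ltry _).
apply: (@hausdorff_img_le _ _ D); first by apply: sumr_ge0 => i _; exact: ltW.
move=> i; rewrite !mxE subr0 w0/= /D (bigD1 i)//= lerDl.
by apply: sumr_ge0 => j _; exact: ltW.
Qed.

(** Half-open boxes that share a facet are disjoint, so additivity of the measure applies to the two
    parts of the longer box. *)
Lemma hvD i w (s t : R) : 0 < s -> 0 < t -> (forall j, j != i -> 0 < w ord0 j) ->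
  hv (upd w i (s + t)) = hv (upd w i s) + hv (upd w i t).
Proof.
move=> s0 t0 w0.
have up u : 0 < u -> bpos ((0, upd w i u) : box R k).
  move=> u0; apply/forallP => j; rewrite !mxE; case: eqP => // /eqP; exact: w0.
have st0 : 0 < s + t by rewrite addr_gt0.
pose b1 : box R k := (0, upd w i s); pose b2 : box R k := (upd 0 i s, upd w i (s + t)).
have b2p : bpos b2.
  apply/forallP => j; rewrite !mxE; case: eqP => [_|/eqP /w0//]; by rewrite ltrDl.
have E : img 0 (0, upd w i (s + t)) = img 0 b1 `|` img 0 b2.
  rewrite /img -image_setU; congr image; apply/seteqP; split => x.
    move=> hx; have [xs|xs] := ltP (x ord0 i) s; [left|right] => j; have /andP[] := hx j;
      rewrite !mxE; case: eqP => [->|_] h1 h2; rewrite ?h1 ?h2 ?xs//.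
  move=> [] hx j; have /andP[] := hx j; rewrite !mxE; case: eqP => [->|_] h1 h2;
    rewrite ?h1 ?h2//.
    by rewrite (lt_trans h2)// ltrDl.
  by rewrite (le_trans _ h1)// ltW.
have dis : img 0 b1 `&` img 0 b2 = set0.
  apply/seteqP; split => // z [[x hx <-] [y hy] /(congr1 (fun z => coo (z - 0)))].
  rewrite !coo_psi => xy; move: (hx i) (hy i); rewrite xy !mxE eqxx.
  by move=> /andP[_ h1] /andP[h2 _]; have := lt_le_trans h1 h2; rewrite ltxx.
have := measureU (hausdorff_measure n k) (measurable_img 0 b1) (measurable_img 0 b2) dis.
rewrite -E [in X in X -> _]/hausdorff_measure/=.
rewrite [in X in X = _ -> _](hausdorff_imgE _ (up _ st0)).
rewrite (hausdorff_imgE _ (up _ s0)) (hausdorff_imgE _ b2p) !subr0 => -[->].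
congr (_ + hv _); apply/rowP => j; rewrite !mxE; case: eqP => _; last by rewrite subr0.
by rewrite addrC addKr.
Qed.

Lemma hv_linear i w (s : R) : 0 < s -> (forall j, j != i -> 0 < w ord0 j) ->
  hv (upd w i s) = s * hv (upd w i 1).
Proof.
move=> s0 w0; pose g t := if t == 0 then 0 else hv (upd w i t).
have := @additive_linear _ g _ _ s (ltW s0).
rewrite /g gt_eqF// oner_eq0; apply => [u t|t].
  rewrite le_eqVlt => /predU1P[<- _|u0]; first by rewrite eqxx !add0r.
  rewrite le_eqVlt => /predU1P[<-|t0]; first by rewrite eqxx !addr0.
  by rewrite !gt_eqF ?addr_gt0// hvD.
by move=> _; case: ifP => // _; rewrite fine_ge0// hausdorff_ge0.
Qed.

(** The factor by which the chart multiplies volume, read off at the unit cube. *)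
Definition kappa : R := hv (const_mx 1).

(** By [hv_linear] the measure is linear in each width separately, so the sides of the unit cube are
    replaced by those of [w] one at a time; [v s] is the stage at which the sides in [s] have been
    replaced. *)
Lemma hv_prod w : (forall i, 0 < w ord0 i) -> hv w = kappa * \prod_i w ord0 i.
Proof.
move=> w0.
pose v (s : seq 'I_k) : 'rV[R]_k := \row_j (if j \in s then w ord0 j else 1).
have H s : uniq s -> hv (v s) = kappa * \prod_(i <- s) w ord0 i.
  elim: s => [|i s IH] /= => [_|/andP[iNs us]].
    by rewrite big_nil mulr1 /kappa; congr hv; apply/rowP => j; rewrite !mxE.
  rewrite big_cons mulrCA -IH//.
  have -> : v (i :: s) = upd (v s) i (w ord0 i).
    by apply/rowP => j; rewrite !mxE inE; case: eqP => [->|_].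
  rewrite hv_linear//; last by move=> j _; rewrite mxE; case: ifP.
  congr (_ * hv _); apply/rowP => j; rewrite !mxE; case: eqP => [->|//].
  by rewrite (negbTE iNs).
have := H (enum 'I_k) (enum_uniq _); rewrite big_enum/= => <-; congr hv; apply/rowP => j.
by rewrite mxE mem_enum inE.
Qed.

Lemma hausdorff_img c b : bpos b -> H (img c b) = (kappa * bvol b)%:E.
Proof.
move=> bp; rewrite hausdorff_imgE// hv_prod => [|i].
  by congr (_ * _)%:E; apply: eq_bigr => i _; rewrite !mxE.
by rewrite !mxE subr_gt0; move/forallP: bp.
Qed.

End flat_boxes.

(** * Positivity of the measure of a box *)

Lemma sum_pow_half (R : realType) (M : nat) : \sum_(i < M) (2 ^- i.+1 : R) <= 1.
Proof.
suff -> : \sum_(i < M) (2 ^- i.+1 : R) = 1 - 2 ^- M by rewrite lerBlDr lerDl.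
elim: M => [|M IH]; first by rewrite big_ord0 expr0 invr1 subrr.
rewrite big_ord_recr/= IH exprS invfM.
by move: (2 ^- M) => u; lra.
Qed.

(** From the smallest index that satisfies the condition, all others are less than 2 N r away. *)
Lemma count_near (R : realType) (N : nat) (y r : R) : 0 <= r ->
  \sum_(a < N) ((`|a%:R / N%:R - y| < r)%R%:R : R) <= 2 * N%:R * r + 1.
Proof.
move=> r0; case: N => [|N]; first by rewrite big_ord0 mulr0 mul0r add0r.
have N0 : 0 < N.+1%:R :> R by rewrite ltr0n.
pose A : {set 'I_N.+1} := [set a : 'I_N.+1 | `|a%:R / N.+1%:R - y| < r]%SET.
rewrite (eq_bigr (fun a => if a \in A then 1 else 0)); last first.
  by move=> a _; rewrite inE; case: ifP.
rewrite -big_mkcond/= sumr_const.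
have [->|[a0 a0A]] := set_0Vmem A; first by rewrite cards0 mulr0n addr_ge0 ?mulr_ge0.
have [m mA mmin] := @arg_minnP _ a0 (mem A) val a0A.
pose M := Num.trunc (2 * N.+1%:R * r).
have Mge : 0 <= 2 * N.+1%:R * r by rewrite !mulr_ge0.
have aM (a : 'I_N.+1) : a \in A -> (m <= a < m + M.+1)%N.
  move=> aA; rewrite mmin//= -(ltr_nat R) natrD.
  have : (a%:R - m%:R) / N.+1%:R < 2 * r.
    move: aA mA; rewrite !inE => h1 h2; rewrite mulrBl.
    move: h1 h2; rewrite !ltr_norml => /andP[_ h1] /andP[h2 _].
    by move: (a%:R / _) (m%:R / _) h1 h2 => u v; lra.
  rewrite ltr_pdivrMr// => h.
  rewrite -ltrBlDl; apply: lt_trans h _; rewrite mulrAC; exact: truncnS_gt.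
have cA : (#|A| <= M.+1)%N.
  rewrite cardE -(size_map val) -(size_iota m M.+1); apply: uniq_leq_size.
    by rewrite map_inj_uniq ?enum_uniq//; exact: val_inj.
  by move=> _ /mapP[a + ->]; rewrite mem_enum mem_iota => /aM.
apply: (@le_trans _ _ M.+1%:R); first by rewrite ler_nat.
by rewrite -natr1 lerD2r; have /andP[] := truncn_itv Mge.
Qed.

(* compare the numbers of points of the grid of mesh [1/N] in each set *)
Lemma cube_cover_volume (R : realType) (k M : nat) (y : 'I_M -> 'rV[R]_k) (r : 'I_M -> R) :
  (forall i, 0 < r i) ->
  (forall x : 'rV[R]_k, (forall j, 0 <= x ord0 j <= 1) ->
     exists i, forall j, `|x ord0 j - y i ord0 j| < r i) ->
  1 <= 3 ^+ k * \sum_i r i ^+ k.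
Proof.
move=> r0 cov.
(* The grid is so fine that N r_i >= 1 for all i; the bound 2 N r_i + 1 of [count_near] is then at
   most 3 N r_i, whence the factor 3^k. *)
pose N := (\sum_i (Num.trunc (r i)^-1).+1).+1.
have N0 : 0 < N%:R :> R by rewrite ltr0n.
have rN i : 1 <= N%:R * r i.
  rewrite -ler_pdivrMr// mul1r; apply: ltW; apply: lt_le_trans (truncnS_gt _) _.
  by rewrite ler_nat /N (bigD1 i)//= ltnW// ltnS leq_addr.
have h1 (f : {ffun 'I_k -> 'I_N}) :
    1 <= \sum_i \prod_j ((`|(f j)%:R / N%:R - y i ord0 j| < r i)%R%:R : R).
  have [|i fi] := cov (\row_j ((f j)%:R / N%:R)).
    move=> j; rewrite mxE divr_ge0 ?ler0n//= ler_pdivrMr// mul1r ler_nat ltnW//.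
  rewrite (bigD1 i)//= big1 => [|j _]; last by have := fi j; rewrite mxE => ->.
  by rewrite lerDl; apply: sumr_ge0 => l _; apply: prodr_ge0.
have h2 : N%:R ^+ k <= \sum_i (3 * N%:R * r i) ^+ k.
  have -> : N%:R ^+ k = \sum_(f : {ffun 'I_k -> 'I_N}) 1 :> R.
    by rewrite sumr_const card_ffun !card_ord natrX.
  apply: le_trans (ler_sum _ (fun f _ => h1 f)) _.
  rewrite exchange_big/=; apply: ler_sum => i _.
  rewrite -(bigA_distr_bigA (fun j (a : 'I_N) =>
    (`|a%:R / N%:R - y i ord0 j| < r i)%R%:R : R)).
  rewrite -[k in X in _ <= X]card_ord -prodr_const; apply: ler_prod => j _.
  rewrite sumr_ge0//=; apply: le_trans (count_near _ _ (ltW (r0 i))) _.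
  have := rN i; move: (N%:R * r i) (mulrA 2 N%:R (r i)) (mulrA 3 N%:R (r i)).
  by move=> u <- <-; lra.
move: h2; under eq_bigr do rewrite -mulrA mulrCA exprMn.
by rewrite -mulr_sumr ler_pMr ?exprn_gt0//; under eq_bigr do rewrite exprMn; rewrite -mulr_sumr.
Qed.

Section positivity.
Context {R : realType} {n k : nat}.
Variable B : 'M[R]_(k, n).
Hypothesis Bfree : row_free B.
Hypothesis k0 : (0 < k)%N.
Local Notation H := (@hausdorff R n k).

(** Side 2 makes this half-open box contain the closed unit cube, which is compact. *)
Let cube : box R k := (0, const_mx 2).
Let C := coonorm B.
Let vB := ball_volume R k.

(** In coordinates each covering set lies in an open cube whose radius is comparable to its
    diameter. Compactness of the unit cube leaves finitely many of them, to which
    [cube_cover_volume] applies. *)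
Lemma hausdorff_cube_cover (F : (set 'rV[R]_n)^nat) :
  (forall i, (diam (F i) <= 1%:E)%E) -> img B 0 cube `<=` \bigcup_i F i ->
  ((vB / (2 * (12 * C) ^+ k))%:E <= \sum_(i <oo) hausdorff_gauge k (F i))%E.
Proof.
move=> dF covF; have C0 : 0 < C by exact: coonorm_gt0.
have vB0 : 0 < vB by exact: ball_volume_gt0.
(* The auxiliary radii [s i] have sum at most [e], so they account for at most 3^k e = 1/2 of the
   covering bound; the other half is left to the diameters. *)
pose e : R := (2 * 3 ^+ k)^-1.
have e0 : 0 < e by rewrite invr_gt0 mulr_gt0// exprn_gt0.
have e1 : e <= 1.
  rewrite /e invf_le1 ?mulr_gt0 ?exprn_gt0//.
  have h : 1 <= 3 ^+ k :> R by rewrite exprn_ege1// ler1n.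
  lra.
pose s i : R := e * 2 ^- i.+1.
have s0 i : 0 < s i by rewrite mulr_gt0// invr_gt0 exprn_gt0.
have s1 i : s i <= 1.
  rewrite -[leRHS]mulr1 ler_pM ?invr_ge0 ?exprn_ge0// ?(ltW e0)//.
  by rewrite invf_le1 ?exprn_gt0// exprn_ege1// ler1n.
pose d i : R := if pselect (F i !=set0) then fine (diam (F i)) else 0.
pose y i : 'rV[R]_k := if pselect (F i !=set0) is left h then coo B (projT1 (cid h)) else 0.
have d0 i : 0 <= d i.
  by rewrite /d; case: pselect => //= h; rewrite fine_ge0// diam_ge0.
have gd i : ((vB * (d i / 2) ^+ k)%:E <= hausdorff_gauge k (F i))%E.
  rewrite /d; case: pselect => /= h.
    by rewrite /hausdorff_gauge ifF//; apply/negbTE/set0P.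
  by rewrite mul0r expr0n gtn_eqF// mulr0 hausdorff_gauge_ge0.
(* The factor 2 makes the distance bound strict, and [s i] keeps the radius positive when the
   covering set has diameter 0 or is empty. *)
pose r i : R := Order.max (2 * C * d i) (s i).
have r0 i : 0 < r i by rewrite lt_max s0 orbT.
have yF i x : F i (psi B 0 x) -> forall j, `|x ord0 j - y i ord0 j| < r i.
  move=> Fx j; rewrite /y /d; case: pselect => [h|[]]; last by exists (psi B 0 x).
  case: cid => z Fz /=.
  have : `|x ord0 j - coo B z ord0 j| <= C * d i.
    have := coo_le B (psi B 0 x - z) j; rewrite cooB -{1}[psi B 0 x]subr0 coo_psi//.
    rewrite rowBE => /le_trans; apply; rewrite ler_wpM2l ?(ltW C0)//.
    rewrite /d; case: pselect => [h'|//] /=; have := enorm_le_diam Fx Fz.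
    rewrite -[diam _]fineK ?lee_fin// ge0_fin_numE ?diam_ge0//.
    by apply: le_lt_trans (dF i) _; rewrite ltry.
  move=> /le_lt_trans; apply; rewrite /r lt_max.
  have [->|dn0] := eqVneq (d i) 0; first by rewrite mulr0 s0 orbT.
  apply/orP; left; rewrite -mulrA ltr_pMl; first by rewrite ltr1n.
  by rewrite mulr_gt0// lt_def dn0 d0.
have [M HM] : exists M, forall x : 'rV[R]_k, (forall j, 0 <= x ord0 j <= 1) ->
    exists i : 'I_M, forall j, `|x ord0 j - y i ord0 j| < r i.
  pose K := [set x : 'rV[R]_k | forall j, `[0, 1]%classic (x ord0 j)].
  have Kc : compact K by apply: (@rV_compact R k (fun=> `[0, 1]%classic)) => j; exact: segment_compact.
  rewrite compact_cover in Kc.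
  have [||D _ KD] := Kc nat setT (fun i => ball (y i) (r i)).
  - by move=> i _; exact: ball_open.
  - move=> x Kx; have [|i _ Fx] := covF (psi B 0 x).
      exists x => // j; have := Kx j; rewrite /= in_itv/= !mxE => /andP[-> /le_lt_trans->] //.
      by rewrite ltr1n.
    exists i => //; split => // a j; rewrite !ord1 -ball_normE/= distrC; exact: yF Fx j.
  exists (\sum_(i <- finmap.enum_fset D) i.+1)%N => x Kx.
  have [|i /= iD [_ xi]] := KD x; first by move=> j; rewrite /= in_itv/=; exact: Kx.
  have iM : (i < \sum_(i <- finmap.enum_fset D) i.+1)%N by rewrite (big_rem i)//= ltn_addr.
  exists (Ordinal iM) => j; have := xi ord0 j; by rewrite -ball_normE/= distrC.
have vol : 1 <= 3 ^+ k * \sum_(i < M) r i ^+ k.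
  by apply: (@cube_cover_volume _ _ _ (y \o val) (r \o val)) => [i|x /HM//]; exact: r0.
have rk i : r i ^+ k <= (2 * C * d i) ^+ k + s i.
  rewrite /r; case: (leP (2 * C * d i) (s i)) => h.
    apply: ler_wpDl; first by rewrite exprn_ge0// !mulr_ge0// ltW.
    by rewrite -[leRHS]expr1 ler_wiXn2l// ltW.
  by rewrite lerDl ltW.
have sums : \sum_(i < M) s i <= e.
  by rewrite -mulr_sumr -[leRHS]mulr1 ler_wpM2l ?sum_pow_half// ltW.
have dsum : (2 * (6 * C) ^+ k)^-1 <= \sum_(i < M) d i ^+ k.
  have h1 : 1 <= 3 ^+ k * (\sum_(i < M) (2 * C * d i) ^+ k + e).
    apply: le_trans vol _; rewrite ler_wpM2l ?exprn_ge0//.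
    apply: (@le_trans _ _ (\sum_(i < M) ((2 * C * d i) ^+ k + s i))).
      by apply: ler_sum => i _; exact: rk.
    by rewrite big_split lerD2l.
  have h2 : 3 ^+ k * e = 2^-1 by rewrite /e invfM mulrCA mulfV ?mulr1// expf_neq0.
  rewrite mulrDr h2 in h1.
  have h3 : 3 ^+ k * \sum_(i < M) (2 * C * d i) ^+ k = (6 * C) ^+ k * \sum_(i < M) d i ^+ k.
    under eq_bigr do rewrite exprMn; rewrite -mulr_sumr mulrA -exprMn.
    by congr (_ ^+ _ * _); ring.
  rewrite h3 in h1; rewrite -[leLHS]mul1r ler_pdivrMr; last first.
    by rewrite mulr_gt0// exprn_gt0// mulr_gt0.
  rewrite mulrCA [X in _ * X]mulrC; move: h1; move: ((6 * C) ^+ k * _) => u; lra.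
apply: (@le_trans _ _ (\sum_(i < M) (vB * (d i / 2) ^+ k)%:E)%E); last first.
  apply: (@le_trans _ _ (\sum_(i < M) hausdorff_gauge k (F i))%E).
    by apply: lee_sum => i _; exact: gd.
  rewrite -[leLHS](big_mkord xpredT (fun i => hausdorff_gauge k (F i))).
  by apply: nneseries_lim_ge => i _ _; exact: hausdorff_gauge_ge0.
rewrite sumEFin lee_fin -mulr_sumr ler_wpM2l ?(ltW vB0)//.
under eq_bigr do rewrite exprMn; rewrite -mulr_suml.
have -> : (2 * (12 * C) ^+ k)^-1 = (2 * (6 * C) ^+ k)^-1 * 2^-1 ^+ k.
  have -> : 12 * C = 6 * C * 2 by ring.
  by rewrite [(6 * C * 2) ^+ k]exprMn mulrA invfM exprVn.
by rewrite ler_wpM2r// exprn_ge0.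
Qed.

Lemma kappa_gt0 : 0 < kappa B.
Proof.
have cp : bpos cube by apply/forallP => j; rewrite !mxE.
have C0 : 0 < C by exact: coonorm_gt0.
have : ((vB / (2 * (12 * C) ^+ k))%:E <= H (img B 0 cube))%E.
  apply: le_trans (hausdorff_delta_le k _ (ltr01 : 0 < 1 :> R)).
  apply: le_ereal_inf_tmp => _ [F [dF cF] <-]; exact: hausdorff_cube_cover.
have v0 : 0 < vB / (2 * (12 * C) ^+ k).
  by rewrite divr_gt0 ?ball_volume_gt0// mulr_gt0// exprn_gt0// mulr_gt0.
rewrite hausdorff_img// lee_fin => /(lt_le_trans v0).
by rewrite pmulr_lgt0// bvol_gt0.
Qed.

End positivity.

(** * Approximation of integrals by sums over boxes *)

Section compact_sets.
Context {R : realType} {n : nat}.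
Variable k : nat.
Implicit Types (K : set 'rV[R]_n).
Local Notation T := (caratheodory_type (@hausdorff_outer R n k)).

Lemma coord_le_norm (x : 'rV[R]_n) i : `|x ord0 i| <= `|x|.
Proof.
rewrite [leRHS]/Num.norm/= mx_normE.
rewrite [leLHS](_ : _ = (`|x ord0 i|%:nng)%:num)// num_le.
exact: (le_bigmax _ (fun j : 'I_1 * 'I_n => `|x j.1 j.2|%:nng) (ord0, i)).
Qed.

Lemma compact_enorm_bounded K : compact K ->
  exists2 M, 0 < M & forall x, K x -> enorm x <= M.
Proof.
move=> /compact_bounded[M [_ KM]].
pose N : R := `|M| + 1.
have MN : M < N by rewrite /N; have := ler_norm M; lra.
have N0 : 0 < N by rewrite ltr_wpDl.
exists (N * \sum_i enorm (row i (1%:M : 'M[R]_n)) + 1).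
  by rewrite ltr_wpDl// mulr_ge0 ?(ltW N0)// sumr_ge0// => i _; exact: enorm_ge0.
move=> x /(KM _ MN)/= xN; rewrite -[x]mulmx1.
apply: ler_wpDr => //; apply: enorm_mulmx => i.
exact: le_trans (coord_le_norm x i) xN.
Qed.

(** The distance to [K] is 1-Lipschitz, and [K], being closed, is its sublevel set at 0. *)
Lemma measurable_compact K : compact K -> measurable (K : set T).
Proof.
have [->|/set0P[x0 Kx0]] := eqVneq K set0; first by move=> _; exact: measurable0.
move=> Kc; have Kcl : closed K by apply: compact_closed Kc; exact: norm_hausdorff.
pose D x : set R := [set enorm (x - y) | y in K].
have D0 x : has_inf (D x).
  split; first by exists (enorm (x - x0)); exists x0.
  by exists 0 => _ [y _ <-]; exact: enorm_ge0.
pose f (x : 'rV[R]_n) : R := inf (D x).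
have fE x y : f x <= f y + enorm (x - y).
  rewrite -lerBlDr; apply: lb_le_inf; first by have [] := D0 y.
  move=> _ [z Kz <-]; rewrite lerBlDr.
  apply: (@le_trans _ _ (enorm (x - z))).
    by apply: ge_inf; [have [] := D0 x|exists z].
  by rewrite -(subrKA y) addrC enormD.
have fL x y : `|f x - f y| <= 1 * enorm (x - y).
  rewrite mul1r ler_norml; apply/andP; split; last by rewrite lerBlDl fE.
  by rewrite lerBrDr addrC lerBlDr enormB fE.
have -> : K = [set x | f x <= 0].
  apply/seteqP; split => x /=.
    move=> Kx; apply: ge_inf; first by have [] := D0 x.
    by exists x => //; rewrite subrr enorm0.
  apply: contraPP => /= nKx; apply/negP; rewrite -ltNge.
  have : nbhs x (~` K) by apply: open_nbhs_nbhs; split => //; exact: closed_openC.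
  move=> /nbhs_ballP[e /= e0 xe].
  apply: (lt_le_trans e0); apply: lb_le_inf; first by have [] := D0 x.
  move=> _ [y Ky <-]; rewrite leNgt; apply/negP => ye.
  apply: (xe y) => //; split => // i j; rewrite !ord1 -ball_normE/=.
  by rewrite -rowBE; apply: le_lt_trans ye; exact: coord_le_enorm.
exact: (lipschitz_measurable_le _ fL).
Qed.

Lemma measurable_powR_enorm (p : R) :
  measurable_fun [set: T] (fun x : T => enorm x `^ p).
Proof.
have me : measurable_fun [set: T] (@enorm R n : T -> R).
  apply: (@lipschitz_measurable_fun _ _ _ _ 1) => x y; rewrite mul1r.
  exact: ler_enormB.
exact: (@measurableT_comp _ _ _ T _ R (@powR R ^~ p) _ _ _ me).
Qed.

End compact_sets.

Section integral_pieces.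
Context {R : realType} d (T : measurableType d).
Variables (mu : {measure set T -> \bar R}) (f : T -> R).
Hypotheses (mf : measurable_fun [set: T] f) (f0 : forall x, 0 <= f x).
Implicit Types (A K : set T).
Local Notation I K := (\int[mu]_(x in K) (f x)%:E)%E.

Lemma measurable_EFinS K : measurable K -> measurable_fun K (fun x => (f x)%:E).
Proof. by move=> mK; apply/measurable_EFinP; apply: measurable_funS mf. Qed.

Lemma integral_setD A K : measurable A -> measurable K -> A `<=` K ->
  I K = (I A + I (K `\` A))%E.
Proof.
move=> mA mK AK; rewrite -{1}(setDUK AK) ge0_integral_setU//.
- exact: measurableD.
- by rewrite setDUK//; exact: measurable_EFinS.
- by move=> x _; rewrite lee_fin.
- by rewrite disj_set2E setDIK.
Qed.

Lemma measure_setD A K : measurable A -> measurable K -> A `<=` K ->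
  mu K = (mu A + mu (K `\` A))%E.
Proof.
move=> mA mK AK; rewrite -{1}(setDUK AK) measureU//; first exact: measurableD.
by rewrite setDIK.
Qed.

Lemma integral_ge_cst A (h m : R) : measurable A -> mu A = m%:E -> 0 <= h ->
  (forall z, A z -> h <= f z) -> ((m * h)%:E <= I A)%E.
Proof.
move=> mA mAm h0 hf; rewrite mulrC EFinM -mAm -(integral_cst mu mA h%:E).
apply: ge0_le_integral => //; exact: measurable_EFinS.
Qed.

Lemma integral_le_cst A (h m : R) : measurable A -> mu A = m%:E ->
  (forall z, A z -> f z <= h) -> (I A <= (m * h)%:E)%E.
Proof.
move=> mA mAm hf; rewrite mulrC EFinM -mAm -(integral_cst mu mA h%:E).
apply: ge0_le_integral => //.
- by move=> x _; rewrite lee_fin.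
- exact: measurable_EFinS.
Qed.

Variables (U : eqType) (g : U -> set T) (m h : U -> R).

Let sub_setD u v K : g u `&` g v = set0 -> g v `<=` K -> g v `<=` K `\` g u.
Proof.
move=> uv vK z vz; split; first exact: vK.
by move=> uz; move: uv; rewrite -subset0 => /(_ z); apply.
Qed.

Lemma integral_pieces_ge (s : seq U) K : measurable K ->
  (forall u, measurable (g u)) -> {in s, forall u, mu (g u) = (m u)%:E} ->
  pairwise (fun u v => `[< g u `&` g v = set0 >]) s ->
  {in s, forall u, g u `<=` K} -> {in s, forall u, 0 <= h u} ->
  {in s, forall u, forall z, g u z -> h u <= f z} ->
  ((\sum_(u <- s) m u * h u)%:E <= I K)%E.
Proof.
move=> + mg; elim: s K => [|u s IH] K mK.
  by rewrite big_nil => *; apply: integral_ge0 => x _; rewrite lee_fin.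
move=> gm /= /andP[us ss] sK h0 hf; rewrite big_cons EFinD.
have uin : u \in u :: s by rewrite inE eqxx.
have tin v : v \in s -> v \in u :: s by rewrite inE orbC => ->.
rewrite (integral_setD (mg u) mK (sK _ uin)); apply: leeD.
  by apply: integral_ge_cst => //; [exact: gm|exact: h0|exact: hf].
apply: IH => //.
- exact: measurableD.
- by move=> v /tin; exact: gm.
- by move=> v vs; apply: sub_setD; [apply/asboolP; exact: (allP us)|apply: sK; exact: tin].
- by move=> v /tin; exact: h0.
- by move=> v /tin; exact: hf.
Qed.

(** What the pieces leave uncovered has measure [V] minus their total, and there [f] is at most
    [M]. *)
Lemma integral_pieces_le (s : seq U) K (M V : R) : measurable K ->
  (forall u, measurable (g u)) -> {in s, forall u, mu (g u) = (m u)%:E} ->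
  mu K = V%:E -> (forall z, K z -> f z <= M) ->
  pairwise (fun u v => `[< g u `&` g v = set0 >]) s ->
  {in s, forall u, g u `<=` K} ->
  {in s, forall u, forall z, g u z -> f z <= h u} ->
  (I K <= (\sum_(u <- s) m u * h u + M * (V - \sum_(u <- s) m u))%:E)%E.
Proof.
move=> + mg; elim: s K V => [|u s IH] K V mK.
  rewrite !big_nil subr0 add0r mulrC => *; exact: integral_le_cst.
move=> gm KV fM /= /andP[us ss] sK hf; rewrite !big_cons.
have uin : u \in u :: s by rewrite inE eqxx.
have tin v : v \in s -> v \in u :: s by rewrite inE orbC => ->.
rewrite (integral_setD (mg u) mK (sK _ uin)).
have KD : mu (K `\` g u) = (V - m u)%:E.
  have := measure_setD (mg u) mK (sK _ uin); rewrite KV gm//.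
  by case: (mu _) => [r| |] //= [->]; rewrite [m u + r]addrC addrK.
have -> : m u * h u + \sum_(v <- s) m v * h v + M * (V - (m u + \sum_(v <- s) m v)) =
    m u * h u + (\sum_(v <- s) m v * h v + M * (V - m u - \sum_(v <- s) m v)).
  by rewrite -addrA opprD [V + _]addrA.
rewrite EFinD; apply: leeD.
  by apply: integral_le_cst => //; [exact: gm|exact: hf].
apply: IH => //.
- exact: measurableD.
- by move=> v /tin; exact: gm.
- by move=> z [/fM].
- by move=> v vs; apply: sub_setD; [apply/asboolP; exact: (allP us)|apply: sK; exact: tin].
- by move=> v /tin; exact: hf.
Qed.

End integral_pieces.

Section box_sums.
Context {R : realType} {n k : nat}.
Variable B : 'M[R]_(k, n).
Hypotheses (Bfree : row_free B) (k0 : (0 < k)%N).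
Variable f : 'rV[R]_n -> R.
Local Notation T := (caratheodory_type (@hausdorff_outer R n k)).
Local Notation H := (@hausdorff R n k).
Hypotheses (mf : measurable_fun [set: T] (f : T -> R)) (f0 : forall x, 0 <= f x).
Local Notation I K := (\int[hausdorff_measure n k]_(x in (K : set T)) (f x)%:E)%E.

Lemma bsep_img_disjoint (c : 'rV[R]_n) (b b' : box R k) :
  bsep b b' -> img B c b `&` img B c b' = set0.
Proof.
move=> bb'; apply/seteqP; split => // z [[x bx <-] [y by_]].
move=> /(congr1 (fun z => coo B (z - c))); rewrite !coo_psi// => xy.
by rewrite xy in by_; exact: (bsep_disjoint bb' bx by_).
Qed.

Variables (U : eqType) (g : U -> box R k) (h : U -> R) (s : seq U) (c : 'rV[R]_n).
Variable K : set 'rV[R]_n.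
Hypotheses (mK : measurable (K : set T)) (pos : {in s, forall u, bpos (g u)}).
Hypotheses (sep : pairwise (relpre g (@bsep R k)) s).
Hypothesis sK : {in s, forall u, img B c (g u) `<=` K}.

Let sep' : pairwise (fun u v => `[< img B c (g u) `&` img B c (g v) = set0 >]) s.
Proof.
by apply: sub_pairwise sep => u v uv; apply/asboolP; exact: bsep_img_disjoint.
Qed.

Let gm : {in s, forall u, hausdorff_measure n k (img B c (g u)) = (kappa B * bvol (g u))%:E}.
Proof. by move=> u us; apply: hausdorff_img => //; exact: pos. Qed.

Lemma integral_boxes_ge : {in s, forall u, 0 <= h u} ->
  {in s, forall u, forall z, img B c (g u) z -> h u <= f z} ->
  ((\sum_(u <- s) kappa B * bvol (g u) * h u)%:E <= I K)%E.
Proof.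
exact: (integral_pieces_ge mf f0 mK (fun u => measurable_img Bfree c (g u)) gm sep' sK).
Qed.

Lemma integral_boxes_le (M V : R) : H K = V%:E -> (forall z, K z -> f z <= M) ->
  {in s, forall u, forall z, img B c (g u) z -> f z <= h u} ->
  (I K <= (\sum_(u <- s) kappa B * bvol (g u) * h u
           + M * (V - \sum_(u <- s) kappa B * bvol (g u)))%:E)%E.
Proof.
move=> HV fM.
exact: (integral_pieces_le mf f0 mK (fun u => measurable_img Bfree c (g u)) gm HV fM sep' sK).
Qed.

End box_sums.

Section approximation.
Context {R : realType} {n k : nat}.
Variable B : 'M[R]_(k, n).
Hypotheses (Bfree : row_free B) (k0 : (0 < k)%N).
Local Notation T := (caratheodory_type (@hausdorff_outer R n k)).
Local Notation H := (@hausdorff R n k).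
Implicit Types (K : set 'rV[R]_n) (c : 'rV[R]_n) (s : seq (box R k)) (b : box R k).

Definition symbox (r : R) : box R k := (const_mx (- r), const_mx r).

Lemma psi_wavg (l : R) (c c' : 'rV[R]_n) (x y : 'rV[R]_k) :
  psi B (wavg l c c') (wavg l x y) = wavg l (psi B c x) (psi B c' y).
Proof. by rewrite /psi /wavg mulmxDl -!scalemxAl !scalerDr addrACA. Qed.

Lemma wavg_id (l : R) (c : 'rV[R]_n) : wavg l c c = c.
Proof. by rewrite /wavg -scalerDl subrK scale1r. Qed.

Lemma symbox_pos r : 0 < r -> bpos (symbox r).
Proof. by move=> r0; apply/forallP => i; rewrite !mxE gt0_cp. Qed.

(** The lower bound [integral_boxes_ge] for the constant function 1. *)
Lemma packing c K (V : R) (U : eqType) (g : U -> box R k) (s : seq U) :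
  measurable (K : set T) -> H K = V%:E ->
  {in s, forall u, bpos (g u)} -> pairwise (relpre g (@bsep R k)) s ->
  {in s, forall u, img B c (g u) `<=` K} ->
  kappa B * \sum_(u <- s) bvol (g u) <= V.
Proof.
move=> mK KV pos sep sub.
have := integral_boxes_ge Bfree (measurable_cst (1 : R)) (fun=> ler01) mK pos sep sub
  (h := fun=> 1) (fun _ _ => ler01) (fun _ _ _ _ => lexx _).
rewrite (integral_cst (hausdorff_measure n k) mK 1%:E) mul1e [X in (_ <= X)%E]KV.
by rewrite lee_fin; under eq_bigr do rewrite mulr1; rewrite -mulr_sumr.
Qed.

(** The two cubes express relative interior and boundedness in coordinates: the inner one gives
    positive volume and room for shrinking towards [c], the outer one a finite grid and a bound for
    the volume of slabs. *)
Definition body c (r M : R) K := [/\ 0 < r, 0 < M, convex_set K,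
  forall x : 'rV[R]_k, (forall i, `|x ord0 i| <= r) -> K (psi B c x) &
  K `<=` img B c (symbox M)].

Lemma body_finite c r M K : body c r M K -> exists V, H K = V%:E /\
  kappa B * bvol (symbox r) <= V.
Proof.
move=> [r0 M0 _ rK KM].
have bd : (H K <= (kappa B * bvol (symbox M))%:E)%E.
  by rewrite -(hausdorff_img Bfree c (symbox_pos M0)); exact: le_hausdorff.
have bd' : ((kappa B * bvol (symbox r))%:E <= H K)%E.
  rewrite -(hausdorff_img Bfree c (symbox_pos r0)); apply: le_hausdorff => _ [x xr <-].
  by apply: rK => i; have /andP[] := xr i; rewrite !mxE ler_norml => -> /ltW->.
exists (fine (H K)); rewrite -lee_fin fineK; first by [].
by rewrite ge0_fin_numE ?hausdorff_ge0// (le_lt_trans bd)// ltry.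
Qed.

Lemma convex_setE K x y (t : R) : convex_set K -> K x -> K y -> 0 <= t <= 1 ->
  K (wavg t x y).
Proof.
move=> Kc Kx Ky t01.
have := Kc y x (Itv01 (proj1 (andP t01)) (proj2 (andP t01))).
by rewrite !inE => /(_ Ky Kx); rewrite /conv/= /wavg addrC.
Qed.

(** The small grid boxes that meet [K] cover it but may stick out. Shrinking them by the factor t
    towards [c] moves them into [K], because [K] is convex and contains a cube around [c], and costs
    only the factor t^k in volume. *)
Lemma body_approx c r M K (V eta : R) : body c r M K -> H K = V%:E -> 0 < eta ->
  exists s, [/\ all (@bpos R k) s, pairwise (@bsep R k) s,
    {in s, forall b, img B c b `<=` K} & V - eta <= kappa B * vols s].
Proof.
move=> [r0 M0 Kc rK KM] HV eta0.
have kp := kappa_gt0 Bfree k0.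
have V0 : 0 <= V by rewrite -lee_fin -HV hausdorff_ge0.
(* Since t^k >= 1 - k u, the loss of volume is at most k u V <= eta; the bound 1/2 keeps t = 1 - u
   positive. *)
pose u := Order.min 2^-1 (eta / (k%:R * (V + 1))).
have kV0 : 0 < k%:R * (V + 1) by rewrite mulr_gt0 ?ltr0n// ltr_wpDl.
have u0 : 0 < u by rewrite lt_min invr_gt0 ltr0n divr_gt0.
have u2 : u <= 2^-1 by rewrite ge_min lexx.
have uV : k%:R * u * V <= eta.
  have : u <= eta / (k%:R * (V + 1)) by rewrite ge_min lexx orbT.
  rewrite ler_pdivlMr// => h; apply: le_trans h.
  by rewrite [k%:R * u]mulrC -mulrA !ler_wpM2l ?(ltW u0)// lerDl.
pose t := 1 - u.
have t0 : 0 < t by rewrite /t; lra.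
have t1 : t <= 1 by rewrite /t; lra.
have tk : 1 - k%:R * u <= t ^+ k.
  elim: (k) => [|m IH]; first by rewrite mul0r subr0 expr0.
  rewrite exprSr -natr1; apply: (@le_trans _ _ ((1 - m%:R * u) * t)); last first.
    by rewrite ler_wpM2r// ltW.
  have : 0 <= m%:R * u * u by rewrite !mulr_ge0// ltW.
  by rewrite /t mulrDl mul1r; move: (m%:R * u) => w; lra.
pose N := (Num.trunc (2 * M / (u * r))).+1.
have N0 : 0 < N%:R :> R by rewrite ltr0n.
have NM : 2 * M / N%:R <= u * r.
  rewrite ler_pdivrMr// [u * r * _]mulrC -ler_pdivrMr ?mulr_gt0// /N.
  apply: ltW; exact: truncnS_gt.
pose sb (f : {ffun 'I_k -> 'I_N}) := subbox (symbox M) f.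
pose tb f : box R k := (t *: (sb f).1, t *: (sb f).2).
pose meets f := `[< exists2 x, inbox (sb f) x & K (psi B c x) >].
pose sf := [seq f <- enum {: {ffun 'I_k -> 'I_N}} | meets f].
have sMp := symbox_pos M0.
have tbv f : bvol (tb f) = t ^+ k * bvol (sb f).
  rewrite /bvol; under eq_bigr do rewrite !mxE -mulrBr.
  by rewrite big_split/= prodr_const card_ord; congr (_ * _); apply: eq_bigr => i _; rewrite !mxE.
have sbp f : bpos (sb f) by exact: subbox_pos.
exists [seq tb f | f <- sf]; split.
- rewrite all_map; apply/allP => f _ /=; apply/forallP => i; rewrite !mxE.
  by rewrite ltr_pM2l//; have /forallP/(_ i) := sbp f; rewrite !mxE.
- rewrite pairwise_map; have := enum_uniq {: {ffun 'I_k -> 'I_N}}.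
  rewrite uniq_pairwise => /(pairwise_filter meets); apply: sub_pairwise => f g /= /eqP/ffunP fg.
  have [i fgi] : exists i, f i != g i.
    apply/existsP; rewrite -negb_forall; apply/negP => /forallP h.
    by apply: fg => i; apply/eqP.
  apply/existsP; exists i; rewrite -(inj_eq val_inj) neq_ltn in fgi.
  have scale b b' : before i b b' ->
     before i ((t *: b.1, t *: b.2) : box R k) (t *: b'.1, t *: b'.2).
    by rewrite /before !mxE => ?; rewrite ler_wpM2l// ltW.
  by case/orP: fgi => fgi; apply/orP; [left|right]; apply: scale; exact: subbox_before.
- move=> b /mapP[f]; rewrite mem_filter => /andP[/asboolP[y yf Ky] _] ->.
  move=> _ [x xt <-].
  (* A point x of a shrunk box is the combination t y + u z, where y is a point of [K] in the
     original box; the mesh was chosen at most u r, so z is in the inner cube. *)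
  have zr i : `|(u^-1 *: (x - t *: y)) ord0 i| <= r.
    have wE : (sb f).2 ord0 i - (sb f).1 ord0 i = 2 * M / N%:R.
      by rewrite subbox_width !mxE opprK; congr (_ / _); ring.
    rewrite mxE rowBE normrM gtr0_norm ?invr_gt0// ler_pdivrMl//.
    apply: le_trans NM; have /andP[x1 x2] := xt i; have /andP[y1 y2] := yf i.
    rewrite [(t *: y) _ _]mxE; rewrite mxE in x1; rewrite mxE in x2.
    have ty1 : t * (sb f).1 ord0 i <= t * y ord0 i by rewrite ler_wpM2l// ltW.
    have ty2 : t * y ord0 i <= t * (sb f).2 ord0 i by rewrite ler_wpM2l// ltW.
    have twE : t * (sb f).2 ord0 i - t * (sb f).1 ord0 i <= 2 * M / N%:R.
      by rewrite -mulrBr wE ler_piMl// divr_ge0 ?ltW// mulr_gt0.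
    rewrite ler_norml; move: x1 x2 ty1 ty2 twE.
    move: (t * _) (t * _) (t * _) => p q v *; apply/andP; split; lra.
  have -> : psi B c x = wavg t (psi B c (u^-1 *: (x - t *: y))) (psi B c y).
    rewrite -psi_wavg wavg_id; congr psi; rewrite /wavg /t subKr scalerA.
    by rewrite mulfV ?gt_eqF// scale1r subrK.
  by apply: convex_setE => //; [exact: rK|rewrite (ltW t0) t1].
- rewrite /vols big_map; under eq_bigr do rewrite tbv; rewrite -mulr_sumr.
  have cov : V <= kappa B * \sum_(f <- sf) bvol (sb f).
    rewrite -lee_fin -HV mulr_sumr -sumEFin.
    apply: (@le_trans _ _ (\sum_(f <- sf) H (img B c (sb f)))%E); last first.
      by rewrite le_eqVlt; apply/orP; left; apply/eqP; apply: eq_bigr => f _; rewrite hausdorff_img.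
    have sub : K `<=` \big[setU/set0]_(f <- sf) img B c (sb f).
      move=> z Kz; have [x xM xz] := KM z Kz.
      have [f xf] := subbox_cover (ltn0Sn _ : (0 < N)%N) xM.
      rewrite -bigcup_seq; exists f; last by exists x.
      rewrite /= mem_filter mem_enum inE andbT; apply/asboolP; exists x => //.
      by rewrite xz.
    apply: le_trans (le_hausdorff k sub) _.
    elim: sf {sub} => [|f s' IH]; first by rewrite !big_nil hausdorff0.
    rewrite !big_cons; apply: le_trans (outer_measureU2 (hausdorff_outer n k) _ _) _.
    exact: leeD.
  apply: (@le_trans _ _ (t ^+ k * V)); last first.
    by rewrite mulrCA ler_wpM2l// exprn_ge0// ltW.
  have := ler_wpM2r V0 tk; rewrite mulrBl mul1r => h; apply: le_trans h.
  by rewrite lerD2l lerN2.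
Qed.

End approximation.

(** * The integral inequality and its strictness *)

Section interpolate.
Context {R : realType} {n : nat}.
Implicit Types (A K : set 'rV[R]_n) (l : R).

Lemma interpolateE A K l :
  interpolate A K l = [set wavg l z.1 z.2 | z in A `*` K].
Proof. by []. Qed.

Lemma interpolateC A K l : interpolate A K (1 - l) = interpolate K A l.
Proof.
rewrite !interpolateE; apply/seteqP; split => _ [[x y] /= [Ax Ky] <-];
  exists (y, x) => //=; by rewrite /wavg subKr addrC.
Qed.

Lemma compact_interpolate A K l : compact A -> compact K ->
  compact (interpolate A K l).
Proof.
move=> Ac Kc; rewrite interpolateE; apply: continuous_compact.
  apply: continuous_subspaceT => z; rewrite /wavg.
  by apply: cvgD; apply: cvgZr; [exact: cvg_fst|exact: cvg_snd].
exact: compact_setX.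
Qed.

Lemma interpolate_bound A K l (M : R) : 0 <= l <= 1 ->
  (forall x, A x -> enorm x <= M) -> (forall x, K x -> enorm x <= M) ->
  forall z, interpolate A K l z -> enorm z <= M.
Proof.
move=> l01 AM KM z; rewrite interpolateE => -[[x y] /= [/AM xM /KM yM] <-].
exact: le_trans (enorm_wavg _ _ l01) (wavg_le l01 xM yM).
Qed.

End interpolate.

Lemma ler_combine (R : realType) (a b S u w z : R) :
  a <= b + u -> z <= w -> a + S - u - w <= b + S - z.
Proof. by move=> *; lra. Qed.

Lemma abs_reflect_le1 (R : realType) (l : R) : 0 <= l <= 1 -> `|2 * l - 1| <= 1.
Proof. by move=> /andP[l0 l1]; rewrite ler_norml; apply/andP; split; lra. Qed.

Section main_estimate.
Context {R : realType} {n k : nat}.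
Variable B : 'M[R]_(k, n).
Hypotheses (Bfree : row_free B) (k0 : (0 < k)%N).
Local Notation T := (caratheodory_type (@hausdorff_outer R n k)).
Local Notation H := (@hausdorff R n k).
Variables (p l : R).
Hypotheses (p1 : 1 <= p) (l01 : 0 <= l <= 1).
Variables (K0 K1 : set 'rV[R]_n) (c0 c1 : 'rV[R]_n) (V M : R).
Hypotheses (K0c : compact K0) (K1c : compact K1).
Hypotheses (M0 : 0 < M) (K0M : forall x, K0 x -> enorm x <= M).
Hypothesis (K1M : forall x, K1 x -> enorm x <= M).
Hypotheses (K0V : H K0 = V%:E) (K1V : H K1 = V%:E).

Local Notation F := (fun x : 'rV[R]_n => enorm x `^ p).
Local Notation Kl := (interpolate K0 K1 l).
Local Notation Kl' := (interpolate K1 K0 l).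
Let L := p * M `^ (p - 1).
Let MF := M `^ p.
Let C := `|2 * l - 1| `^ p.

Let p0 : 0 <= p. Proof. exact: le_trans p1. Qed.

Let C1 : C <= 1.
Proof.
have <- : 1 `^ p = 1 :> R by rewrite powR1.
by apply: le_powR => //; rewrite normr_ge0 abs_reflect_le1.
Qed.

Lemma powR_enorm_bound z : enorm z <= M -> F z <= MF.
Proof. by move=> zM; apply: le_powR => //; rewrite enorm_ge0. Qed.

Lemma powR_enorm_osc c (b : box R k) (d : R) z : bpos b -> bsmall d b ->
  (forall w, img B c b w -> enorm w <= M) -> img B c b z ->
  `|F z - F (psi B c b.1)| <= L * (d * Bnorm B).
Proof.
move=> /forallP bp /forallP bd bM zb.
have cb : img B c b (psi B c b.1) by exists b.1 => // i; rewrite lexx bp.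
apply: le_trans (@powR_lipschitz _ p M _ _ p1 _ _) _; rewrite ?enorm_ge0 ?bM//.
rewrite ler_wpM2l ?mulr_ge0 ?powR_ge0//; apply: le_trans (ler_enormB _ _) _.
case: zb => x xb <-; rewrite psiB; apply: enorm_mulB.
  have i := Ordinal k0; apply: le_trans (bd i).
  by rewrite subr_ge0 ltW.
move=> i; have := bd i; have /andP[] := xb i; rewrite rowBE => h1 h2 h3.
rewrite ger0_norm ?subr_ge0//; apply: le_trans h3; rewrite lerD2r; exact: ltW.
Qed.

Variables (d : R) (s : seq (box R k * box R k)).
Hypotheses (sd : all (goodpair d) s) (ssep : pairwise (@psep R k) s).
Hypotheses (sK0 : {in s, forall u, img B c0 u.1 `<=` K0}).
Hypotheses (sK1 : {in s, forall u, img B c1 u.2 `<=` K1}).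

Let om := L * (d * Bnorm B).
Let v := \sum_(u <- s) bvol u.1.

Lemma binterp_img (m : R) c c' (P Q : box R k) A K : 0 <= m <= 1 ->
  bpos P -> bpos Q -> img B c P `<=` A -> img B c' Q `<=` K ->
  img B (wavg m c c') (binterp m P Q) `<=` interpolate A K m.
Proof.
move=> m01 Pp Qp PA QK _ [x xI <-].
have [y [z [yP zQ ->]]] := binterp_minkowski m01 Pp Qp xI.
by exists (psi B c y, psi B c' z); [split; [apply: PA; exists y|apply: QK; exists z]|
  rewrite psi_wavg].
Qed.

(** Stated with a relabelling [g] of the pairs because it is applied both to the pairs themselves
    and to the exchanged pairs. *)
Lemma moment_binterp_ge (g : box R k * box R k -> box R k * box R k) c c' A K :
  (forall z, A z -> enorm z <= M) -> (forall z, K z -> enorm z <= M) ->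
  compact A -> compact K ->
  {in s, forall u, goodpair d (g u) /\ bvol (g u).1 = bvol u.1} ->
  pairwise (fun u u' => psep (g u) (g u')) s ->
  {in s, forall u, img B c (g u).1 `<=` A} ->
  {in s, forall u, img B c' (g u).2 `<=` K} ->
  ((\sum_(u <- s) kappa B * bvol u.1 *
     (F (wavg l (psi B c (g u).1.1) (psi B c' (g u).2.1)) - om))%:E
   <= moment k p (interpolate A K l))%E.
Proof.
move=> AM KM Ac Kc gs gsep sA sK.
have kp := kappa_gt0 Bfree k0.
pose gb u := binterp l (g u).1 (g u).2.
(* A nonnegative lower bound is required for the integral, and it also allows the volume of the
   interpolated box to be replaced by the smaller [bvol u.1]. *)
pose h u := Order.max 0 (F (psi B (wavg l c c') (gb u).1) - om).
have gbp : {in s, forall u, bpos (gb u)}.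
  by move=> u /gs[/and5P[h1 h2 _ _ _] _]; exact: binterp_pos.
have gbK : {in s, forall u, img B (wavg l c c') (gb u) `<=` interpolate A K l}.
  move=> u us; have [/and5P[h1 h2 _ _ _] _] := gs u us.
  by apply: binterp_img => //; [exact: sA|exact: sK].
have gbsep : pairwise (relpre gb (@bsep R k)) s.
  by apply: sub_pairwise gsep => u u'; exact: psep_binterp.
have mI : measurable (interpolate A K l : set T).
  by apply: measurable_compact; exact: compact_interpolate.
have hge : {in s, forall u, 0 <= h u} by move=> u _; rewrite /h le_max lexx.
have hle : {in s, forall u, forall z, img B (wavg l c c') (gb u) z -> h u <= F z}.
  move=> u us z zb; rewrite /h ge_max powR_ge0/=.
  have [/and5P[h1 h2 h3 h4 _] _] := gs u us.
  have bM w : img B (wavg l c c') (gb u) w -> enorm w <= M.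
    by move=> /(gbK _ us); apply: interpolate_bound.
  have := powR_enorm_osc (gbp _ us) (binterp_small l01 h3 h4) bM zb.
  by rewrite ler_norml -/om => /andP[+ _]; rewrite lerBrDl addrC.
have := integral_boxes_ge Bfree (@measurable_powR_enorm R n k p) (fun x => powR_ge0 _ p)
  mI gbp gbsep gbK hge hle.
apply: le_trans.
rewrite lee_fin !big_seq; apply: ler_sum => u us.
have [/and5P[h1 h2 _ _ /eqP h5] h6] := gs u us.
rewrite -psi_wavg; apply: (@le_trans _ _ (kappa B * bvol u.1 * h u)).
  rewrite ler_wpM2l ?mulr_ge0 ?(ltW kp) -?h6 ?(ltW (bvol_gt0 _))//.
  by rewrite /h le_max lexx orbT.
rewrite ler_wpM2r ?le_max ?lexx// ler_wpM2l ?(ltW kp)// -h6.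
exact: bvol_binterp.
Qed.

Let gsd u : u \in s -> [/\ bpos u.1, bpos u.2, bsmall d u.1, bsmall d u.2 & bvol u.1 = bvol u.2].
Proof. by move=> /(allP sd)/and5P[? ? ? ? /eqP ?]. Qed.

Lemma moment_boxes_le (g : box R k * box R k -> box R k) c K :
  (forall z, K z -> enorm z <= M) -> compact K -> H K = V%:E ->
  {in s, forall u, [/\ bpos (g u), bsmall d (g u) & bvol (g u) = bvol u.1]} ->
  pairwise (relpre g (@bsep R k)) s -> {in s, forall u, img B c (g u) `<=` K} ->
  (moment k p K <= (\sum_(u <- s) kappa B * bvol u.1 * (F (psi B c (g u).1) + om)
     + MF * (V - kappa B * v))%:E)%E.
Proof.
move=> KM Kc KV gs gsep sK; have mK := measurable_compact k Kc.
have gp : {in s, forall u, bpos (g u)} by move=> u /gs[].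
have := integral_boxes_le Bfree (@measurable_powR_enorm R n k p) (fun x => powR_ge0 _ p)
  mK gp gsep sK (h := fun u => F (psi B c (g u).1) + om) KV
  (fun z Kz => powR_enorm_bound (KM z Kz)).
have -> : \sum_(u <- s) kappa B * bvol (g u) = kappa B * v.
  by rewrite mulr_sumr; apply: eq_big_seq => u /gs[_ _ ->].
have -> : \sum_(u <- s) kappa B * bvol (g u) * (F (psi B c (g u).1) + om) =
  \sum_(u <- s) kappa B * bvol u.1 * (F (psi B c (g u).1) + om).
  by apply: eq_big_seq => u /gs[_ _ ->].
apply => u us z zb; have [h1 h2 _] := gs u us.
have bM w : img B c (g u) w -> enorm w <= M by move=> /(sK _ us)/KM.
have := powR_enorm_osc h1 h2 bM zb.
by rewrite ler_norml -/om => /andP[_]; rewrite lerBlDl.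
Qed.

Lemma moment_fin (K : set 'rV[R]_n) : (forall z, K z -> enorm z <= M) -> compact K ->
  H K = V%:E -> moment k p K \is a fin_num.
Proof.
move=> KM Kc KV; rewrite ge0_fin_numE; last first.
  by apply: integral_ge0 => x _; rewrite lee_fin powR_ge0.
have mK := measurable_compact k Kc.
apply: le_lt_trans (ltry (V * MF)).
have KF z : K z -> F z <= MF by move=> /KM; exact: powR_enorm_bound.
have F0 z : 0 <= F z by exact: powR_ge0.
have h := integral_le_cst (@measurable_powR_enorm R n k p) F0 mK.
exact: (h (hausdorff_measure n k) MF V KV KF).
Qed.

(** On each box the power of the norm is replaced by its value at the lower corner. Of the two error
    terms, the first comes from the parts of the bodies outside the boxes; the second adds the
    oscillations of four integrals, two of weight 1 and two of weight C <= 1. *)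
Lemma main_estimate :
  ((C * (fine (moment k p K0) + fine (moment k p K1))
    + kappa B * (\sum_(u <- s) bvol u.1 * moment_gap p l (psi B c0 u.1.1) (psi B c1 u.2.1))
    - 2 * MF * (V - kappa B * v) - 4 * om * (kappa B * v))%:E
   <= moment k p Kl + moment k p Kl')%E.
Proof.
have kp := kappa_gt0 Bfree k0.
have g1 : {in s, forall u, goodpair d u /\ bvol u.1 = bvol u.1}.
  by move=> u us; split => //; exact: (allP sd).
have g2 : {in s, forall u, goodpair d (u.2, u.1) /\ bvol (u.2, u.1).1 = bvol u.1}.
  move=> u /gsd[h1 h2 h3 h4 h5]; split; last by [].
  by rewrite /goodpair/= h1 h2 h3 h4 h5 eqxx.
have s2 : pairwise (fun u u' : box R k * box R k => psep (u.2, u.1) (u'.2, u'.1)) s.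
  apply: sub_pairwise ssep => u u' /existsP[i h]; apply/existsP; exists i.
  by rewrite /= andbC orbC andbC orbC.
have f0 : {in s, forall u, [/\ bpos u.1, bsmall d u.1 & bvol u.1 = bvol u.1]}.
  by move=> u /gsd[h1 h2 h3 h4 h5].
have f1 : {in s, forall u, [/\ bpos u.2, bsmall d u.2 & bvol u.2 = bvol u.1]}.
  by move=> u /gsd[h1 h2 h3 h4 h5].
have t0 : pairwise (relpre fst (@bsep R k)) s.
  by apply: sub_pairwise ssep => u u'; exact: psep_fst.
have t1 : pairwise (relpre snd (@bsep R k)) s.
  by apply: sub_pairwise ssep => u u'; exact: psep_snd.
have A1 := moment_binterp_ge (g := id) K0M K1M K0c K1c g1 ssep sK0 sK1.
have A2 := moment_binterp_ge (g := fun u => (u.2, u.1)) K1M K0M K1c K0c g2 s2 sK1 sK0.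
have B0 := moment_boxes_le (g := fst) K0M K0c K0V f0 t0 sK0.
have B1 := moment_boxes_le (g := snd) K1M K1c K1V f1 t1 sK1.
rewrite -[moment k p K0]fineK ?moment_fin// lee_fin in B0.
rewrite -[moment k p K1]fineK ?moment_fin// lee_fin in B1.
apply: le_trans (leeD A1 A2); rewrite -EFinD lee_fin -big_split/=.
set w := fun u : box R k * box R k => kappa B * bvol u.1.
have C0 : 0 <= C by exact: powR_ge0.
have om0 : 0 <= om * (kappa B * v).
  have [->|[u us]] : v = 0 \/ exists u, u \in s.
  - rewrite /v; case: (s) => [|u s']; first by left; rewrite big_nil.
    by right; exists u; rewrite inE eqxx.
  - by rewrite !mulr0.
  have [up _ ud _ _] := gsd us.
  have d0 : 0 <= d.
    have i := Ordinal k0; move/forallP: ud => /(_ i); apply: le_trans.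
    by rewrite subr_ge0 ltW//; move/forallP: up.
  rewrite mulr_ge0//; first by rewrite !mulr_ge0 ?powR_ge0// ltW// Bnorm_gt0.
  rewrite mulr_ge0 ?(ltW kp)// /v big_seq; apply: sumr_ge0 => u' /gsd[u'p _ _ _ _].
  exact/ltW/bvol_gt0.
have MV : 0 <= MF * (V - kappa B * v).
  rewrite mulr_ge0 ?powR_ge0// subr_ge0.
  apply: (packing Bfree (measurable_compact k K0c) K0V _ t0 sK0).
  by move=> u /gsd[].
have wv : \sum_(u <- s) w u = kappa B * v by rewrite mulr_sumr.
set X := \sum_(u <- s) w u * (F (psi B c0 u.1.1) + om) in B0.
set Y := \sum_(u <- s) w u * (F (psi B c1 u.2.1) + om) in B1.
have -> : \sum_(u <- s) (w u * (F (wavg l (psi B c0 u.1.1) (psi B c1 u.2.1)) - om)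
    + w u * (F (wavg l (psi B c1 u.2.1) (psi B c0 u.1.1)) - om)) =
  C * (X + Y) + kappa B * (\sum_(u <- s) bvol u.1 *
      moment_gap p l (psi B c0 u.1.1) (psi B c1 u.2.1))
   - 2 * (1 + C) * (om * (kappa B * v)).
  rewrite -wv /X /Y -big_split/= !mulr_sumr -big_split/= -sumrB.
  apply: eq_bigr => u _; rewrite /moment_gap -/C /w.
  move: (_ `^ p) (_ `^ p) (_ `^ p) (_ `^ p) => e1 e2 e3 e4; ring.
have h1 : C * (fine (moment k p K0) + fine (moment k p K1)) <=
  C * (X + Y) + 2 * (MF * (V - kappa B * v)).
  apply: (@le_trans _ _ (C * (X + Y + 2 * (MF * (V - kappa B * v))))).
    by rewrite ler_wpM2l//; lra.
  by rewrite mulrDr lerD2l ler_piMl// mulr_ge0.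
have h2 : 2 * (1 + C) * (om * (kappa B * v)) <= 4 * (om * (kappa B * v)).
  by rewrite ler_wpM2r//; move: C1; move: (C) => cc; lra.
by rewrite -(mulrA 2 MF) -(mulrA 4 om); exact: ler_combine h1 h2.
Qed.

End main_estimate.

Lemma sum_good (R : realType) (U : eqType) (s : seq U) (f : U -> R) (good bad1 bad2 : pred U) :
  {in s, forall u, 0 <= f u} -> {in s, forall u, [|| good u, bad1 u | bad2 u]} ->
  \sum_(u <- s) f u <= \sum_(u <- s | good u) f u +
    (\sum_(u <- s | bad1 u) f u + \sum_(u <- s | bad2 u) f u).
Proof.
move=> f0 cov; rewrite [X in X + _]big_mkcond [X in _ + (X + _)]big_mkcond.
rewrite [X in _ + (_ + X)]big_mkcond -!big_split/= !big_seq; apply: ler_sum => u us.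
move: (cov u us) (f0 u us); move: (f u) (good u) (bad1 u) (bad2 u) => x [] [] [] //= _ x0;
  by rewrite ?addr0 ?add0r ?lerDl ?lerDr ?addr_ge0.
Qed.

Section moment_inequalities.
Context {R : realType} {n k : nat}.
Variable B : 'M[R]_(k, n).
Hypotheses (Bfree : row_free B) (k0 : (0 < k)%N).
Local Notation T := (caratheodory_type (@hausdorff_outer R n k)).
Local Notation H := (@hausdorff R n k).

Lemma bsub_img c (b b' : box R k) : bsub b b' -> img B c b `<=` img B c b'.
Proof. by move=> bb' _ [x xb <-]; exists x => //; exact: bsub_in xb. Qed.

Lemma has_bsub_img c (K : set 'rV[R]_n) s (b : box R k) :
  {in s, forall b', img B c b' `<=` K} -> has (bsub b) s -> img B c b `<=` K.
Proof.
by move=> sK /hasP[b' b's bb']; apply: subset_trans (bsub_img bb') (sK _ b's).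
Qed.

Lemma has_bsub_cutlo i t s (b : box R k) : b \in cutlo i t s -> has (bsub b) s.
Proof.
by move=> bs; have [] := @has_cutlo _ _ i t s b; [apply/hasP; exists b => //; exact: bsub_refl|].
Qed.

Lemma has_bsub_cuthi i t s (b : box R k) : b \in cuthi i t s -> has (bsub b) s.
Proof.
by move=> bs; have [] := @has_cuthi _ _ i t s b; [apply/hasP; exists b => //; exact: bsub_refl|].
Qed.

Definition inner_boxes c (K : set 'rV[R]_n) (s : seq (box R k)) :=
  [/\ all (@bpos R k) s, pairwise (@bsep R k) s & {in s, forall b, img B c b `<=` K}].

Lemma inner_boxes_volume c K s (v : R) : inner_boxes c K s -> 0 <= v <= vols s ->
  exists2 s', inner_boxes c K s' & vols s' = v.
Proof.
move=> [sp ss sK] vs; have [t tv] := cutlo_ivt (Ordinal k0) sp vs.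
exists (cutlo (Ordinal k0) t s) => //; split; [exact: cutlo_pos|exact: cutlo_sep|].
by move=> b /has_bsub_cutlo; exact: has_bsub_img.
Qed.

(** The family with the larger volume is cut down by a hyperplane to the volume of the other. *)
Lemma equal_volume_boxes c0 c1 r0 r1 m0 m1 K0 K1 (V eta : R) :
  body B c0 r0 m0 K0 -> body B c1 r1 m1 K1 -> H K0 = V%:E -> H K1 = V%:E -> 0 < eta ->
  exists sA sB, [/\ inner_boxes c0 K0 sA, inner_boxes c1 K1 sB, vols sA = vols sB &
    V - eta <= kappa B * vols sA].
Proof.
move=> b0 b1 V0 V1 eta0.
have [sA [Ap As AK Av]] := body_approx Bfree k0 b0 V0 eta0.
have [sB [Bp Bs BK Bv]] := body_approx Bfree k0 b1 V1 eta0.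
have [AB|/ltW BA] := leP (vols sA) (vols sB).
  have [||sB' B' vB] := @inner_boxes_volume c1 K1 sB (vols sA); first by split.
    by rewrite vols_ge0.
  by exists sA, sB'; split.
have [||sA' A' vA] := @inner_boxes_volume c0 K0 sA (vols sB); first by split.
  by rewrite vols_ge0.
by exists sA', sB; split => //; rewrite vA.
Qed.

Variables (p l : R).
Hypotheses (p1 : 1 <= p) (l01 : 0 <= l <= 1).
Variables (K0 K1 : set 'rV[R]_n) (c0 c1 : 'rV[R]_n) (r0 r1 m0 m1 V : R).
Hypotheses (K0c : compact K0) (K1c : compact K1).
Hypotheses (K0b : body B c0 r0 m0 K0) (K1b : body B c1 r1 m1 K1).
Hypotheses (K0V : H K0 = V%:E) (K1V : H K1 = V%:E).
Local Notation C := (`|2 * l - 1| `^ p).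

Lemma common_bound : exists2 M, 0 < M &
  (forall x, K0 x -> enorm x <= M) /\ (forall x, K1 x -> enorm x <= M).
Proof.
have [M0 M00 HM0] := compact_enorm_bounded K0c.
have [M1 M10 HM1] := compact_enorm_bounded K1c.
exists (M0 + M1); first by rewrite addr_gt0.
by split=> x => [/HM0|/HM1] /le_trans; apply; rewrite ?lerDl ?lerDr ltW.
Qed.

Lemma coupling_imgs d sA sB s : inner_boxes c0 K0 sA -> inner_boxes c1 K1 sB ->
  coupling d sA sB s ->
  {in s, forall u, img B c0 u.1 `<=` K0} /\ {in s, forall u, img B c1 u.2 `<=` K1}.
Proof.
move=> [_ _ AK] [_ _ BK] [_ hs _ _].
by split=> u /(allP hs)/andP[]; [move=> + _|move=> _]; exact: has_bsub_img.
Qed.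

Let V0 : 0 <= V. Proof. by rewrite -lee_fin -K0V hausdorff_ge0. Qed.

Lemma inner_boxes_le c K s : compact K -> H K = V%:E -> inner_boxes c K s ->
  kappa B * vols s <= V.
Proof.
move=> Kc KV [sp ss sK].
apply: (packing (g := id) Bfree (measurable_compact k Kc) KV (allP sp) ss sK).
Qed.

(** Valid for every coupling that is fine enough, so that strictness can supply one with a
    prescribed first cut and further restrictions on the mesh. *)
Lemma estimate_coupling (e M : R) : 0 < e -> 0 < M ->
  (forall x, K0 x -> enorm x <= M) -> (forall x, K1 x -> enorm x <= M) ->
  exists2 eta, 0 < eta & exists2 d, 0 < d &
  forall eta' d' sA sB s, 0 < eta' <= eta -> 0 < d' <= d ->
    inner_boxes c0 K0 sA -> inner_boxes c1 K1 sB ->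
    V - eta' <= kappa B * vols sA -> coupling d' sA sB s ->
    ((C * (fine (moment k p K0) + fine (moment k p K1))
    + kappa B * (\sum_(u <- s) bvol u.1 * moment_gap p l (psi B c0 u.1.1) (psi B c1 u.2.1))
    - e)%:E <= moment k p (interpolate K0 K1 l) + moment k p (interpolate K1 K0 l))%E.
Proof.
move=> e0 M0 K0M K1M.
have MF0 : 0 < M `^ p by exact: powR_gt0.
pose L := p * M `^ (p - 1) * Bnorm B.
have L0 : 0 < L by rewrite !mulr_gt0 ?powR_gt0 ?Bnorm_gt0// (lt_le_trans _ p1).
have V1 : 0 < V + 1 by rewrite ltr_wpDl.
(* Each of the two error terms of [main_estimate] is allotted [e / 2]. *)
exists (e / (4 * M `^ p)); first by rewrite divr_gt0// mulr_gt0.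
exists (e / (8 * L * (V + 1))); first by rewrite divr_gt0// mulr_gt0// mulr_gt0.
move=> eta d sA sB s /andP[_ etae] /andP[d0 de] A0 B1 Av cs.
have [sK0 sK1] := coupling_imgs A0 B1 cs.
have vV := inner_boxes_le K0c K0V A0.
case: cs => sd _ ssep vs.
have := main_estimate Bfree k0 p1 l01 K0c K1c K0M K1M K0V K1V sd ssep sK0 sK1.
apply: le_trans; rewrite lee_fin vs.
have h1 : 2 * M `^ p * (V - kappa B * vols sA) <= e / 2.
  apply: (@le_trans _ _ (2 * M `^ p * (e / (4 * M `^ p)))).
    by rewrite ler_wpM2l ?mulr_ge0 ?(ltW MF0)//; lra.
  rewrite le_eqVlt; apply/orP; left; apply/eqP; field; exact: lt0r_neq0.
have h2 : 4 * (p * M `^ (p - 1) * (d * Bnorm B)) * (kappa B * vols sA) <= e / 2.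
  rewrite (_ : 4 * _ = 4 * L * d); last by rewrite /L; ring.
  clearbody L.
  have kv0 : 0 <= kappa B * vols sA.
    by rewrite mulr_ge0 ?(ltW (kappa_gt0 Bfree k0))// vols_ge0//; case: A0.
  apply: (@le_trans _ _ (4 * L * (e / (8 * L * (V + 1))) * (V + 1))).
    have L4 : 0 <= 4 * L by rewrite mulr_ge0// ltW.
    apply: ler_pM => //; first by rewrite mulr_ge0// ltW.
      by rewrite ler_wpM2l.
    by apply: le_trans vV _; rewrite lerDl.
  rewrite le_eqVlt; apply/orP; left; apply/eqP; field.
  by rewrite !lt0r_neq0.
by rewrite -[leRHS]addrA -opprD lerD2l lerN2 [leRHS]splitr lerD.
Qed.

Lemma moment_ineq :
  ((C * (fine (moment k p K0) + fine (moment k p K1)))%:E <=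
   moment k p (interpolate K0 K1 l) + moment k p (interpolate K1 K0 l))%E.
Proof.
apply/lee_addgt0Pr => e e0; have [M M0 [K0M K1M]] := common_bound.
have [eta eta0 [d d0 est]] := estimate_coupling e0 M0 K0M K1M.
have [sA [sB [A0 B1 AB Av]]] := equal_volume_boxes K0b K1b K0V K1V eta0.
have [s cs] : exists s, coupling d sA sB s.
  by case: A0 B1 => [? ? _] [? ? _]; exact: coupling_exists.
have eta' : 0 < eta <= eta by rewrite eta0 lexx.
have d' : 0 < d <= d by rewrite d0 lexx.
have h := est eta d sA sB s eta' d' A0 B1 Av cs; rewrite -leeBlDr//.
apply: le_trans h; rewrite -EFinB lee_fin lerD2r lerDl mulr_ge0 ?(ltW (kappa_gt0 Bfree k0))//.
rewrite big_seq; apply: sumr_ge0 => u us; rewrite mulr_ge0 ?moment_gap_ge0//.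
by apply/ltW/bvol_gt0; case: cs => /allP/(_ u us)/and5P[].
Qed.

(** Boxes of [K] between two values of coordinate [i] pack into a slab whose other sides are at most
    2m, by the outer cube of [body]. *)
Lemma slab_volume c r m K i (a b : R) (U : eqType) (g : U -> box R k) (s : seq U) :
  body B c r m K -> a < b ->
  {in s, forall u, bpos (g u)} -> pairwise (relpre g (@bsep R k)) s ->
  {in s, forall u, img B c (g u) `<=` K} ->
  {in s, forall u, a <= (g u).1 ord0 i /\ (g u).2 ord0 i <= b} ->
  \sum_(u <- s) bvol (g u) <= (b - a) * (2 * m) ^+ k.-1.
Proof.
move=> [_ m_gt0 _ _ Km] ab pos sep sK sab.
pose slab : box R k := (upd (const_mx (- m)) i a, upd (const_mx m) i b).
have slabp : bpos slab.
  apply/forallP => j; rewrite !mxE; case: ifP => // _; lra.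
have slabv : bvol slab = (b - a) * (2 * m) ^+ k.-1.
  rewrite (bvolE i) !mxE eqxx; congr (_ * _); rewrite /bface.
  under eq_bigr => j /negbTE ji do rewrite !mxE ji opprK -mulr2n -mulr_natl.
  by rewrite prodr_const cardC1 card_ord.
have := packing Bfree (measurable_img Bfree c slab) (hausdorff_img Bfree c slabp) pos sep.
rewrite ler_pM2l ?kappa_gt0// slabv; apply => u us _ [x xu <-].
exists x => // j; have [y ym] := Km _ (sK u us _ (ex_intro2 _ _ x xu erefl)).
move=> /(congr1 (fun z => coo B (z - c))); rewrite !coo_psi// => yx.
rewrite !mxE; case: eqP => [->|_]; last by have := ym j; rewrite yx !mxE.
have [h1 h2] := sab u us; have /andP[h3 h4] := xu i.
by rewrite (le_trans h1)//= (lt_le_trans h4).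
Qed.

(** Half of the inner cube, of volume [v0], can be added on one side of the cut to the boxes on the
    other side, and the result still packs into [K]. Hence one side can never use up almost all of
    the volume. *)
Lemma halves_volume c r m K i s (eta v : R) : body B c r m K -> compact K -> H K = v%:E ->
  inner_boxes c K s -> v - eta <= kappa B * vols s ->
  let v0 := r * (2 * r) ^+ k.-1 in
  kappa B * v0 - eta <= kappa B * vols (cuthi i 0 s) /\
  kappa B * v0 - eta <= kappa B * vols (cutlo i 0 s).
Proof.
move=> [r_gt0 _ _ rK _] Kc Kv [sp ss sK] sv v0.
pose hi : box R k := (upd (const_mx (- r)) i 0, const_mx r).
pose lo : box R k := (const_mx (- r), upd (const_mx r) i 0).
have hip : bpos hi by apply/forallP => j; rewrite !mxE; case: ifP => _; rewrite ?mxE; lra.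
have lop : bpos lo by apply/forallP => j; rewrite !mxE; case: ifP => _; rewrite ?mxE; lra.
have hiv : bvol hi = v0.
  rewrite (bvolE i) !mxE eqxx subr0; congr (_ * _); rewrite /bface.
  under eq_bigr => j /negbTE ji do rewrite !mxE ji opprK -mulr2n -mulr_natl.
  by rewrite prodr_const cardC1 card_ord.
have lov : bvol lo = v0.
  rewrite (bvolE i) !mxE eqxx sub0r opprK; congr (_ * _); rewrite /bface.
  under eq_bigr => j /negbTE ji do rewrite !mxE ji opprK -mulr2n -mulr_natl.
  by rewrite prodr_const cardC1 card_ord.
have inK (b : box R k) : bsub b (symbox r : box R k) -> img B c b `<=` K.
  move=> br _ [x xb <-]; apply: rK => j; have := bsub_in br xb j.
  by rewrite !mxE ler_norml => /andP[-> /ltW->].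
have subhi : bsub hi (symbox r : box R k).
  by apply/forallP => j; rewrite !mxE lexx andbT; case: ifP => _; rewrite ?mxE// lerNl oppr0 ltW.
have sublo : bsub lo (symbox r : box R k).
  by apply/forallP => j; rewrite !mxE lexx/=; case: ifP => _; rewrite ?mxE// ltW.
have mK := measurable_compact k Kc.
have pack b s' : bpos b -> bsub b (symbox r : box R k) -> all (@bpos R k) s' ->
    pairwise (@bsep R k) s' -> {in s', forall b', has (bsub b') s} ->
    all (bsep b) s' -> kappa B * (bvol b + vols s') <= v.
  move=> bp br s'p s's s'K bs'.
  have := @packing _ _ _ B Bfree c K v _ id (b :: s') mK Kv.
  rewrite big_cons; apply.
  - by move=> u; rewrite inE => /predU1P[->//|]; exact: (allP s'p).
  - by rewrite /= bs'.
  - move=> u; rewrite inE => /predU1P[->|/s'K]; first exact: inK.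
    exact: has_bsub_img.
have vE := vols_cut i 0 sp.
have plo := pack hi (cutlo i 0 s) hip subhi (cutlo_pos i 0 sp) (cutlo_sep i 0 ss)
  (@has_bsub_cutlo i 0 s).
have phi := pack lo (cuthi i 0 s) lop sublo (cuthi_pos i 0 sp) (cuthi_sep i 0 ss)
  (@has_bsub_cuthi i 0 s).
have {}plo : kappa B * (v0 + vols (cutlo i 0 s)) <= v.
  rewrite -hiv; apply: plo; apply/allP => b /mapP[b' _ ->].
  by apply/existsP; exists i; rewrite orbC /before !mxE eqxx ge_min lexx orbT.
have {}phi : kappa B * (v0 + vols (cuthi i 0 s)) <= v.
  rewrite -lov; apply: phi; apply/allP => b /mapP[b' _ ->].
  by apply/existsP; exists i; rewrite /before !mxE eqxx le_max lexx orbT.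
rewrite vE mulrDr in sv; rewrite !mulrDr in plo phi.
by move: plo phi sv; move: (kappa B * _) (kappa B * _) (kappa B * _) => *; split; lra.
Qed.

(** * Strictness when the directions are not spanned by the base point *)

Section strict.
Variables (i : 'I_k) (q : 'rV[R]_n) (e1 : R).
Hypotheses (q1 : enorm q = 1) (l01s : 0 < l < 1).
Hypothesis q0E : forall x, dotp q (psi B c0 x) = x ord0 i.
Hypothesis q1E : forall x, dotp q (psi B c1 x) = e1 + x ord0 i.

Let S0 := (2 * m0) ^+ k.-1.
Let S1 := (2 * m1) ^+ k.-1.
Let v0 := r0 * (2 * r0) ^+ k.-1.

Let m0_gt0 : 0 < m0. Proof. by case: K0b. Qed.
Let m1_gt0 : 0 < m1. Proof. by case: K1b. Qed.
Let r0_gt0 : 0 < r0. Proof. by case: K0b. Qed.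
Let S0_gt0 : 0 < S0. Proof. by rewrite exprn_gt0// mulr_gt0. Qed.
Let S1_gt0 : 0 < S1. Proof. by rewrite exprn_gt0// mulr_gt0. Qed.
Let v0_gt0 : 0 < v0. Proof. by rewrite mulr_gt0// exprn_gt0// mulr_gt0. Qed.

(* The pieces that come closer than [del] to the hyperplane [q^perp] are contained
   in slabs of width [2 del] of the two bodies. *)
Lemma good_volume (del d : R) (s : seq (box R k * box R k)) : 0 < del -> d <= del ->
  all (goodpair d) s -> pairwise (@psep R k) s ->
  {in s, forall u, img B c0 u.1 `<=` K0} -> {in s, forall u, img B c1 u.2 `<=` K1} ->
  ({in s, forall u : box R k * box R k, 0 <= u.1.1 ord0 i /\ 0 <= e1 + u.2.1 ord0 i} ->
   \sum_(u <- s) bvol u.1 <=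
   \sum_(u <- (s : seq (box R k * box R k)) | (del <= u.1.1 ord0 i) && (del <= e1 + u.2.1 ord0 i)) bvol u.1 +
   2 * del * (S0 + S1)) /\
  ({in s, forall u : box R k * box R k, u.1.2 ord0 i <= 0 /\ e1 + u.2.2 ord0 i <= 0} ->
   \sum_(u <- s) bvol u.1 <=
   \sum_(u <- s | (u.1.2 ord0 i <= - del) && (e1 + u.2.2 ord0 i <= - del)) bvol u.1 +
   2 * del * (S0 + S1)).
Proof.
move=> del0 ddel sd ssep sK0 sK1.
have gs u : u \in s -> [/\ bpos u.1, bpos u.2, u.1.2 ord0 i - u.1.1 ord0 i <= del,
    u.2.2 ord0 i - u.2.1 ord0 i <= del & bvol u.1 = bvol u.2].
  move=> /(allP sd)/and5P[? ? /forallP/(_ i) h3 /forallP/(_ i) h4 /eqP ?].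
  by split => //; exact: le_trans ddel.
have f0 : {in s, forall u, 0 <= bvol u.1} by move=> u /gs[h _ _ _ _]; exact/ltW/bvol_gt0.
have slab0 (P : pred (box R k * box R k)) a b : b - a = 2 * del ->
    {in s, forall u, P u -> a <= u.1.1 ord0 i /\ u.1.2 ord0 i <= b} ->
    \sum_(u <- s | P u) bvol u.1 <= 2 * del * S0.
  move=> ba Pab; rewrite -big_filter -ba.
  apply: (slab_volume (g := fst) (s := [seq u <- s | P u]) K0b).
  - by rewrite -subr_gt0 ba mulr_gt0.
  - by move=> u; rewrite mem_filter => /andP[_ /gs[]].
  - by apply: pairwise_filter; apply: sub_pairwise ssep => u u'; exact: psep_fst.
  - by move=> u; rewrite mem_filter => /andP[_]; exact: sK0.
  - by move=> u; rewrite mem_filter => /andP[Pu us]; exact: Pab.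
have slab1 (P : pred (box R k * box R k)) a b : b - a = 2 * del ->
    {in s, forall u, P u -> a <= u.2.1 ord0 i /\ u.2.2 ord0 i <= b} ->
    \sum_(u <- s | P u) bvol u.1 <= 2 * del * S1.
  move=> ba Pab; rewrite big_seq_cond.
  rewrite (eq_bigr (fun u => bvol u.2)); last by move=> u /andP[/gs[]].
  rewrite -big_seq_cond -big_filter -ba.
  apply: (slab_volume (g := snd) (s := [seq u <- s | P u]) K1b).
  - by rewrite -subr_gt0 ba mulr_gt0.
  - by move=> u; rewrite mem_filter => /andP[_ /gs[]].
  - by apply: pairwise_filter; apply: sub_pairwise ssep => u u'; exact: psep_snd.
  - by move=> u; rewrite mem_filter => /andP[_]; exact: sK1.
  - by move=> u; rewrite mem_filter => /andP[Pu us]; exact: Pab.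
split=> su; rewrite mulrDr.
  pose good (u : box R k * box R k) := (del <= u.1.1 ord0 i) && (del <= e1 + u.2.1 ord0 i).
  pose bad1 (u : box R k * box R k) := u.1.1 ord0 i < del.
  pose bad2 (u : box R k * box R k) := e1 + u.2.1 ord0 i < del.
  have cov : {in s, forall u, [|| good u, bad1 u | bad2 u]}.
    by move=> u _; rewrite /good /bad1 /bad2 !leNgt; case: (_ < _); case: (_ < _).
  apply: (le_trans (sum_good f0 cov)).
  rewrite lerD2l; apply: lerD.
    apply: (slab0 _ 0 (2 * del)); first by rewrite subr0.
    move=> u us; rewrite /bad1 => ud; have [h1 _] := su u us; have [_ _ h2 _ _] := gs u us; split=> //.
    by move: (u.1.1 _ _) (u.1.2 _ _) ud h1 h2 => *; lra.
  apply: (slab1 _ (- e1) (- e1 + 2 * del)); first by rewrite addrC addKr.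
  move=> u us; rewrite /bad2 => ud; have [_ h1] := su u us; have [_ _ _ h2 _] := gs u us.
  by move: (u.2.1 _ _) (u.2.2 _ _) ud h1 h2 => *; split; lra.
pose good (u : box R k * box R k) := (u.1.2 ord0 i <= - del) && (e1 + u.2.2 ord0 i <= - del).
pose bad1 (u : box R k * box R k) := - del < u.1.2 ord0 i.
pose bad2 (u : box R k * box R k) := - del < e1 + u.2.2 ord0 i.
have cov : {in s, forall u, [|| good u, bad1 u | bad2 u]}.
  by move=> u _; rewrite /good /bad1 /bad2 !leNgt; case: (_ < _); case: (_ < _).
apply: (le_trans (sum_good f0 cov)).
rewrite lerD2l; apply: lerD.
  apply: (slab0 _ (- (2 * del)) 0); first by rewrite sub0r opprK.
  move=> u us; rewrite /bad1 => ud; have [h1 _] := su u us; have [_ _ h2 _ _] := gs u us; split=> //.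
  by move: (u.1.1 _ _) (u.1.2 _ _) ud h1 h2 => *; lra.
apply: (slab1 _ (- e1 - 2 * del) (- e1)); first by rewrite opprB addrC subrK.
move=> u us; rewrite /bad2 => ud; have [_ h1] := su u us; have [_ _ _ h2 _] := gs u us.
by move: (u.2.1 _ _) (u.2.2 _ _) ud h1 h2 => *; split; lra.
Qed.

Lemma moment_strict :
  ((C * (fine (moment k p K0) + fine (moment k p K1)))%:E <
   moment k p (interpolate K0 K1 l) + moment k p (interpolate K1 K0 l))%E.
Proof.
have [M M0 [K0M K1M]] := common_bound; have kp := kappa_gt0 Bfree k0.
(* The slabs around [q^perp] then cost at most v0 / 4. With the choice of [eta'] below, each half of
   the boxes in K_0 has volume at least (3/4) v0, so good pairs of volume v0 / 2 remain. *)
pose del := v0 / (8 * (S0 + S1)).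
have S_gt0 : 0 < S0 + S1 by rewrite addr_gt0.
have del0 : 0 < del by rewrite divr_gt0// mulr_gt0.
have delS : 2 * del * (S0 + S1) = v0 / 4 by rewrite /del; field; exact: lt0r_neq0.
have [ep ep0 Hp] := moment_gap_halfspace p1 l01 M l01s del0 q1.
have qN1 : enorm (- q) = 1 by rewrite enormN.
have [em em0 Hm] := moment_gap_halfspace p1 l01 M l01s del0 qN1.
pose eps := Order.min ep em.
have eps0 : 0 < eps by rewrite lt_min ep0 em0.
(* The good pairs contribute at least [G], and the approximation error is held to [G / 2]. *)
pose G := kappa B * eps * (v0 / 2).
have G0 : 0 < G by apply: mulr_gt0; [exact: mulr_gt0|exact: divr_gt0].
have G2 : 0 < G / 2 by rewrite divr_gt0.
have [eta eta0 [d d0 est]] := estimate_coupling G2 M0 K0M K1M.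
pose eta' := Order.min eta (kappa B * v0 / 4).
have eta'0 : 0 < eta' by rewrite lt_min eta0 divr_gt0// mulr_gt0.
have eta'k : eta' <= kappa B * v0 / 4 by rewrite ge_min lexx orbT.
pose d' := Order.min d del.
have d'0 : 0 < d' by rewrite lt_min d0 del0.
have d'del : d' <= del by rewrite ge_min lexx orbT.
have [sA [sB [A0 B1 AB Av]]] := equal_volume_boxes K0b K1b K0V K1V eta'0.
have [t' [s1 [s2 [cs1 cs2 cs]]]] : exists t' s1 s2,
    [/\ coupling d' (cutlo i 0 sA) (cutlo i t' sB) s1,
    coupling d' (cuthi i 0 sA) (cuthi i t' sB) s2 & coupling d' sA sB (s1 ++ s2)].
  by case: A0 B1 => [? ? _] [? ? _]; exact: coupling_cut.
have [hiv lov] := halves_volume i K0b K0c K0V A0 Av.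
have [sK0 sK1] := coupling_imgs A0 B1 cs.
have hest : _ := est eta' d' sA sB (s1 ++ s2) _ _ A0 B1 Av cs.
rewrite eta'0 ge_min lexx d'0 ge_min lexx in hest; have {}hest := hest isT isT.
apply: lt_le_trans hest; rewrite lte_fin -addrA ltrDl subr_gt0.
apply: (@lt_le_trans _ _ G); first by rewrite gtr_pMr ?invf_lt1// ltr1n.
rewrite /G -mulrA ler_pM2l//.
have gapg u : u \in s1 ++ s2 -> 0 <= bvol u.1.
  by case: cs => /allP gs _ _ _ /gs/and5P[h _ _ _ _]; exact/ltW/bvol_gt0.
have corner c (b : box R k) K : bpos b -> img B c b `<=` K -> K (psi B c b.1).
  by move=> /forallP bp; apply; exists b.1 => // j; rewrite lexx bp.
have x0K u : u \in s1 ++ s2 -> K0 (psi B c0 u.1.1).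
  move=> us; apply: (corner _ u.1 _ _ (sK0 u us)).
  by case: cs => /allP/(_ u us)/and5P[].
have x1K u : u \in s1 ++ s2 -> K1 (psi B c1 u.2.1).
  move=> us; apply: (corner _ u.2 _ _ (sK1 u us)).
  by case: cs => /allP/(_ u us)/and5P[].
suff [good gm gv] : exists2 good : pred (box R k * box R k),
    (forall u, u \in s1 ++ s2 -> good u ->
       eps <= moment_gap p l (psi B c0 u.1.1) (psi B c1 u.2.1)) &
    v0 / 2 <= \sum_(u <- s1 ++ s2 | good u) bvol u.1.
  apply: (@le_trans _ _ (eps * \sum_(u <- s1 ++ s2 | good u) bvol u.1)).
    by rewrite ler_pM2l.
  rewrite mulr_sumr big_mkcond/= !big_seq; apply: ler_sum => u us.
  case: ifP => gu; last by rewrite mulr_ge0 ?gapg// moment_gap_ge0.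
  by rewrite mulrC ler_wpM2l ?gapg// gm.
have sub1 u : u \in s1 -> u \in s1 ++ s2 by rewrite mem_cat => ->.
have sub2 u : u \in s2 -> u \in s1 ++ s2 by rewrite mem_cat orbC => ->.
have volge w : kappa B * v0 - eta' <= kappa B * w -> 3 / 4 * v0 <= w.
  move=> h; rewrite -(ler_pM2l kp); apply: le_trans h.
  by rewrite lerBrDr mulrCA; move: eta'k; move: (kappa B * v0) => *; lra.
have eps_ep : eps <= ep by rewrite ge_min lexx.
have eps_em : eps <= em by rewrite ge_min lexx orbT.
(* On the cut of K_1 the functional [q] has the value e1 + t', on that of K_0 the value 0. By the
   sign of e1 + t', the upper pairs [s2] lie in q >= 0 on both sides, or the lower pairs [s1] in q
   <= 0; the latter are handled with [- q]. *)
have [et|/ltW et] := leP 0 (e1 + t').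
  case: (cs2) => sd2 hs2 sp2 vs2.
  have [H2 _] := good_volume del0 d'del sd2 sp2 (fun u us => sK0 u (sub2 u us))
     (fun u us => sK1 u (sub2 u us)).
  exists (fun u => (u \in s2) && ((del <= u.1.1 ord0 i) && (del <= e1 + u.2.1 ord0 i))).
    move=> u us /andP[_ /andP[h1 h2]]; apply: le_trans eps_ep _; apply: Hp.
    - exact/K0M/x0K.
    - exact/K1M/x1K.
    - by rewrite q0E.
    - by rewrite q1E.
  apply: (@le_trans _ _ (\sum_(u <- s2 | (del <= u.1.1 ord0 i) &&
      (del <= e1 + u.2.1 ord0 i)) bvol u.1)); last first.
    rewrite big_cat/=; apply: ler_wpDl.
      by rewrite big_seq_cond; apply: sumr_ge0 => u /andP[/sub1 us _]; exact: gapg.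
    by rewrite [leLHS]big_seq_cond.
  have := H2 _; rewrite vs2 delS => /(_ _)/le_trans H3.
  have := volge _ hiv; suff : vols (cuthi i 0 sA) <= \sum_(u <- s2 | (del <= u.1.1 ord0 i) &&
      (del <= e1 + u.2.1 ord0 i)) bvol u.1 + v0 / 4 by move=> *; lra.
  apply: H3 => // u /(allP hs2)/andP[/has_cuthi[_ h1] /has_cuthi[_ h2]]; split => //.
  by apply: le_trans et _; rewrite lerD2l.
case: (cs1) => sd1 hs1 sp1 vs1.
have [_ H2] := good_volume del0 d'del sd1 sp1 (fun u us => sK0 u (sub1 u us))
   (fun u us => sK1 u (sub1 u us)).
exists (fun u => (u \in s1) && ((u.1.2 ord0 i <= - del) && (e1 + u.2.2 ord0 i <= - del))).
  move=> u us /andP[_ /andP[h1 h2]]; apply: le_trans eps_em _.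
  have /and5P[/forallP/(_ i) b1 /forallP/(_ i) b2 _ _ _] : goodpair d' u.
    by case: cs => /allP/(_ u us).
  apply: Hm.
  - exact/K0M/x0K.
  - exact/K1M/x1K.
  - by rewrite dotpNl q0E lerNr (le_trans _ h1)// ltW.
  - by rewrite dotpNl q1E lerNr (le_trans _ h2)// lerD2l ltW.
apply: (@le_trans _ _ (\sum_(u <- s1 | (u.1.2 ord0 i <= - del) &&
    (e1 + u.2.2 ord0 i <= - del)) bvol u.1)); last first.
  rewrite big_cat/=; apply: ler_wpDr.
    by rewrite big_seq_cond; apply: sumr_ge0 => u /andP[/sub2 us _]; exact: gapg.
  by rewrite [leLHS]big_seq_cond.
have := H2 _; rewrite vs1 delS => /(_ _)/le_trans H3.
have := volge _ lov; suff : vols (cutlo i 0 sA) <= \sum_(u <- s1 | (u.1.2 ord0 i <= - del) &&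
    (e1 + u.2.2 ord0 i <= - del)) bvol u.1 + v0 / 4 by move=> *; lra.
apply: H3 => // u /(allP hs1)/andP[/has_cutlo[_ h1] /has_cutlo[_ h2]]; split => //.
by apply: le_trans et; rewrite lerD2l.
Qed.

End strict.
End moment_inequalities.

(** * Charts of convex bodies *)

Section flats.
Context {R : realType} {n : nat}.
Implicit Types (K : set 'rV[R]_n) (c x y v : 'rV[R]_n) (V W : {vspace 'rV[R]_n}).

Lemma flat_direction_sub c d V W : flat c V `<=` flat d W -> (V <= W)%VS.
Proof.
move=> cd; apply/subvP => v vV.
have [w wW dw] : flat d W (c + v) by apply: cd; exists v.
have [w' w'W dw'] : flat d W (c + 0) by apply: cd; exists 0 => //; exact: mem0v.
suff -> : v = w - w' by rewrite rpredB.
transitivity (d + w - (d + w')); first by rewrite dw dw' addr0 addrC addKr.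
by rewrite opprD addrACA subrr add0r.
Qed.

Lemma flat_direction c d V W : flat c V = flat d W -> V = W.
Proof.
by move=> cd; apply/eqP; rewrite eqEsubv; apply/andP; split;
  [apply: (@flat_direction_sub c d)|apply: (@flat_direction_sub d c)]; rewrite cd.
Qed.

Lemma sub_affine_hull K : K `<=` affine_hull K.
Proof.
move=> x Kx; exists 1%N, (fun=> 1), (fun=> x); split => //.
  by rewrite big_ord1.
by rewrite big_ord1 scale1r.
Qed.

Lemma affine_hull_direction K c V x y : affine_hull K = flat c V ->
  K x -> K y -> x - y \in V.
Proof.
move=> KV /sub_affine_hull + /sub_affine_hull; rewrite KV => -[v vV <-] [w wV <-].
by rewrite opprD addrACA subrr add0r rpredB.
Qed.

(** Coefficients with sum 1 turn a point of the hull minus [y] into a linear combination of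
    differences x - y with x in [K]. *)
Lemma affine_hull_direction_sub K c V W y : affine_hull K = flat c V -> K y ->
  (forall x, K x -> x - y \in W) -> (V <= W)%VS.
Proof.
move=> KV Ky KW; apply/subvP => v vV.
have : affine_hull K (y + v).
  have := sub_affine_hull Ky; rewrite KV => -[w wV <-].
  by exists (w + v); rewrite ?addrA//=; exact: rpredD.
move=> [m [a [z [zK a1 yv]]]].
suff -> : v = \sum_i a i *: (z i - y).
  by apply: rpred_sum => i _; apply: rpredZ; exact: KW.
under eq_bigr do rewrite scalerBr.
by rewrite sumrB -yv -scaler_suml a1 scale1r [RHS]addrAC subrr add0r.
Qed.

(** Differences are chosen greedily: if all of them lay in the span of fewer than dim V vectors,
    that span would contain V. *)
Lemma free_differences K c V y r : affine_hull K = flat c V -> K y ->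
  (r <= \dim V)%N -> exists X : seq 'rV[R]_n,
    [/\ size X = r, free X & {in X, forall x, K (y + x)}].
Proof.
move=> KV Ky; elim: r => [_|r IH rV]; first by exists [::]; split => //; rewrite nil_free.
have [X [sX fX XK]] := IH (ltnW rV).
have [x [Kx xX]] : exists x, K x /\ x - y \notin <<X>>%VS.
  apply: contrapT => nex.
  suff /dimvS : (V <= <<X>>)%VS by have := dim_span X; rewrite sX => h /leq_trans/(_ h); rewrite leqNgt rV.
  apply: (affine_hull_direction_sub KV Ky) => x Kx; apply/negPn/negP => xX.
  by apply: nex; exists x.
exists ((x - y) :: X); split; rewrite /= ?sX ?free_cons ?xX//.
move=> z; rewrite inE => /predU1P[->|/XK//].
by rewrite addrC subrK.
Qed.

Definition spans k (B : 'M[R]_(k, n)) V := forall v, (v \in V) = (v <= B)%MS.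

Lemma basis_differences K c V y : affine_hull K = flat c V -> K y ->
  exists B : 'M[R]_(\dim V, n),
    [/\ row_free B, spans B V & forall i, K (y + row i B)].
Proof.
move=> KV Ky; have [X [/eqP sX fX XK]] := free_differences KV Ky (leqnn _).
pose Y := Tuple sX; pose B : 'M[R]_(\dim V, n) := \matrix_i Y`_i.
have XV : <<X>>%VS = V.
  apply/eqP; rewrite eqEdim; apply/andP; split; last by move: fX => /eqP ->; rewrite (eqP sX).
  apply/span_subvP => x /XK Kx; have := affine_hull_direction KV Kx Ky.
  by rewrite addrC addrA addNr add0r.
have mulB (x : 'rV[R]__) : x *m B = \sum_i x ord0 i *: Y`_i.
  by rewrite mulmx_sum_row; apply: eq_bigr => i _; rewrite rowK.
exists B; split.
- apply: inj_row_free => x; rewrite mulB => xB; apply/rowP => i; rewrite mxE.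
  exact: (@freeP _ _ _ Y fX (fun i => x ord0 i)).
- move=> v; have -> : (v \in V) = (v \in <<X>>%VS) by rewrite XV.
  apply/idP/submxP => [vX|[x ->]].
    exists (\row_i coord Y i v); rewrite mulB [LHS](@coord_span _ _ _ Y v vX).
    by apply: eq_bigr => i _; rewrite mxE.
  rewrite mulB; apply: rpred_sum => i _; apply: rpredZ; apply: memv_span.
  by apply: mem_nth; rewrite (eqP sX).
- by move=> i; rewrite rowK; apply: XK; apply: mem_nth; rewrite (eqP sX).
Qed.

Lemma convex_set_mean K m (z : 'I_m.+1 -> 'rV[R]_n) : convex_set K ->
  (forall i, K (z i)) -> K (m.+1%:R^-1 *: \sum_i z i).
Proof.
move=> Kc; elim: m z => [|m IH] z Kz; first by rewrite big_ord1 invr1 scale1r.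
have m1 : m.+1%:R != 0 :> R by rewrite pnatr_eq0.
have m2 : m.+2%:R != 0 :> R by rewrite pnatr_eq0.
rewrite big_ord_recr/=.
have := convex_setE (t := m.+2%:R^-1) Kc (IH (fun i => z (widen_ord (leqnSn _) i)) _) (Kz ord_max).
rewrite /wavg scalerA scalerDr [X in X *: \sum_(_ < _) _](_ : _ = m.+2%:R^-1).
  by apply => //; rewrite invr_ge0 ler0n invf_le1// ler1n.
by move: m1 m2; rewrite -(natr1 m.+1); move: m.+1%:R => t t0 t1; field; rewrite t0 t1.
Qed.

(* All points [y + x B] with [0 <= x_i <= 1/k] are means of points on the
   segments from [y] to [y + row i B]. *)
Lemma convex_box k (B : 'M[R]_(k, n)) K y (x : 'rV[R]_k) : (0 < k)%N -> convex_set K ->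
  K y -> (forall i, K (y + row i B)) -> (forall i, 0 <= x ord0 i <= k%:R^-1) ->
  K (y + x *m B).
Proof.
case: k B x => // k B x _ Kc Ky KB xk.
have k1 : k.+1%:R != 0 :> R by rewrite pnatr_eq0.
suff -> : y + x *m B = k.+1%:R^-1 *: \sum_i wavg (k.+1%:R * x ord0 i) y (y + row i B).
  apply: convex_set_mean => // i; apply: convex_setE => //.
  have /andP[h1 h2] := xk i; rewrite mulr_ge0//=.
  by rewrite -ler_pdivlMl ?mulr1// ltr0n.
rewrite (eq_bigr (fun i => y + (k.+1%:R * x ord0 i) *: row i B)); last first.
  by move=> i _; rewrite /wavg scalerDr addrA -scalerDl subrK scale1r.
rewrite big_split/= sumr_const card_ord -[y *+ _]scaler_nat scalerDr scalerA mulVf// scale1r.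
congr (_ + _); rewrite mulmx_sum_row scaler_sumr; apply: eq_bigr => i _.
by rewrite scalerA mulKf.
Qed.

(** By [convex_box] the cube [0, 1/k]^k in the coordinates at [y] lies in [K]. Its centre is the new
    base point, and half its side is the inner radius. *)
Lemma body_exists k (B : 'M[R]_(k, n)) K c V y : (0 < k)%N -> row_free B -> spans B V ->
  affine_hull K = flat c V -> convex_set K -> compact K -> K y ->
  (forall i, K (y + row i B)) -> exists x r m, K x /\ body B x r m K.
Proof.
move=> k0 Bfree BV KV Kc Kk Ky KB.
pose r : R := (2 * k%:R)^-1; pose x := y + const_mx r *m B.
have k1 : 0 < k%:R :> R by rewrite ltr0n.
have r0 : 0 < r by rewrite invr_gt0 mulr_gt0.
have rr : r + r = k%:R^-1 by rewrite /r; field; exact: lt0r_neq0.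
have xK (z : 'rV[R]_k) : (forall i, `|z ord0 i| <= r) -> K (psi B x z).
  move=> zr; rewrite /psi /x -addrA -mulmxDl; apply: convex_box => // i.
  have := zr i; rewrite !mxE ler_norml -rr.
  by move: (z _ _) => t /andP[h1 h2]; rewrite lerD2l h2 andbT -lerBlDl sub0r.
have Kx : K x.
  have := xK 0; rewrite /psi mul0mx addr0; apply => i.
  by rewrite mxE normr0 ltW.
have [M M0 KM] := compact_enorm_bounded Kk.
have C0 := coonorm_gt0 B.
pose m := coonorm B * (M + M) + 1.
have m0 : 0 < m by rewrite ltr_wpDl// mulr_ge0 ?ltW// addr_gt0.
exists x, r, m; split => //; split => // z Kz.
have := affine_hull_direction KV Kz Kx; rewrite BV => zx.
exists (coo B (z - x)); last by rewrite /psi /coo mulmxKpV// addrC subrK.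
move=> i; have := coo_le B (z - x) i.
have : coonorm B * enorm (z - x) < m.
  rewrite /m ltr_pwDr// ler_pM2l//; apply: le_trans (enormD _ _) _.
  by rewrite enormN lerD ?KM.
move=> h1 /le_lt_trans/(_ h1)/ltr_normlP[h2 h3].
by rewrite ![const_mx _ _ _]mxE h3 lerNl ltW.
Qed.

(** A linear change of coordinates distorts cubes by bounded factors, so the base point is kept and
    only the radii change. *)
Lemma body_change k (B C : 'M[R]_(k, n)) K x r m : row_free B -> row_free C ->
  (B :=: C)%MS -> body B x r m K -> exists r' m', body C x r' m' K.
Proof.
move=> Bfree Cfree BC [r0 m0 Kc rK Km].
have CB0 : 0 < coonorm B * Bnorm C by rewrite mulr_gt0 ?coonorm_gt0 ?Bnorm_gt0.
pose r' := r / (coonorm B * Bnorm C); pose m' := coonorm C * (m * Bnorm B) + 1.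
have r'0 : 0 < r' by rewrite divr_gt0.
have m'0 : 0 < m'.
  by rewrite ltr_wpDl// mulr_ge0 ?mulr_ge0 ?ltW ?coonorm_gt0 ?Bnorm_gt0.
exists r', m'; split => // [z zr|z Kz].
  have -> : psi C x z = psi B x (coo B (z *m C)).
    by rewrite /psi /coo mulmxKpV// BC submxMl.
  apply: rK => i; apply: le_trans (coo_le _ _ _) _.
  rewrite (_ : r = coonorm B * (r' * Bnorm C)).
    by rewrite ler_pM2l ?coonorm_gt0//; apply: enorm_mulB => //; exact: ltW.
  by rewrite mulrCA /r' divfK// lt0r_neq0.
have [w wm <-] := Km _ Kz.
exists (coo C (w *m B)); last by rewrite /psi /coo mulmxKpV// -BC submxMl.
move=> i; have := coo_le C (w *m B) i.
have : coonorm C * enorm (w *m B) < m'.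
  rewrite /m' ltr_pwDr// ler_pM2l ?coonorm_gt0//; apply: enorm_mulB; first exact: ltW.
  by move=> j; have := wm j; rewrite !mxE ler_norml => /andP[-> /ltW].
move=> h1 /le_lt_trans/(_ h1)/ltr_normlP[h2 h3].
by rewrite ![const_mx _ _ _]mxE h3 lerNl ltW.
Qed.

(* A column of [cokermx c] that does not vanish on [v] is a normal vector [q];
   the basis is completed so that [q] reads off one coordinate. *)
Lemma adapted_basis k (B : 'M[R]_(k, n)) c v : row_free B -> (v <= B)%MS ->
  ~~ (v <= c)%MS -> exists (C : 'M[R]_(k, n)) (i : 'I_k) (q : 'rV[R]_n),
    [/\ row_free C, (B :=: C)%MS, enorm q = 1, dotp q c = 0 &
        forall x : 'rV[R]_k, dotp q (x *m C) = x ord0 i].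
Proof.
move=> Bfree /submxP[w ->] vc.
have [j vj] : exists j, (w *m B *m cokermx c) ord0 j != 0.
  apply: contrapT => nj; move: vc; rewrite submxE => /eqP; apply.
  apply/rowP => j; rewrite [RHS]mxE; apply: contrapT => vj; apply: nj.
  by exists j; apply/eqP.
pose q0 := (col j (cokermx c))^T.
have q0E z : dotp q0 z = (z *m cokermx c) ord0 j.
  by rewrite dotpC mxE; apply: eq_bigr => a _; rewrite !mxE.
have q0n : 0 < enorm q0.
  rewrite lt_neqAle enorm_ge0 andbT eq_sym; apply: contra_neq vj => /eqP.
  by rewrite enorm_eq0 => /eqP h; rewrite -q0E h dotp0l.
pose q := (enorm q0)^-1 *: q0.
have qE z : dotp q z = (z *m q^T) ord0 ord0.
  by rewrite dotpC mxE; apply: eq_bigr => a _; rewrite !mxE.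
have [a aE] : exists a : 'rV[R]_k, B *m q^T = a^T by exists (B *m q^T)^T; rewrite trmxK.
have a0 : a != 0.
  apply: contra_neq vj => a0; apply: (mulfI (lt0r_neq0 q0n : (enorm q0) != 0)).
  rewrite mulr0 -q0E; have : dotp q (w *m B) = 0.
    by rewrite qE -mulmxA aE a0 trmx0 mulmx0 mxE.
  by rewrite dotpZl => /eqP; rewrite mulf_eq0 invr_eq0 (gt_eqF q0n) => /eqP ->; rewrite mulr0.
have [i ai] : exists i, a ord0 i != 0.
  apply: contrapT => ni; move/eqP: a0; apply; apply/rowP => i; rewrite [RHS]mxE.
  by apply: contrapT => vi; apply: ni; exists i; apply/eqP.
(* The row [a] lists the values of [q] on the rows of [B]. A rank-one matrix sends it to the [i]-th
   unit vector and is completed to an invertible [g] with the same effect on [a]; the transpose of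
   [g] is the change of basis. *)
pose f : 'M[R]_k := (a ord0 i)^-1 *: delta_mx i i.
have af : a *m f = delta_mx 0 i.
  rewrite /f -scalemxAr; apply/rowP => b; rewrite !mxE (bigD1 i)//= big1 => [|b' /negbTE b'i].
    by rewrite !mxE !eqxx/= addr0; case: eqP; rewrite ?mulr1 ?mulVf ?mulr0.
  by rewrite !mxE b'i mulr0.
have [g gu ag] : {g : 'M[R]_k | g \in unitmx & a *m f = a *m g}.
  by apply: complete_unitmx; rewrite af mxrank_delta rank_rV a0.
exists (g^T *m B), i, q; split.
- by rewrite /row_free mxrankMfree// mxrank_unit// unitmx_tr.
- by apply: eqmx_sym; apply: eqmxMfull; rewrite row_full_unit unitmx_tr.
- by rewrite enormZ ger0_norm ?invr_ge0 ?enorm_ge0// mulVf// lt0r_neq0.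
- by rewrite dotpZl q0E mulmx_coker mxE mulr0.
- move=> x; rewrite qE -!mulmxA aE -trmx_mul -ag af.
  rewrite mxE (bigD1 i)//= big1 => [|b /negbTE bi]; rewrite !mxE ?bi ?eqxx ?mulr1 ?addr0//.
  by rewrite mulr0.
Qed.

End flats.

(** * Segments on a line through the origin *)

Lemma integral_measure_preserving d (T : measurableType d) (R : realType)
    (mu : {measure set T -> \bar R}) (phi : T -> T) (D : set T) (f : T -> \bar R) :
  measurable_fun [set: T] phi ->
  (forall A, measurable A -> mu (phi @^-1` A) = mu A) ->
  measurable D -> measurable_fun D f -> (forall x, 0 <= f x)%E ->
  (\int[mu]_(x in D) f x = \int[mu]_(x in phi @^-1` D) f (phi x))%E.
Proof.
move=> mphi muphi mD mf f0; rewrite -(ge0_integral_pushforward mphi mu mD mf)//.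
by apply: eq_measure_integral => A mA _; rewrite -muphi.
Qed.

Section integral_translate.
Context {R : realType} {n : nat}.
Variable k : nat.
Implicit Types (K : set 'rV[R]_n) (c : 'rV[R]_n).
Local Notation T := (caratheodory_type (@hausdorff_outer R n k)).
Local Notation H := (@hausdorff R n k).

Lemma mem_translate c K x : translate c K x <-> K (x - c).
Proof.
split=> [[y Ky <-]|Kx]; first by rewrite addrC addKr.
by exists (x - c) => //; rewrite addrC subrK.
Qed.

Lemma preimage_add c K : (fun x => c + x) @^-1` K = translate (- c) K.
Proof.
apply/seteqP; split => x; first by move=> Kx; apply/mem_translate; rewrite opprK addrC.
by move=> /mem_translate; rewrite opprK addrC.
Qed.

(** The Caratheodory condition of the preimage on a test set is that of [A] on the translated test
    set. *)
Lemma measurable_add c : measurable_fun [set: T] ((fun x : 'rV[R]_n => c + x) : T -> T).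
Proof.
move=> _ A mA; rewrite setTI preimage_add.
apply: (le_caratheodory_measurable (mu := hausdorff_outer n k)) => X.
rewrite /hausdorff_outer/= -(hausdorff_translate k c X) -(hausdorff_translate k c (X `&` _))
  -(hausdorff_translate k c (X `&` ~` _)) (mA (translate c X)).
rewrite le_eqVlt; apply/orP; left; apply/eqP.
by congr (H _ + H _)%E; apply/seteqP; split=> x; rewrite /setI/= !mem_translate
   /setC/= !mem_translate opprK subrK.
Qed.

Lemma integral_translate c K (f : 'rV[R]_n -> \bar R) : measurable (K : set T) ->
  measurable (translate c K : set T) ->
  measurable_fun [set: T] (f : T -> \bar R) -> (forall x, 0 <= f x)%E ->
  hausdorff_integral k (translate c K) f = hausdorff_integral k K (fun x => f (c + x)).
Proof.
move=> mK mcK mf f0.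
have cK : (fun x => c + x) @^-1` translate c K = K.
  by rewrite preimage_add translateK.
rewrite /hausdorff_integral -[in RHS]cK.
apply: (@integral_measure_preserving _ T R (hausdorff_measure n k) _ _ _ (measurable_add c)).
- move=> A mA; rewrite preimage_add; exact: hausdorff_translate.
- exact: mcK.
- exact: measurable_funTS.
- exact: f0.
Qed.

End integral_translate.

(** The interval is taken on whichever side of [t] has room for it within [a, b]. *)
Lemma lipschitz_pos_interval (R : realType) (f : R -> R) (a b t L : R) : a < b -> a <= t <= b ->
  (forall s s', a <= s <= b -> a <= s' <= b -> `|f s - f s'| <= L * `|s - s'|) -> 0 < f t ->
  exists a' b', [/\ a' < b', a <= a', b' <= b & forall s, a' <= s <= b' -> f t / 2 <= f s].
Proof.
move=> ab /andP[t1 t2] fL ft.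
have L0 : 0 < 2 * (`|L| + 1) by rewrite mulr_gt0// ltr_wpDl.
pose d := Order.min (f t / (2 * (`|L| + 1))) ((b - a) / 2).
have d0 : 0 < d by rewrite lt_min !divr_gt0// subr_gt0.
have dL : d * (2 * (`|L| + 1)) <= f t by rewrite -ler_pdivlMr// ge_min lexx.
have dab : d <= (b - a) / 2 by rewrite ge_min lexx orbT.
have fs s : a <= s <= b -> `|s - t| <= d -> f t / 2 <= f s.
  move=> sab sd; have tab : a <= t <= b by rewrite t1.
  have h1 := fL _ _ sab tab.
  have h2 : L * `|s - t| <= (`|L| + 1) * d.
    apply: (@le_trans _ _ ((`|L| + 1) * `|s - t|)); last by rewrite ler_wpM2l.
    by rewrite ler_wpM2r// ler_wpDr// ler_norm.
  have := le_trans h1 h2; rewrite ler_norml => /andP[h3 _].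
  rewrite mulrC -mulrA in dL.
  by move: h3 dL; move: ((`|L| + 1) * d) => *; lra.
have [h|h] := leP (t + d) b.
  exists t, (t + d); split => //; first by rewrite ltrDl.
  move=> s /andP[h1 h2]; apply: fs; first by rewrite (le_trans t1)//= (le_trans h2).
  by rewrite ger0_norm ?subr_ge0// lerBlDl.
exists (t - d), t; split => //; first by rewrite ltrBlDr ltrDl.
  by lra.
move=> s /andP[h1 h2]; apply: fs; first by rewrite (le_trans h2)// andbT; lra.
by rewrite distrC ger0_norm ?subr_ge0//; lra.
Qed.

Section segments.
Context {R : realType} {n : nat}.
Variable u : 'rV[R]_n.
Hypothesis u1 : enorm u = 1.
Local Notation T := (caratheodory_type (@hausdorff_outer R n 1)).
Local Notation H := (@hausdorff R n 1).
Implicit Types (K : set 'rV[R]_n) (a b s t : R).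

Definition segment a b : set 'rV[R]_n := [set t *: u | t in [set t | a <= t <= b]].

Let u0 : u != 0. Proof. by rewrite -enorm_eq0 u1 oner_eq0. Qed.

Lemma unit_row_free : row_free (u : 'M[R]_(1, n)).
Proof. by rewrite /row_free rank_rV u0. Qed.

Lemma dotp_unit t : dotp u (t *: u) = t.
Proof. by rewrite dotpZr -enorm_sqr u1 expr1n mulr1. Qed.

Lemma img_segment a b : img u 0 (const_mx a, const_mx b) = [set t *: u | t in [set t | a <= t < b]].
Proof.
apply/seteqP; split => [_ [x xab <-]|_ [t tab <-]].
  exists (x ord0 ord0); first by have := xab ord0; rewrite !mxE.
  by rewrite /psi add0r [in RHS](mx11_scalar x) mul_scalar_mx.
exists (const_mx t); first by move=> i; rewrite !mxE.
by rewrite /psi add0r (mx11_scalar (const_mx t)) mul_scalar_mx mxE.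
Qed.

Lemma bpos_const a b : a < b -> bpos ((const_mx a, const_mx b) : box R 1).
Proof. by move=> ab; apply/forallP => i; rewrite !mxE. Qed.

Lemma hausdorff_img_segment a b : a < b ->
  H (img u 0 (const_mx a, const_mx b)) = (kappa u * (b - a))%:E.
Proof.
move=> ab; rewrite (hausdorff_img unit_row_free 0 (bpos_const ab)) /bvol big_ord1.
by rewrite !mxE.
Qed.

(** Box images are half-open; the closed segment fits between the half-open one with the same ends
    and one longer by [e / kappa u]. *)
Lemma hausdorff_segment a b : a < b -> H (segment a b) = (kappa u * (b - a))%:E.
Proof.
move=> ab; apply/eqP; rewrite eq_le; apply/andP; split; last first.
  rewrite -hausdorff_img_segment// img_segment; apply: le_hausdorff.
  by move=> _ [t /andP[h1 h2] <-]; exists t => //=; rewrite h1 ltW.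
have kp := kappa_gt0 unit_row_free isT.
apply/lee_addgt0Pr => e e0.
have abe : a < b + e / kappa u by rewrite ltr_wpDr// divr_ge0 ?ltW.
apply: (@le_trans _ _ (H (img u 0 (const_mx a, const_mx (b + e / kappa u))))).
  rewrite img_segment; apply: le_hausdorff => _ [t /andP[h1 h2] <-]; exists t => //=.
  by rewrite h1 (le_lt_trans h2)// ltrDl divr_gt0.
rewrite hausdorff_img_segment// -EFinD lee_fin addrAC mulrDr.
by rewrite mulrCA divff ?mulr1// lt0r_neq0.
Qed.

Lemma dotp_continuous (q : 'rV[R]_n) : continuous (dotp q).
Proof.
move=> x; rewrite /dotp; apply: (@cvg_big R^o 'I_n +%R 0 xpredT (@add_continuous R^o) _ (nbhs x) _
  (fun i y => q ord0 i * y ord0 i) (fun i => q ord0 i * x ord0 i)) => i _.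
by apply: cvgM; [exact: cvg_cst|exact: coord_continuous].
Qed.

(** The end points are where [dotp u] attains its extrema on [K]; two distinct points exclude equal
    ends. *)
Lemma segment_compact_convex K x y : compact K -> convex_set K ->
  K `<=` [set x | x \in <[u]>%VS] -> K x -> K y -> x != y ->
  exists a b, a < b /\ K = segment a b.
Proof.
move=> Kc Kv Ku Kx Ky xy.
have K0 : K !=set0 by exists x.
have cf : {within K, continuous (dotp u)}.
  by apply: continuous_subspaceT; exact: dotp_continuous.
have [zb Kzb zbM] := compact_EVT_max K0 Kc cf.
have [za Kza zaM] := compact_EVT_min K0 Kc cf.
have uE z : K z -> z = dotp u z *: u.
  by move=> /Ku/vlineP[t ->]; rewrite dotp_unit.
have KE : K = segment (dotp u za) (dotp u zb).
  apply/seteqP; split => [z Kz|_ [t /andP[h1 h2] <-]].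
    by exists (dotp u z); [rewrite /= zaM ?zbM// inE|rewrite -uE].
  have {}Kza : K (dotp u za *: u) by rewrite -uE// -inE.
  have {}Kzb : K (dotp u zb *: u) by rewrite -uE// -inE.
  move: h1 h2 Kza Kzb; move: (dotp u za) (dotp u zb) => a b h1 h2 Kza Kzb.
  have [ba|ab] := leP b a; first by rewrite (_ : t = a)//; lra.
  have ba0 : b - a != 0 by rewrite subr_eq0 gt_eqF.
  have tm : 0 <= (t - a) / (b - a) <= 1.
    rewrite divr_ge0/= ?subr_ge0 ?(ltW ab)// ler_pdivrMr ?subr_gt0// mul1r lerD2r//.
  have := convex_setE Kv Kza Kzb tm; rewrite /wavg !scalerA -scalerDl.
  by rewrite (_ : (1 - _) * a + _ = t)//; field.
exists (dotp u za), (dotp u zb); split => //.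
rewrite ltNge; apply/negP => ba; move/eqP: xy; apply.
have := Kx; have := Ky; rewrite KE => -[s /andP[s1 s2] <-] [t /andP[t1 t2] <-].
by congr (_ *: _); lra.
Qed.

Lemma segment_translate a b s : segment (a + s) (b + s) = translate (s *: u) (segment a b).
Proof.
apply/seteqP; split => [_ [t /= tab <-]|_ [_ [t /= tab <-] <-]].
  exists ((t - s) *: u); last by rewrite -scalerDl addrC subrK.
  by exists (t - s) => //=; lra.
by exists (s + t); [move: tab => /=; lra|rewrite scalerDl].
Qed.

Lemma interpolate_segment a b w (l : R) : 0 <= l <= 1 ->
  interpolate (segment a b) (segment (a + w) (b + w)) l = segment (a + l * w) (b + l * w).
Proof.
move=> /andP[l0 l1]; rewrite interpolateE; apply/seteqP; split.
  move=> _ [[_ _] /= [[s /= /andP[s1 s2] <-] [t /= /andP[t1 t2] <-]] <-].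
  rewrite /wavg !scalerA -scalerDl; exists ((1 - l) * s + l * t) => //=.
  have h1 := ler_wpM2l l0 t1; have h2 := ler_wpM2l l0 t2.
  have l'0 : 0 <= 1 - l by rewrite subr_ge0.
  have h3 := ler_wpM2l l'0 s1; have h4 := ler_wpM2l l'0 s2.
  by apply/andP; split; lra.
move=> _ [t /= /andP[t1 t2] <-].
exists ((t - l * w) *: u, (t - l * w + w) *: u) => /=.
  by split; [exists (t - l * w) => //=; lra|exists (t - l * w + w) => //=; lra].
by rewrite /wavg !scalerA -scalerDl; congr (_ *: _); ring.
Qed.

Lemma compact_segment a b : compact (segment a b).
Proof.
rewrite /segment (_ : [set t | a <= t <= b] = [set` `[a, b]]); last first.
  by apply/seteqP; split => t /=; rewrite in_itv.
apply: continuous_compact; last exact: segment_compact.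
apply: continuous_subspaceT => t; apply: cvgZr_tmp; exact: cvg_id.
Qed.

End segments.

Lemma integral_combination d (T : measurableType d) (R : realType)
    (mu : {measure set T -> \bar R}) (K : set T) (f1 f2 f3 f4 h : T -> R) (C : R) :
  measurable K -> measurable_fun [set: T] f1 -> measurable_fun [set: T] f2 ->
  measurable_fun [set: T] f3 -> measurable_fun [set: T] f4 -> measurable_fun [set: T] h ->
  (forall x, 0 <= f1 x) -> (forall x, 0 <= f2 x) -> (forall x, 0 <= f3 x) ->
  (forall x, 0 <= f4 x) -> (forall x, 0 <= h x) -> 0 <= C ->
  (forall x, f1 x + f2 x = C * (f3 x + f4 x) + h x) ->
  (\int[mu]_(x in K) (f1 x)%:E + \int[mu]_(x in K) (f2 x)%:E =
   C%:E * (\int[mu]_(x in K) (f3 x)%:E + \int[mu]_(x in K) (f4 x)%:E) +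
   \int[mu]_(x in K) (h x)%:E)%E.
Proof.
move=> mK m1 m2 m3 m4 mh p1 p2 p3 p4 ph C0 fE.
have mE f : measurable_fun [set: T] f -> measurable_fun K (fun x => (f x : R)%:E).
  by move=> mf; apply/measurable_EFinP; exact: measurable_funTS.
rewrite -!ge0_integralD//; try (by move=> x _; rewrite lee_fin); try exact: mE.
rewrite -ge0_integralZl_EFin//; last 2 first.
- by move=> x _; rewrite -EFinD lee_fin addr_ge0.
- by apply: emeasurable_funD; exact: mE.
rewrite -ge0_integralD//.
- by apply: eq_integral => x _; rewrite -EFinD fE EFinD EFinM EFinD.
- by move=> x _; rewrite -EFinD -EFinM lee_fin mulr_ge0 ?addr_ge0.
- by apply: measurable_funeM; apply: emeasurable_funD; exact: mE.
- by move=> x _; rewrite lee_fin.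
- exact: mE.
Qed.

Lemma integral_ge_subset d (T : measurableType d) (R : realType)
    (mu : {measure set T -> \bar R}) (f : T -> R) (A K : set T) (h m : R) :
  measurable_fun [set: T] f -> (forall x, 0 <= f x) -> measurable A -> measurable K ->
  A `<=` K -> mu A = m%:E -> 0 <= h -> (forall x, A x -> h <= f x) ->
  ((m * h)%:E <= \int[mu]_(x in K) (f x)%:E)%E.
Proof.
move=> mf f0 mA mK AK Am h0 hf; apply: le_trans (integral_ge_cst mf mA Am h0 hf) _.
apply: ge0_subset_integral => //; first exact: measurable_EFinS.
by move=> x _; rewrite lee_fin.
Qed.

Lemma measurable_combination d (T : measurableType d) (R : realType)
    (f1 f2 f3 f4 : T -> R) (C : R) :
  measurable_fun [set: T] f1 -> measurable_fun [set: T] f2 ->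
  measurable_fun [set: T] f3 -> measurable_fun [set: T] f4 ->
  measurable_fun [set: T] (fun x => f1 x + f2 x - C * (f3 x + f4 x)).
Proof.
move=> m1 m2 m3 m4; apply: measurable_funB; first exact: measurable_funD.
by apply: measurable_funM => //; exact: measurable_funD.
Qed.

Section moment_segments.
Context {R : realType} {n : nat}.
Variable u : 'rV[R]_n.
Hypothesis u1 : enorm u = 1.
Variables (p l a b w : R).
Hypotheses (p1 : 1 <= p) (l01 : 0 <= l <= 1) (ab : a < b).
Local Notation T := (caratheodory_type (@hausdorff_outer R n 1)).
Local Notation K := (segment u a b).
Local Notation C := (`|2 * l - 1| `^ p).

Let F (s : R) (x : 'rV[R]_n) : R := enorm (s *: u + x) `^ p.
Let gap (x : 'rV[R]_n) : R := moment_gap p l x (w *: u + x).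

Let mF s : measurable_fun [set: T] (F s : T -> R).
Proof.
have me : measurable_fun [set: T] ((fun x => enorm (s *: u + x)) : T -> R).
  apply: (@lipschitz_measurable_fun _ _ _ _ 1) => x y; rewrite mul1r.
  by apply: le_trans (ler_enormB _ _) _; rewrite opprD addrACA subrr add0r.
exact: (@measurableT_comp _ _ _ T _ R (@powR R ^~ p) _ _ _ me).
Qed.

Let F_ge0 s x : 0 <= F s x. Proof. exact: powR_ge0. Qed.

Lemma moment_segment s :
  moment 1 p (segment u (a + s) (b + s)) = hausdorff_integral 1 K (fun x => (F s x)%:E).
Proof.
rewrite segment_translate /moment.
apply: (@integral_translate _ _ 1 (s *: u) K (fun x => (enorm x `^ p)%:E)).
- by apply: measurable_compact; exact: compact_segment.
- rewrite -segment_translate; by apply: measurable_compact; exact: compact_segment.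
- by apply/measurable_EFinP; exact: measurable_powR_enorm.
- by move=> x; rewrite lee_fin powR_ge0.
Qed.

Let gapB x : gap x = F (l * w) x + F ((1 - l) * w) x - C * (F 0 x + F w x).
Proof.
rewrite /gap /moment_gap /F scale0r add0r.
rewrite (_ : wavg l x (w *: u + x) = (l * w) *: u + x); last first.
  by apply/rowP => i; rewrite !mxE; ring.
rewrite (_ : wavg l (w *: u + x) x = ((1 - l) * w) *: u + x)//.
by apply/rowP => i; rewrite !mxE; ring.
Qed.

Let gapE x : F (l * w) x + F ((1 - l) * w) x = C * (F 0 x + F w x) + gap x.
Proof. by rewrite gapB [RHS]addrC subrK. Qed.

Let gap_ge0 x : 0 <= gap x. Proof. exact: moment_gap_ge0. Qed.

Let mgap : measurable_fun [set: T] (gap : T -> R).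
Proof.
have -> : gap = fun x => F (l * w) x + F ((1 - l) * w) x - C * (F 0 x + F w x).
  by apply/funext => x; exact: gapB.
exact: (@measurable_combination _ T R _ _ _ _ C (mF _) (mF _) (mF 0) (mF w)).
Qed.

(** All four segments are translates of [K], by 0, w, l w and (1 - l) w. Hence all moments are
    integrals over [K], and the definition of the gap can be integrated exactly, without a
    coupling. *)
Lemma moment_segments_eq :
  (moment 1 p (interpolate K (segment u (a + w) (b + w)) l) +
   moment 1 p (interpolate (segment u (a + w) (b + w)) K l) =
   C%:E * (moment 1 p K + moment 1 p (segment u (a + w) (b + w))) +
   hausdorff_integral 1 K (fun x => (gap x)%:E))%E.
Proof.
have mK : measurable (K : set T) by apply: measurable_compact; exact: compact_segment.
rewrite -(interpolateC K) !interpolate_segment ?moment_segment//; last by move/andP: l01 => *; lra.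
have -> : moment 1 p K = hausdorff_integral 1 K (fun x => (F 0 x)%:E).
  by rewrite -moment_segment !addr0.
exact: (@integral_combination _ T R (hausdorff_measure n 1) K (F (l * w)) (F ((1 - l) * w))
  (F 0) (F w) gap C mK (mF _) (mF _) (mF 0) (mF w) mgap (F_ge0 _) (F_ge0 _) (F_ge0 _) (F_ge0 _)
  gap_ge0 (powR_ge0 _ _) gapE).
Qed.

Let Fline s t : F s (t *: u) = `|s + t| `^ p.
Proof. by rewrite /F -scalerDl enormZ u1 mulr1. Qed.

Let M := `|a| + `|b| + `|w|.
Let L := p * M `^ (p - 1).

Let Fline_lipschitz s t t' : `|s| <= `|w| -> a <= t <= b -> a <= t' <= b ->
  `|F s (t *: u) - F s (t' *: u)| <= L * `|t - t'|.
Proof.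
move=> sw tab t'ab; rewrite !Fline.
have tM r : a <= r <= b -> 0 <= `|s + r| <= M.
  move=> /andP[r1 r2]; rewrite normr_ge0/=; apply: le_trans (ler_normD _ _) _.
  rewrite /M addrC lerD// ler_norml.
  have := ler_norm b; have := ler_norm (- a); rewrite normrN.
  by have := normr_ge0 a; have := normr_ge0 b => *; lra.
apply: le_trans (powR_lipschitz p1 (tM t tab) (tM t' t'ab)) _.
apply: ler_wpM2l; first by apply: mulr_ge0; [exact: le_trans p1|exact: powR_ge0].
by apply: le_trans (ler_dist_dist _ _) _; rewrite opprD addrACA subrr add0r.
Qed.

Let gap_lipschitz t t' : a <= t <= b -> a <= t' <= b ->
  `|gap (t *: u) - gap (t' *: u)| <= (2 * L + 2 * C * L) * `|t - t'|.
Proof.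
move=> tab t'ab.
have sw s : 0 <= s <= 1 -> `|s * w| <= `|w|.
  by move=> /andP[s0 s1]; rewrite normrM (ger0_norm s0) ler_piMl.
have h1 := Fline_lipschitz (sw l l01) tab t'ab.
have h2 : `|F ((1 - l) * w) (t *: u) - F ((1 - l) * w) (t' *: u)| <= L * `|t - t'|.
  by apply: Fline_lipschitz => //; apply: sw; move/andP: l01 => *; lra.
have h3 : `|F 0 (t *: u) - F 0 (t' *: u)| <= L * `|t - t'|.
  by apply: Fline_lipschitz => //; rewrite normr0.
have h4 := Fline_lipschitz (lexx `|w|) tab t'ab.
have C0 : 0 <= C by exact: powR_ge0.
rewrite !gapB; move: h1 h2 h3 h4 C0.
move: (F (l * w) _) (F ((1 - l) * w) _) (F 0 _) (F w _) => a1 a2 a3 a4.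
move: (F (l * w) _) (F ((1 - l) * w) _) (F 0 _) (F w _) => b1 b2 b3 b4.
move: C => c h1 h2 h3 h4 c0.
rewrite (_ : _ - _ = (a1 - b1) + (a2 - b2) - c * ((a3 - b3) + (a4 - b4))); last by ring.
apply: le_trans (ler_normB _ _) _; rewrite [leRHS]mulrDl; apply: lerD.
  by apply: le_trans (ler_normD _ _) _; rewrite -mulrA mulr_natl mulr2n lerD.
rewrite normrM ger0_norm// mulrAC (mulrC 2) -!mulrA ler_wpM2l// mulr_natl (mulrC _ L).
by apply: le_trans (ler_normD _ _) _; rewrite mulr2n lerD.
Qed.

(** The gap is nonnegative and Lipschitz along the segment, so a positive value would persist on an
    interval of positive measure. *)
Lemma integral_gap_eq0 : hausdorff_integral 1 K (fun x => (gap x)%:E) = 0%E ->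
  forall t, a <= t <= b -> gap (t *: u) = 0.
Proof.
move=> I0 t tab; apply/eqP; rewrite eq_le gap_ge0 andbT leNgt; apply/negP => gt.
have [a' [b' [a'b' aa' bb' gs]]] := lipschitz_pos_interval ab tab gap_lipschitz gt.
pose A := img u 0 (const_mx a', const_mx b').
have ufree := unit_row_free u1.
have mA : measurable (A : set T) := measurable_img ufree _ _.
have mK : measurable (K : set T) by apply: measurable_compact; exact: compact_segment.
have g2 : 0 <= gap (t *: u) / 2 by rewrite divr_ge0.
have gA z : A z -> gap (t *: u) / 2 <= gap z.
  rewrite /A img_segment => -[s /= /andP[s1 s2] <-]; apply: gs.
  by rewrite s1 ltW.
have AK : A `<=` K.
  rewrite /A img_segment => _ [s /= /andP[s1 s2] <-]; exists s => //=.
  by rewrite (le_trans aa' s1)/= (le_trans _ bb')// ltW.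
have := @integral_ge_subset _ T R (hausdorff_measure n 1) gap A K _ _ mgap gap_ge0 mA mK AK
  (hausdorff_img_segment u1 a'b') g2 gA.
have -> : (\int[hausdorff_measure n 1]_(x in (K : set T)) (gap x)%:E)%E = 0%E := I0.
apply/negP; rewrite -ltNge lte_fin mulr_gt0 ?divr_gt0// mulr_gt0 ?subr_gt0//.
exact: kappa_gt0.
Qed.

Lemma moment_segments_eq_iff : moment 1 p K \is a fin_num ->
  moment 1 p (segment u (a + w) (b + w)) \is a fin_num ->
  (moment 1 p (interpolate K (segment u (a + w) (b + w)) l) +
   moment 1 p (interpolate (segment u (a + w) (b + w)) K l) =
   C%:E * (moment 1 p K + moment 1 p (segment u (a + w) (b + w))))%E <->
  forall t, a <= t <= b -> moment_gap p l (t *: u) ((t + w) *: u) = 0.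
Proof.
move=> f0 f1; rewrite moment_segments_eq.
have gapl t : moment_gap p l (t *: u) ((t + w) *: u) = gap (t *: u).
  by rewrite /gap -scalerDl addrC.
have fin : (C%:E * (moment 1 p K + moment 1 p (segment u (a + w) (b + w))))%E \is a fin_num.
  by rewrite fin_numM// fin_numD f0 f1.
split=> [e t tab|gap0].
  rewrite gapl; apply: integral_gap_eq0 => //.
  move: e fin; move: (C%:E * _)%E (hausdorff_integral 1 K _) => X Y e Xf.
  by have := congr1 (fun z => z - X)%E e; rewrite /= addeAC subee// add0e.
rewrite [X in (_ + X)%E](_ : _ = 0%E) ?adde0//.
apply: (@integral0_eq _ T R (hausdorff_measure n 1)) => _ [t tab <-].
by rewrite -gapl gap0.
Qed.

End moment_segments.

Section segment_equality.
Context {R : realType} {n : nat}.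
Variable u : 'rV[R]_n.
Hypothesis u1 : enorm u = 1.
Implicit Types (p l a b w t : R).

Lemma wavg_line l t w : wavg l (t *: u) ((t + w) *: u) = (t + l * w) *: u.
Proof. by rewrite /wavg !scalerA -scalerDl; congr (_ *: _); ring. Qed.

Lemma wavg_lineC l t w : wavg l ((t + w) *: u) (t *: u) = (t + (1 - l) * w) *: u.
Proof. by rewrite /wavg !scalerA -scalerDl; congr (_ *: _); ring. Qed.

(** On a line, opposite directions mean that the product of the two coordinates is nonpositive; if
    their absolute values agree as well, their sum 2t + w vanishes. *)
Lemma moment_gap_line_eq0 p l t w : 1 <= p -> 0 < l < 1 ->
  moment_gap p l (t *: u) ((t + w) *: u) = 0 ->
  (p = 1 \/ 2 * t + w = 0) /\ (t + l * w) * (t + (1 - l) * w) <= 0.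
Proof.
move=> p1 l01 /(moment_gap_eq0 p1 (_ : 0 <= l <= 1) l01).
case/andP: (l01) => l0 l1; rewrite (ltW l0) (ltW l1) => /(_ isT).
rewrite wavg_line wavg_lineC dotpZl dotpZr -enorm_sqr u1 expr1n mulr1.
rewrite !enormZ u1 !mulr1.
set x := t + l * w; set y := t + (1 - l) * w => -[h1 h2]; split; last first.
  by rewrite h2 oppr_le0 mulr_ge0.
case: h1 => [->|xy]; [by left|right].
have -> : 2 * t + w = x + y by rewrite /x /y; ring.
rewrite xy -expr2 real_normK ?num_real// in h2.
have xxyy : x ^+ 2 = y ^+ 2 by rewrite -(real_normK (num_real x)) xy real_normK ?num_real.
have : (x + y) ^+ 2 = 0.
  by rewrite sqrrD xxyy h2; ring.
by move/eqP; rewrite sqrf_eq0 => /eqP.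
Qed.

(** With x = t + l w and y = t + (1 - l) w, the coordinates of the two end points scaled by 2l - 1
    are l y - (1 - l) x and l x - (1 - l) y. For x and y of opposite signs no cancellation occurs,
    and the absolute values add up to |x| + |y|. *)
Lemma moment_gap_line_opposite l t w : 0 <= l <= 1 ->
  (t + l * w) * (t + (1 - l) * w) <= 0 ->
  moment_gap 1 l (t *: u) ((t + w) *: u) = 0.
Proof.
move=> l01 xy; rewrite /moment_gap !powRr1 ?enorm_ge0 ?normr_ge0//.
rewrite wavg_line wavg_lineC !enormZ u1 !mulr1 mulrDr -!normrM.
have -> : (2 * l - 1) * t = l * (t + (1 - l) * w) - (1 - l) * (t + l * w) by ring.
have -> : (2 * l - 1) * (t + w) = l * (t + l * w) - (1 - l) * (t + (1 - l) * w) by ring.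
move: xy; move: (t + l * w) (t + (1 - l) * w) => x y xy.
have l'0 : 0 <= 1 - l by lra.
have l0 : 0 <= l by lra.
have [x0|x0] := leP 0 x; have [y0|y0] := leP 0 y.
- have xy0 : x * y = 0 by apply/eqP; rewrite eq_le xy mulr_ge0.
  move/eqP: xy0; rewrite mulf_eq0 => /orP[] /eqP->.
    rewrite !mulr0 subr0 sub0r normrN normr0 add0r !ger0_norm ?mulr_ge0//; ring.
  by rewrite !mulr0 subr0 sub0r normrN normr0 addr0 !ger0_norm ?mulr_ge0//; ring.
- have h1 := mulr_ge0 l0 x0; have h2 := mulr_ge0 l'0 x0.
  have h3 := mulr_ge0_le0 l0 (ltW y0); have h4 := mulr_ge0_le0 l'0 (ltW y0).
  rewrite (ger0_norm x0) (ltr0_norm y0).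
  rewrite ler0_norm; last lra. rewrite ger0_norm; last lra. ring.
- have h1 := mulr_ge0 l0 y0; have h2 := mulr_ge0 l'0 y0.
  have h3 := mulr_ge0_le0 l0 (ltW x0); have h4 := mulr_ge0_le0 l'0 (ltW x0).
  rewrite (ger0_norm y0) (ltr0_norm x0).
  rewrite ger0_norm; last lra. rewrite ler0_norm; last lra. ring.
by move: xy; rewrite leNgt nmulr_lgt0// x0.
Qed.

(** If x <= y, then t + x > 0 implies t + y > 0, and t + y < 0 implies t + x < 0. So the sign
    condition forces t + x <= 0 <= t + y throughout, which is separation at 0. *)
Lemma separates_segments a b x y : a < b ->
  hyperplane_separates u 0 (segment u (a + x) (b + x)) (segment u (a + y) (b + y)) <->
  forall t, a <= t <= b -> (t + x) * (t + y) <= 0.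
Proof.
move=> ab; split=> [sep t tab|neg].
  have Sx : segment u (a + x) (b + x) ((t + x) *: u) by exists (t + x) => //=; lra.
  have Sy : segment u (a + y) (b + y) ((t + y) *: u) by exists (t + y) => //=; lra.
  case: sep => -[s1 s2].
    by have := s1 _ Sx; have := s2 _ Sy; rewrite /= !dotp_unit// => *; rewrite mulr_le0_ge0.
  by have := s1 _ Sy; have := s2 _ Sx; rewrite /= !dotp_unit// => *; rewrite mulr_ge0_le0.
have main x' y' : (forall t, a <= t <= b -> (t + x') * (t + y') <= 0) -> x' <= y' ->
    segment u (a + x') (b + x') `<=` [set z | dotp u z <= 0] /\
    segment u (a + y') (b + y') `<=` [set z | 0 <= dotp u z].
  move=> neg' xy; split=> _ [s /= /andP[s1 s2] <-]; rewrite dotp_unit// leNgt; apply/negP => s0.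
    have := neg' (s - x'); rewrite subrK pmulr_rle0// => h.
    have /h : a <= s - x' <= b by lra.
    lra.
  have := neg' (s - y'); rewrite subrK nmulr_lle0// => h.
  have /h : a <= s - y' <= b by lra.
  lra.
have [xy|/ltW xy] := leP x y; first by left; exact: main.
by right; apply: main => // t tab; rewrite mulrC neg.
Qed.

(** For p different from 1, the equation 2t + w = 0 would have to hold at both end points of a
    segment of positive length. *)
Lemma segments_gap_separates p l a b w : 1 <= p -> 0 < l < 1 -> a < b ->
  (forall t, a <= t <= b -> moment_gap p l (t *: u) ((t + w) *: u) = 0) <->
  p = 1 /\ hyperplane_separates u 0 (segment u (a + l * w) (b + l * w))
     (segment u (a + (1 - l) * w) (b + (1 - l) * w)).
Proof.
move=> p1 l01 ab; split=> [gap0|[-> sep] t tab]; last first.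
  apply: moment_gap_line_opposite; first by lra.
  by move: t tab; apply/separates_segments.
have key t : a <= t <= b -> (p = 1 \/ 2 * t + w = 0) /\ (t + l * w) * (t + (1 - l) * w) <= 0.
  by move=> /gap0; exact: moment_gap_line_eq0.
split; last by apply/separates_segments => // t /key[].
have /key[[//|ha] _] : a <= a <= b by rewrite lexx ltW.
have /key[[//|hb] _] : a <= b <= b by rewrite lexx ltW.
lra.
Qed.

End segment_equality.

(** * The equality case *)

Section equality_case.
Context {R : realType} {n : nat}.
Implicit Types (K : set 'rV[R]_n) (c u : 'rV[R]_n) (V : {vspace 'rV[R]_n}).

Lemma interpolate0 K0 K1 : K1 !=set0 -> interpolate K0 K1 0 = K0.
Proof.
move=> [y K1y]; rewrite interpolateE; apply/seteqP; split => [_ [[x z] /= [Kx _] <-]|x Kx].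
  by rewrite /wavg subr0 scale1r scale0r addr0.
by exists (x, y) => //=; rewrite /wavg subr0 scale1r scale0r addr0.
Qed.

Lemma convex_body_chart K k c V : convex_body K -> affine_hull K = flat c V ->
  \dim V = k -> (0 < k)%N -> exists (B : 'M[R]_(k, n)) x r m,
    [/\ row_free B, spans B V & body B x r m K].
Proof.
move=> [[y Ky] Kv Kc] KV <- k0.
have [B [Bfree BV KB]] := basis_differences KV Ky.
have [x [r [m [_ Kb]]]] := body_exists k0 Bfree BV KV Kv Kc Ky KB.
by exists B, x, r, m.
Qed.

Lemma body_two_points k (B : 'M[R]_(k, n)) c r m K : (0 < k)%N -> row_free B ->
  body B c r m K -> exists x y, [/\ K x, K y & x != y].
Proof.
move=> k0 Bfree [r0 _ _ rK _].
exists (psi B c 0), (psi B c (const_mx r)); split.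
- by apply: rK => i; rewrite mxE normr0 ltW.
- by apply: rK => i; rewrite mxE ger0_norm// ltW.
apply/eqP => /(congr1 (fun z => coo B (z - c) ord0 (Ordinal k0))).
by rewrite !coo_psi// !mxE => /eqP; rewrite lt_eqF.
Qed.

Lemma moment_strict_transversal k (B : 'M[R]_(k, n)) K0 K1 c0 c1 r0 r1 m0 m1
    (p l W : R) (v : 'rV[R]_n) : row_free B -> (0 < k)%N -> 1 <= p -> 0 < l < 1 ->
  compact K0 -> compact K1 -> body B c0 r0 m0 K0 -> body B c1 r1 m1 K1 ->
  hausdorff k K0 = W%:E -> hausdorff k K1 = W%:E -> (v <= B)%MS -> ~~ (v <= c0)%MS ->
  ((`|2 * l - 1| `^ p * (fine (moment k p K0) + fine (moment k p K1)))%:E <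
   moment k p (interpolate K0 K1 l) + moment k p (interpolate K1 K0 l))%E.
Proof.
move=> Bfree k0 p1 l01 K0c K1c K0b K1b K0W K1W vB vc.
have [C [i [q [Cfree BC q1 qc qC]]]] := adapted_basis Bfree vB vc.
have [r0' [m0' K0b']] := body_change Bfree Cfree BC K0b.
have [r1' [m1' K1b']] := body_change Bfree Cfree BC K1b.
have l01' : 0 <= l <= 1 by case/andP: l01 => *; rewrite !ltW.
apply: (@moment_strict _ _ _ C Cfree k0 p l p1 l01' K0 K1 c0 c1 r0' r1' m0' m1' W
  K0c K1c K0b' K1b' K0W K1W i q (dotp q c1) q1 l01).
- by move=> x; rewrite /psi dotpDr qc add0r qC.
- by move=> x; rewrite /psi dotpDr qC.
Qed.

Lemma moment_line_eq_iff u K0 K1 (p l W : R) : enorm u = 1 -> 1 <= p -> 0 < l < 1 ->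
  compact K0 -> convex_set K0 -> (exists x y, [/\ K0 x, K0 y & x != y]) ->
  compact K1 -> convex_set K1 -> (exists x y, [/\ K1 x, K1 y & x != y]) ->
  K0 `<=` [set x | x \in <[u]>%VS] -> K1 `<=` [set x | x \in <[u]>%VS] ->
  hausdorff 1 K0 = W%:E -> hausdorff 1 K1 = W%:E ->
  (moment 1 p (interpolate K0 K1 l) + moment 1 p (interpolate K1 K0 l) =
   (`|2 * l - 1| `^ p)%:E * (moment 1 p K0 + moment 1 p K1))%E <->
  p = 1 /\ hyperplane_separates u 0 (interpolate K0 K1 l) (interpolate K1 K0 l).
Proof.
move=> u1 p1 l01 K0c K0v [x [y [K0x K0y xy]]] K1c K1v [x' [y' [K1x' K1y' xy']]] K0u K1u K0W K1W.
have [M0 _ K0M] := compact_enorm_bounded K0c.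
have [M1 _ K1M] := compact_enorm_bounded K1c.
have f0 := moment_fin p1 K0M K0c K0W.
have f1 := moment_fin p1 K1M K1c K1W.
have [a [b [ab K0E]]] := segment_compact_convex u1 K0c K0v K0u K0x K0y xy.
have [c [d [cd K1E]]] := segment_compact_convex u1 K1c K1v K1u K1x' K1y' xy'.
(* Equal measure means equal length, so that the second segment is the first one translated by c -
   a. *)
have bd : b - a = d - c.
  have kp := kappa_gt0 (unit_row_free u1) isT.
  apply: (mulfI (lt0r_neq0 kp)); move: K1W; rewrite -K0W K0E K1E !hausdorff_segment//.
  by case.
have cE : c = a + (c - a) by ring.
have dE : d = b + (c - a) by rewrite -[b in RHS](subrK a) bd; ring.
move: K1E f1; rewrite dE {1}cE; move: (c - a) => w -> f1; rewrite K0E in f0 *.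
have l01' : 0 <= l <= 1 by case/andP: l01 => *; rewrite !ltW.
rewrite moment_segments_eq_iff// segments_gap_separates//.
rewrite -(interpolateC (segment u a b)) !interpolate_segment//.
by case/andP: l01 => *; apply/andP; split; lra.
Qed.

End equality_case.

Unset Implicit Arguments.
Set Strict Implicit.
Set Printing Implicit Defensive.

Theorem theorem1p9 (R : realType) (n k : nat) (K0 K1 : set 'rV[R]_n) :
  convex_body K0 -> convex_body K1 ->
  has_dim K0 k -> has_dim K1 k -> (1 <= k)%N ->
  hausdorff k K0 = hausdorff k K1 ->
  parallel (affine_hull K0) (affine_hull K1) ->
  forall p l : R, 1 <= p -> 0 <= l <= 1 ->
    (moment k p (interpolate K0 K1 l) + moment k p (interpolate K0 K1 (1 - l))
      >= (`|2 * l - 1| `^ p)%:E * (moment k p K0 + moment k p K1))%E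
    /\
    ((moment k p (interpolate K0 K1 l) + moment k p (interpolate K0 K1 (1 - l))
      = (`|2 * l - 1| `^ p)%:E * (moment k p K0 + moment k p K1))%E
     <->
     (l = 0 \/ l = 1) \/
     (p = 1 /\
      exists u : 'rV[R]_n,
        [/\ enorm u = 1,
            K0 `<=` [set x | x \in <[u]>%VS],
            K1 `<=` [set x | x \in <[u]>%VS]
          & hyperplane_separates u 0
              (interpolate K0 K1 l) (interpolate K0 K1 (1 - l))])).
Proof.
move=> K0b K1b [c [V [K0V dimV]]] _ k0 K01 [c' [d [V' [K0V' K1V]]]] p l p1 l01.
have VV' : V = V' by apply: (@flat_direction _ _ c c'); rewrite -K0V.
rewrite -{}VV' {V' K0V'} in K1V; rewrite interpolateC.
have [B [c0 [r0 [m0 [Bfree BV K0B]]]]] := convex_body_chart K0b K0V dimV k0.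
have [B1 [c1 [r1 [m1 [B1free B1V K1B1]]]]] := convex_body_chart K1b K1V dimV k0.
have B1B : (B1 :=: B)%MS.
  apply/eqmxP; apply/andP; split; apply/row_subP => i.
    by rewrite -BV B1V row_sub.
  by rewrite -B1V BV row_sub.
have {r1 m1 B1free B1V B1B B1 K1B1} [r1 [m1 K1B]] := body_change B1free Bfree B1B K1B1.
have [W [K0W _]] := body_finite Bfree K0B.
have K1W : hausdorff k K1 = W%:E by rewrite -K01.
have [K00 K0v K0c] := K0b; have [K10 K1v K1c] := K1b.
have [M0 _ K0M] := compact_enorm_bounded K0c.
have [M1 _ K1M] := compact_enorm_bounded K1c.
have f0 := moment_fin p1 K0M K0c K0W.
have f1 := moment_fin p1 K1M K1c K1W.
have rhsE : ((`|2 * l - 1| `^ p)%:E * (moment k p K0 + moment k p K1) =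
    (`|2 * l - 1| `^ p * (fine (moment k p K0) + fine (moment k p K1)))%:E)%E.
  by rewrite EFinM EFinD !fineK.
split; first by rewrite rhsE; exact: (moment_ineq Bfree k0 p1 l01 K0c K1c K0B K1B K0W K1W).
have [l0|l0] := eqVneq l 0.
  split=> _; first by left; left.
  by rewrite l0 !interpolate0// mulr0 sub0r normrN normr1 powR1 mul1e.
have [l1|l1] := eqVneq l 1.
  split=> _; first by left; right.
  rewrite l1 -(subr0 1) !interpolateC !interpolate0// subr0 mulr1.
  by rewrite [2]mulr2n addrK normr1 powR1 mul1e addeC.
have {l0 l1} l01' : 0 < l < 1.
  by case/andP: l01 => h0 h1; rewrite !lt_neqAle h0 h1 l1 eq_sym l0.
have K0two := body_two_points k0 Bfree K0B.
have K1two := body_two_points k0 Bfree K1B.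
split=> [e|[[l0|l1]|[p1' [u [u1 K0u K1u sep]]]]]; last 3 first.
- by rewrite l0 ltxx in l01'.
- by rewrite l1 ltxx andbF in l01'.
(* Bodies contained in a line have a direction space of dimension at most 1, and k is positive. *)
- have k1 : k = 1%N.
    apply/eqP; rewrite eqn_leq k0 andbT -dimV.
    have [y K0y] := K00.
    have : (V <= <[u]>)%VS.
      by apply: (affine_hull_direction_sub K0V K0y) => x K0x; rewrite rpredB//; exact: K0u.
    by move/dimvS/leq_trans; apply; rewrite dim_vline; case: (u != 0).
  move: K0W K1W; rewrite k1 => K0W K1W.
  by apply/(moment_line_eq_iff u1 p1 l01' K0c K0v K0two K1c K1v K1two K0u K1u K0W K1W).
right.
(* A row of [B] that is not a multiple of [c0] would make the inequality strict; hence [B] has rank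
   1. *)
have sub0 : (B <= c0)%MS.
  apply/row_subP => i; apply/negPn/negP => vc.
  have := moment_strict_transversal Bfree k0 p1 l01' K0c K1c K0B K1B K0W K1W (row_sub i B) vc.
  by rewrite -rhsE -e ltxx.
(* The same argument with the two bodies exchanged, under which both sides of the inequality are
   symmetric. *)
have sub1 : (B <= c1)%MS.
  apply/row_subP => i; apply/negPn/negP => vc.
  have := moment_strict_transversal Bfree k0 p1 l01' K1c K0c K1B K0B K1W K0W (row_sub i B) vc.
  by rewrite (addrC (fine _)) addeC -rhsE -e ltxx.
have k1 : k = 1%N.
  apply/eqP; rewrite eqn_leq k0 andbT -(eqP Bfree) (leq_trans (mxrankS sub0))//.
  exact: rank_leq_row.
clear dimV; subst k.
(* Equality of ranks reverses the inclusion: the base point lies in the direction space, so the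
   affine hull passes through the origin. *)
have c0B : (c0 <= B)%MS.
  by rewrite -(geq_leqif (mxrank_leqif_sup sub0)) (eqP Bfree) rank_leq_row.
have c1B : (c1 <= B)%MS.
  by rewrite -(geq_leqif (mxrank_leqif_sup sub1)) (eqP Bfree) rank_leq_row.
have B0 : 0 < enorm B.
  rewrite lt_neqAle enorm_ge0 andbT eq_sym enorm_eq0; apply/eqP => B0.
  by move/eqP: Bfree; rewrite B0 mxrank0.
pose u := (enorm B)^-1 *: B.
have u1 : enorm u = 1.
  by rewrite enormZ ger0_norm ?invr_ge0 ?enorm_ge0// mulVf// lt0r_neq0.
have Bu v : (v <= B)%MS -> v \in <[u]>%VS.
  move=> /submxP[x ->]; apply/vlineP; exists (x ord0 ord0 * enorm B).
  by rewrite /u scalerA mulfK ?lt0r_neq0// [in LHS](mx11_scalar x) mul_scalar_mx.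
have K0u : K0 `<=` [set x | x \in <[u]>%VS].
  case: K0B => _ _ _ _ sub x /sub[y _ <-] /=; apply: Bu; exact: addmx_sub c0B (submxMl _ _).
have K1u : K1 `<=` [set x | x \in <[u]>%VS].
  case: K1B => _ _ _ _ sub x /sub[y _ <-] /=; apply: Bu; exact: addmx_sub c1B (submxMl _ _).
have /(moment_line_eq_iff u1 p1 l01' K0c K0v K0two K1c K1v K1two K0u K1u K0W K1W)[-> sep] := e.
by split=> //; exists u.
Qed.
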